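(* Let $k$ be an algebraically closed field of characteristic $p\ge0$ and let $X\subset\mathbb{P}^3_k$ be a nonsingular cubic surface. The number of octanomial parameters of $X$, i.e. the number of tuples $(a_0,a_1,a_2,a_3)\in k^4$ such that $X$ is projectively isomorphic to the surface $$x_0x_1(x_0 + x_1 + a_3x_2 + a_2x_3) + x_2x_3(a_1x_0 + a_0x_1 + x_2+x_3) = 0,$$ equals $25920/|\mathrm{Aut}(X)|$ if $p\neq3$, and $8640/|\mathrm{Aut}(X)|$ if $p=3$.
   Context: $\mathrm{Aut}(X)$ is the automorphism group of $X$ (a finite group, embedded in $\mathrm{PGL}_4(k)$ via the anticanonical embedding). Two surfaces in $\mathbb{P}^3_k$ are projectively isomorphic if some element of $\mathrm{PGL}_4(k)$ maps one onto the other. *)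

(* Defs.v *)
From mathcomp Require Import all_boot all_order all_algebra.
From mathcomp Require Import finmap.
From mathcomp Require Import boolp classical_sets functions cardinality.
From mathcomp Require Import mpoly.

Set Implicit Arguments.
Unset Strict Implicit.
Unset Printing Implicit Defensive.

Import GRing.Theory.
Local Open Scope classical_set_scope.
Local Open Scope ring_scope.

(* The class of u modulo multiplication by k^*. *)
Definition scalar_class (k : fieldType) (V : lmodType k) (u : V) : set V :=
  [set c *: u | c in [set c | c != 0]].

(* PGL_4(k) = GL_4(k) / k^*, an element being a coset, i.e. a set of matrices. *)
Definition PGL4 (k : fieldType) : set (set 'M[k]_4) :=
  [set scalar_class A | A in [set A : 'M[k]_4 | A \in unitmx]].

(* Action on points of P^3(k) = (k^4 \ {0}) / k^*: a point is a coset of nonzero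
   column vectors, and [A] . [v] = [A v] is the elementwise product of cosets. *)
Definition pgl_act (k : fieldType) (g : set 'M[k]_4) (x : set 'cV[k]_4) :
    set 'cV[k]_4 :=
  [set A *m v | A in g & v in x].

Definition surface (k : fieldType) (F : {mpoly k[4]}) : set (set 'cV[k]_4) :=
  [set scalar_class v | v in
    [set v : 'cV[k]_4 | v != 0 /\ F.@[fun i => v i ord0] = 0]].

(* F is tested together with its partial derivatives because Euler's relation
   3 F = sum_i x_i dF/dx_i gives nothing in characteristic 3. *)
Definition nonsingular (k : fieldType) (F : {mpoly k[4]}) : Prop :=
  forall v : 'cV[k]_4, v != 0 -> F.@[fun i => v i ord0] = 0 ->
    exists i : 'I_4, (F^`M(i)).@[fun j => v j ord0] != 0.

Definition projectively_isomorphic (k : fieldType)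
    (X Y : set (set 'cV[k]_4)) : Prop :=
  exists2 g, PGL4 g & pgl_act g @` X = Y.

(* The anticanonical embedding of a nonsingular cubic surface is its inclusion
   in P^3, so its automorphisms are the elements of PGL_4(k) that preserve it. *)
Definition surface_Aut (k : fieldType) (X : set (set 'cV[k]_4)) :
    set (set 'M[k]_4) :=
  [set g | PGL4 g /\ pgl_act g @` X = X].

Definition octanomial (k : fieldType) (a : k * k * k * k) : {mpoly k[4]} :=
  let: (a0, a1, a2, a3) := a in
  let x0 : {mpoly k[4]} := 'X_(inord 0) in
  let x1 : {mpoly k[4]} := 'X_(inord 1) in
  let x2 : {mpoly k[4]} := 'X_(inord 2) in
  let x3 : {mpoly k[4]} := 'X_(inord 3) in
  x0 * x1 * (x0 + x1 + a3 *: x2 + a2 *: x3)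
  + x2 * x3 * (a1 *: x0 + a0 *: x1 + x2 + x3).

Definition octanomial_parameters (k : fieldType) (X : set (set 'cV[k]_4)) :
    set (k * k * k * k) :=
  [set a | projectively_isomorphic X (surface (octanomial a))].

(* Main.v *)
Require Import Defs.
From mathcomp Require Import all_boot all_order all_algebra all_field.
From mathcomp Require Import finmap.
From mathcomp Require Import boolp classical_sets functions cardinality.
From mathcomp Require Import mpoly.
From mathcomp Require Import ring.

Set Implicit Arguments.
Unset Strict Implicit.
Unset Printing Implicit Defensive.

Import GRing.Theory.
Local Open Scope ring_scope.

(* An octanomial equation of X amounts to a basis b of k^4, up to a common scalar,
   whose points form a skew quadrilateral b0 b2 b1 b3 of lines of X, with
   D(b0, b1) = D(b1, b0) = D(b2, b3) = D(b3, b2), where D(u, v) is the derivative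
   at u in the direction v.  These four values are nonzero because X is nonsingular,
   and rescaling the vertices of a given quadrilateral leaves the choice of a cube
   root: three bases, or one in characteristic 3.  A quadrilateral is a pair of skew
   lines together with an ordered pair of transversals, so there are
   27 * 16 * 5 * 4 = 8640 of them.  Aut(X) acts simply transitively on the bases
   giving the same parameters, because a cubic form meeting some line in three
   distinct points is determined by its zeros.

   The line count is characteristic free.  The planes through a line that contain a
   second line are the zeros of a binary quintic, half the discriminant of the
   residual conic, and nonsingularity makes these zeros simple.  That there is a line
   at all comes from a specialization argument: some perturbation F + e of F,
   with algebraically independent coefficients over a field K, contains an obvious
   line; sending these coefficients to 0 extends to a place of K with values in k,
   and the reduction of the line lies on X. *)

(** * Counting *)

(** Characteristics 2 and 3 shape the encoding. Symmetrizing a cubic form divides by 6, so the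
    equation is carried by an arbitrary trilinear [C], and arguments use only [cubic], [polar1] and
    [polar2], the coefficients in the expansion of the form at a sum. The formula comes from
    counting one set in two ways: the classes in PGL_4(k) that carry X onto some octanomial surface.
    Sorted by quadrilateral, it has 8640 times 3 (or 1) elements; sorted by parameters, its nonempty
    fibres are cosets of Aut(X). The second sorting makes sense because an octanomial surface
    determines its parameters: its form is known up to a factor, and D(e0, e1) = 1 fixes the factor.
    Only the product of the two wanted numbers is computed, and the finiteness of Aut(X) is a
    by-product, not an input. For the existence of a line, finding one on a given surface means
    solving four equations in four unknowns. The proof solves nothing: the four coordinates of the
    line are taken as variables, and the coefficients of the perturbation are computed from them.
    What remains is their algebraic independence, which is visible on leading terms. *)

Definition has_card (T : choiceType) (A : set T) (n : nat) : Prop :=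
  exists s : seq T, [/\ uniq s, size s = n & forall x, A x <-> x \in s].

Section HasCard.
Local Open Scope classical_set_scope.
Local Open Scope ring_scope.
Implicit Types T U : choiceType.

Lemma has_card_ext T (A B : set T) n :
  (forall x, A x <-> B x) -> has_card A n -> has_card B n.
Proof.
move=> AB [s [us ss sA]]; exists s; split=> // x.
by rewrite -sA; split=> /AB.
Qed.

Lemma has_card_unique T (A : set T) n m : has_card A n -> has_card A m -> n = m.
Proof.
move=> [s [us <- sA]] [r [ur <- rA]]; apply/eqP.
rewrite -uniq_size_uniq //; by move=> x; apply/idP/idP => [/rA/sA|/sA/rA].
Qed.

Lemma has_card_image T U (f : T -> U) (A : set T) n :
    {in A &, injective f} -> has_card A n -> has_card (f @` A) n.
Proof.
move=> fI [s [us <- sA]]; exists (map f s); split; last 1 first.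
- move=> y; split=> [[x /sA xs <-]|/mapP[x /sA xs ->]]; first exact: map_f.
  by exists x.
- by rewrite map_inj_in_uniq // => x y /sA xA /sA yA; apply: fI; rewrite inE.
- by rewrite size_map.
Qed.

Lemma has_card_sub T (A B : set T) n :
  (forall x, B x -> A x) -> has_card A n -> exists m, has_card B m.
Proof.
move=> BA [s [us _ sA]].
exists (size [seq x <- s | `[< B x >]]), [seq x <- s | `[< B x >]].
split; rewrite ?filter_uniq // => x; rewrite mem_filter.
split=> [Bx|/andP[/asboolP //]].
by apply/andP; split; [apply/asboolP | apply/sA/BA].
Qed.

Lemma has_cardU T (A B : set T) n m :
    (forall x, A x -> B x -> False) ->
  has_card A n -> has_card B m -> has_card (fun x => A x \/ B x) (n + m)%N.
Proof.
move=> AB [s [us <- sA]] [r [ur <- rB]]; exists (s ++ r); split.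
- rewrite cat_uniq us ur andbT /=; apply/hasPn => x /rB Bx.
  by apply/negP => /sA /AB.
- by rewrite size_cat.
- move=> x; rewrite mem_cat; split=> [[/sA -> //|/rB ->]|]; first by rewrite orbT.
  by case/orP => [/sA|/rB]; [left|right].
Qed.

Lemma has_cardD T (A B : set T) n m :
    (forall x, B x -> A x) ->
  has_card A n -> has_card B m -> has_card (fun x => A x /\ ~ B x) (n - m)%N.
Proof.
move=> BA cA cB.
have [l cD] := has_card_sub (B := fun x => A x /\ ~ B x) (fun x h => h.1) cA.
suff -> : (n - m = l)%N by [].
have /has_card_unique/(_ cA) <- : has_card A (l + m)%N; last by rewrite addnK.
apply: has_card_ext (has_cardU _ cD cB) => [x|x [_]] //.
by split=> [[[]|/BA]//|Ax]; have [|] := pselect (B x); [right|left].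
Qed.

Lemma has_card1 T (a : T) : has_card (fun x => x = a) 1.
Proof.
exists [:: a]; split=> // x; rewrite inE; split=> [->|/eqP //].
by rewrite eqxx.
Qed.

Lemma has_cardD1 T (A : set T) a n :
  A a -> has_card A n -> has_card (fun x => A x /\ x <> a) n.-1.
Proof.
move=> Aa cA; rewrite -subn1.
by apply: has_cardD (has_card1 a) => // x ->.
Qed.

Lemma has_card_fib T U (f : T -> U) (A : set T) (P : set U) n c :
    (forall x, A x -> P (f x)) -> has_card P n ->
    (forall y, P y -> has_card (fun x => A x /\ f x = y) c) ->
  has_card A (n * c)%N.
Proof.
move=> AP [s [us <- sP]].
(* [A] is generalized with the list: the induction step removes from [A] the fibre over the head
   [y]. *)
elim: s => [|y s IHs] in A P us sP AP * => fib.
  by exists [::]; split=> // x; split=> [/AP/sP|].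
move: us => /= /andP[ys us].
have := has_cardU (A := fun x => A x /\ f x = y)
  (B := fun x => A x /\ f x <> y) (n := c) (m := (size s * c)%N).
rewrite mulSn => H; apply: has_card_ext (H _ _ _).
- by move=> x; split=> [[[]|[]]//|Ax]; have [|] := pselect (f x = y); [left|right].
- by move=> x [_ fx] [_]; rewrite fx.
- by apply: fib; apply/sP; rewrite inE eqxx.
apply: (IHs _ (fun z => z \in s)) => //.
- move=> x [Ax fxy]; move/AP/sP: (Ax); rewrite inE => /orP[/eqP//|].
  by [].
- move=> z zs; have /fib : P z by apply/sP; rewrite inE zs orbT.
  apply: has_card_ext => x; split=> [[Ax fxz]|[[]]//].
  by split=> //; split=> //; rewrite fxz => zy; rewrite -zy zs in ys.
Qed.

Lemma has_card_onto T U (f : T -> U) (A : set T) n :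
  has_card A n -> exists m, has_card (f @` A) m.
Proof.
move=> [s [us _ sA]]; exists (size (undup (map f s))), (undup (map f s)).
split; rewrite ?undup_uniq // => y; rewrite mem_undup.
split=> [[x /sA xs <-]|/mapP[x /sA xs ->]]; first exact: map_f.
by exists x.
Qed.

(** A relational form of fibre counting, for data read off a chosen representative (here a matrix in
    a projective class), where uniqueness of the value is proved afterwards. *)
Lemma has_card_rel T U (R : T -> U -> Prop) (A : set T) (P : set U) n c :
    (forall x, A x -> exists2 y, P y & R x y) ->
    (forall x y z, A x -> P y -> P z -> R x y -> R x z -> y = z) ->
    has_card P n ->
    (forall y, P y -> has_card (fun x => A x /\ R x y) c) ->
  has_card A (n * c)%N.
Proof.
move=> tot fct cP fib.
(* Extracting a function from [R] needs a default value outside [A]. If [P] is empty there is none,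
   but then [A] is empty by totality and [n] is 0. *)
have [[a0 Pa0]|P0] := pselect (exists a, P a); last first.
  have [s [us ss sP]] := cP; exists [::]; split=> //; last first.
    by move=> x; split=> // /tot[y Py]; case: P0; exists y.
  case: s ss sP {us} => [<-//|y s _ sP]; case: P0; exists y.
  by apply/sP; rewrite inE eqxx.
have : forall x, exists y, A x -> P y /\ R x y.
  move=> x; have [/tot[y Py xy]|nA] := pselect (A x); first by exists y.
  by exists a0.
move=> /choice[f fP]; apply: (has_card_fib (f := f) _ cP) => [x /fP[]//|y Py].
apply: has_card_ext (fib y Py) => x.
split=> -[Ax]; last by move=> <-; split=> //; have [] := fP _ Ax.
by move=> xy; split=> //; apply: (fct x) => //; have [] := fP _ Ax.
Qed.

Lemma has_card_finite T (A : set T) n :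
  has_card A n -> finite_set A /\ #|` fset_set A| = n.
Proof.
move=> [s [us ss sA]].
have -> : A = [set` [fset x in s]%fset].
  by apply/seteqP; split=> x /=; rewrite inE => /sA.
split; first exact: finite_fset.
by rewrite set_fsetK -ss -[in RHS](undup_id us) -card_fseq.
Qed.

End HasCard.

(** * Cubic forms and their polars *)

(** No symmetry is required, so every cubic form comes from such a [C] in any characteristic. *)
Record trilinear (k : pzRingType) (V : lmodType k) (C : V -> V -> V -> k) : Prop :=
  Trilinear {
    trilinear1 : forall a u u' v w, C (a *: u + u') v w = a * C u v w + C u' v w;
    trilinear2 : forall a u u' v w, C v (a *: u + u') w = a * C v u w + C v u' w;
    trilinear3 : forall a u u' v w, C v w (a *: u + u') = a * C v w u + C v w u' }.

Section Polars.
Variables (k : comPzRingType) (V : lmodType k) (C : V -> V -> V -> k).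

Definition cubic (v : V) := C v v v.
Definition polar1 (v w : V) := C w v v + C v w v + C v v w.
(** The coefficient of x y z in [cubic C] at x u + y v + z w. It is symmetric, but on a repeated
    argument it gives 2 [polar1], so in characteristic 2 it does not determine [polar1]; both are
    kept. *)
Definition polar2 (u v w : V) :=
  C u v w + C u w v + C v u w + C v w u + C w u v + C w v u.

Hypothesis triC : trilinear C.

Lemma trilinearD1 u u' v w : C (u + u') v w = C u v w + C u' v w.
Proof. by rewrite -[u]scale1r trilinear1 // mul1r scale1r. Qed.
Lemma trilinearD2 u u' v w : C v (u + u') w = C v u w + C v u' w.
Proof. by rewrite -[u]scale1r trilinear2 // mul1r scale1r. Qed.
Lemma trilinearD3 u u' v w : C v w (u + u') = C v w u + C v w u'.
Proof. by rewrite -[u]scale1r trilinear3 // mul1r scale1r. Qed.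
Lemma trilinear01 v w : C 0 v w = 0.
Proof. by apply: (addrI (C 0 v w)); rewrite -trilinearD1 !addr0. Qed.
Lemma trilinear02 v w : C v 0 w = 0.
Proof. by apply: (addrI (C v 0 w)); rewrite -trilinearD2 !addr0. Qed.
Lemma trilinear03 v w : C v w 0 = 0.
Proof. by apply: (addrI (C v w 0)); rewrite -trilinearD3 !addr0. Qed.
Lemma trilinearZ1 a u v w : C (a *: u) v w = a * C u v w.
Proof. by rewrite -[a *: u]addr0 trilinear1 // trilinear01 addr0. Qed.
Lemma trilinearZ2 a u v w : C v (a *: u) w = a * C v u w.
Proof. by rewrite -[a *: u]addr0 trilinear2 // trilinear02 addr0. Qed.
Lemma trilinearZ3 a u v w : C v w (a *: u) = a * C v w u.
Proof. by rewrite -[a *: u]addr0 trilinear3 // trilinear03 addr0. Qed.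

Definition trilinearE := (trilinearD1, trilinearD2, trilinearD3,
  trilinearZ1, trilinearZ2, trilinearZ3, trilinear01, trilinear02, trilinear03).

Lemma cubicD u v : cubic (u + v) = cubic u + polar1 u v + polar1 v u + cubic v.
Proof. by rewrite /cubic /polar1 !trilinearE; ring. Qed.
Lemma cubicZ a u : cubic (a *: u) = a ^+ 3 * cubic u.
Proof. by rewrite /cubic !trilinearE; ring. Qed.
Lemma cubic0 : cubic 0 = 0.
Proof. by rewrite /cubic !trilinearE. Qed.
Lemma polar1Dl u v w : polar1 (u + v) w = polar1 u w + polar2 u v w + polar1 v w.
Proof. by rewrite /polar1 /polar2 !trilinearE; ring. Qed.
Lemma polar1Zl a u w : polar1 (a *: u) w = a ^+ 2 * polar1 u w.
Proof. by rewrite /polar1 !trilinearE; ring. Qed.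
Lemma polar10l w : polar1 0 w = 0.
Proof. by rewrite /polar1 !trilinearE !addr0. Qed.
Lemma polar1Dr u v w : polar1 w (u + v) = polar1 w u + polar1 w v.
Proof. by rewrite /polar1 !trilinearE; ring. Qed.
Lemma polar1Zr a u w : polar1 w (a *: u) = a * polar1 w u.
Proof. by rewrite /polar1 !trilinearE; ring. Qed.
Lemma polar10r w : polar1 w 0 = 0.
Proof. by rewrite /polar1 !trilinearE !addr0. Qed.
Lemma polar1vv u : polar1 u u = 3%:R * cubic u.
Proof. by rewrite /polar1 /cubic; ring. Qed.
Lemma polar2C u v w : polar2 u v w = polar2 v u w.
Proof. by rewrite /polar2; ring. Qed.
Lemma polar2AC u v w : polar2 u v w = polar2 u w v.
Proof. by rewrite /polar2; ring. Qed.
Lemma polar2Dr u v w x : polar2 u v (w + x) = polar2 u v w + polar2 u v x.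
Proof. by rewrite /polar2 !trilinearE; ring. Qed.
Lemma polar2Dm u v w x : polar2 u (w + x) v = polar2 u w v + polar2 u x v.
Proof. by rewrite /polar2 !trilinearE; ring. Qed.
Lemma polar2Dl u v w x : polar2 (w + x) u v = polar2 w u v + polar2 x u v.
Proof. by rewrite /polar2 !trilinearE; ring. Qed.
Lemma polar2Zr a u v w : polar2 u v (a *: w) = a * polar2 u v w.
Proof. by rewrite /polar2 !trilinearE; ring. Qed.
Lemma polar2Zm a u v w : polar2 u (a *: v) w = a * polar2 u v w.
Proof. by rewrite /polar2 !trilinearE; ring. Qed.
Lemma polar2Zl a u v w : polar2 (a *: u) v w = a * polar2 u v w.
Proof. by rewrite /polar2 !trilinearE; ring. Qed.
Lemma polar2uuv u v : polar2 u u v = 2%:R * polar1 u v.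
Proof. by rewrite /polar1 /polar2; ring. Qed.
Lemma polar2uvu u v : polar2 u v u = 2%:R * polar1 u v.
Proof. by rewrite /polar1 /polar2; ring. Qed.
Lemma polar2vuu u v : polar2 v u u = 2%:R * polar1 u v.
Proof. by rewrite /polar1 /polar2; ring. Qed.

Definition polarE := (cubicD, cubicZ, cubic0, polar1Dl, polar1Zl, polar10l,
  polar1Dr, polar1Zr, polar10r, polar1vv, polar2Dr, polar2Dm, polar2Dl,
  polar2Zr, polar2Zm, polar2Zl, polar2uuv, polar2uvu, polar2vuu).

End Polars.

(** * Subspaces of small dimension *)

Section Subspaces.
Variables (k : fieldType) (V : vectType k).
Implicit Types (u v w x : V) (U W : {vspace V}).

Lemma dim_addv_line U x : \dim (U + <[x]>) = (\dim U + (x \notin U))%N.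
Proof.
have [xU|xU] := boolP (x \in U).
  by rewrite addn0 (addv_idPl _) // -memvE.
have -> : ~~ false = true by [].
rewrite dimv_disjoint_sum ?dim_vline.
  by case: eqP xU => // ->; rewrite mem0v.
apply/eqP; rewrite -subv0; apply/subvP => y; rewrite memv_cap memv0.
case/andP => yU /vlineP[a ya]; move: yU; rewrite ya.
have [->|a0 /(memvZ a^-1)] := eqVneq a 0; first by rewrite scale0r.
by rewrite scalerA mulVf // scale1r (negPf xU).
Qed.

Lemma mem_addv_lineP U x y :
  reflect (exists2 u, u \in U & exists a : k, y = u + a *: x) (y \in U + <[x]>)%VS.
Proof.
apply: (iffP memv_addP) => [[u uU [_ /vlineP[a ->] ->]]|[u uU [a ->]]].
  by exists u => //; exists a.
by exists u => //; exists (a *: x) => //; rewrite memvZ ?memv_line.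
Qed.

Lemma mem_pairP u v y :
  reflect (exists a b : k, y = a *: u + b *: v) (y \in <[u]> + <[v]>)%VS.
Proof.
apply: (iffP (mem_addv_lineP _ _ _)) => [[_ /vlineP[a ->] [b ->]]|[a [b ->]]].
  by exists a, b.
by exists (a *: u); [rewrite memvZ ?memv_line | exists b].
Qed.

Lemma mem_tripleP u v w y :
  reflect (exists a b c : k, y = a *: u + b *: v + c *: w)
    (y \in <[u]> + <[v]> + <[w]>)%VS.
Proof.
apply: (iffP (mem_addv_lineP _ _ _)) => [[_ /mem_pairP[a [b ->]] [c ->]]|].
  by exists a, b, c.
move=> [a [b [c ->]]]; exists (a *: u + b *: v); last by exists c.
by apply/mem_pairP; exists a, b.
Qed.

Lemma exists_notin U n : \dim U = n -> (n < \dim {:V})%N -> exists x, x \notin U.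
Proof.
move=> dU n4; have /subvPn[x _ xU] : ~~ ({:V} <= U)%VS.
  by apply/negP => /dimvS; rewrite dU leqNgt n4.
by exists x.
Qed.

Lemma dim_pair u v : \dim (<[u]> + <[v]>) = ((u != 0%R) + (v \notin <[u]>%VS))%N.
Proof. by rewrite dim_addv_line dim_vline. Qed.

Lemma dim2_basis U u : \dim U = 2%N -> u != 0 -> u \in U ->
  exists2 v, v \notin <[u]>%VS & U = (<[u]> + <[v]>)%VS.
Proof.
move=> dU u0 uU; have /subvPn[v vU vu] : ~~ (U <= <[u]>)%VS.
  by apply/negP => /dimvS; rewrite dU dim_vline u0.
exists v => //; apply/eqP; rewrite eq_sym eqEdim subv_add -!memvE uU vU.
by rewrite dim_pair u0 vu dU.
Qed.

Lemma dim_pos_neq0 U n : \dim U = n.+1 -> exists2 u, u \in U & u != 0.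
Proof.
move=> dU; exists (vpick U); rewrite ?memv_pick // vpick0 -dimv_eq0 dU.
by [].
Qed.

Lemma pair_neq0 u v a b : \dim (<[u]> + <[v]>) = 2%N -> (a != 0) || (b != 0) ->
  a *: u + b *: v != 0.
Proof.
rewrite dim_pair; case u0: (u != 0); case vu: (v \notin _) => //= _.
move: u0 vu => u0 vu; apply: contraL => /eqP uv0.
have [b0|b0] := eqVneq b 0.
  move/eqP: uv0; rewrite b0 scale0r addr0 scaler_eq0 (negPf u0) orbF => /eqP->.
  by rewrite eqxx.
case/negP: vu; apply/vlineP; exists (- (a / b)).
apply: (scalerI b0); rewrite scalerA mulrN mulrCA divff // mulr1.
by apply/eqP; rewrite scaleNr -addr_eq0 addrC uv0.
Qed.

Lemma in_pair_l u v : u \in (<[u]> + <[v]>)%VS.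
Proof. by rewrite (subvP (addvSl _ _)) ?memv_line. Qed.
Lemma in_pair_r u v : v \in (<[u]> + <[v]>)%VS.
Proof. by rewrite (subvP (addvSr _ _)) ?memv_line. Qed.
Lemma in_triple_l u v w : u \in (<[u]> + <[v]> + <[w]>)%VS.
Proof. by rewrite (subvP (addvSl _ _)) ?in_pair_l. Qed.
Lemma in_triple_m u v w : v \in (<[u]> + <[v]> + <[w]>)%VS.
Proof. by rewrite (subvP (addvSl _ _)) ?in_pair_r. Qed.

Lemma dim_triple u v w : \dim (<[u]> + <[v]> + <[w]>) = 3%N ->
  \dim (<[u]> + <[v]>) = 2%N /\ w \notin (<[u]> + <[v]>)%VS.
Proof.
have duv : (\dim (<[u]> + <[v]>) <= 2%N)%N.
  by rewrite dim_pair; case: (u != 0); case: (v \notin _).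
rewrite dim_addv_line; case: (w \notin _); rewrite ?addn0 ?addn1 => h.
  by case: h.
by rewrite h in duv.
Qed.

Lemma triple_free u v w a b c : \dim (<[u]> + <[v]> + <[w]>) = 3%N ->
  a *: u + b *: v + c *: w = 0 -> [/\ a = 0, b = 0 & c = 0].
Proof.
move=> /dim_triple[duv wuv] e; have c0 : c = 0.
  apply: contraNeq wuv => c0; apply/mem_pairP; exists (- (a / c)), (- (b / c)).
  apply: (scalerI c0); rewrite scalerDr !scalerA !mulrN !(mulrCA c) divff // !mulr1.
  by apply/eqP; rewrite !scaleNr -opprD -addr_eq0 addrC e.
move: e; rewrite c0 scale0r addr0 => /eqP e.
have [h|h] := boolP ((a != 0) || (b != 0)).
  by rewrite (negPf (pair_neq0 duv h)) in e.
by move: h; rewrite negb_or !negbK => /andP[/eqP -> /eqP ->].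
Qed.

Lemma triple_inj u v w a b c a' b' c' : \dim (<[u]> + <[v]> + <[w]>) = 3%N ->
  a *: u + b *: v + c *: w = a' *: u + b' *: v + c' *: w -> [/\ a = a', b = b' & c = c'].
Proof.
move=> d e; have : (a - a') *: u + (b - b') *: v + (c - c') *: w = 0.
  by rewrite !scalerBl [X in X + _]addrACA -opprD addrACA -opprD e subrr.
by case/(triple_free d) => /subr0_eq -> /subr0_eq -> /subr0_eq ->.
Qed.

Lemma kernel_line u v w (a b c : k) : \dim (<[u]> + <[v]> + <[w]>) = 3%N ->
    [|| a != 0, b != 0 | c != 0] ->
  exists n : {vspace V}, [/\ \dim n = 2%N, (n <= <[u]> + <[v]> + <[w]>)%VS &
    forall x y z : k, x *: u + y *: v + z *: w \in n <-> x * a + y * b + z * c = 0].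
Proof.
move=> d abc.
have key s t : s \in (<[u]> + <[v]> + <[w]>)%VS -> t \in (<[u]> + <[v]> + <[w]>)%VS ->
  (forall x y : k, x *: s + y *: t = 0 -> x = 0 /\ y = 0) ->
  (forall x y z : k, x *: u + y *: v + z *: w \in (<[s]> + <[t]>)%VS <->
     x * a + y * b + z * c = 0) ->
  exists n : {vspace V}, [/\ \dim n = 2%N, (n <= <[u]> + <[v]> + <[w]>)%VS &
    forall x y z : k, x *: u + y *: v + z *: w \in n <-> x * a + y * b + z * c = 0].
  move=> sW tW fr iff; exists (<[s]> + <[t]>)%VS; split=> //; last first.
    by rewrite subv_add -!memvE sW tW.
  rewrite dim_pair; have -> : s != 0.
    apply/eqP => s0; have [|/eqP] := fr 1 0.
      by rewrite s0 scaler0 scale0r addr0.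
    by rewrite oner_eq0.
  suff -> : t \notin <[s]>%VS by [].
  apply/negP => /vlineP[e te].
  have [|_ /eqP] := fr (- e) 1; first by rewrite te scale1r scaleNr addNr.
  by rewrite oner_eq0.
have [a0|a0] := eqVneq a 0; last first.
  (* When a is nonzero, (b, -a, 0) and (c, 0, -a) are independent solutions of x a + y b + z c =
     0. *)
  apply: (key (b *: u + (- a) *: v + 0 *: w) (c *: u + 0 *: v + (- a) *: w)).
  - by apply/mem_tripleP; do 3!eexists.
  - by apply/mem_tripleP; do 3!eexists.
  - move=> x y; rewrite !scale0r !addr0 !scalerDr !scalerA addrACA -scalerDl addrA.
    case/(triple_free d) => _ /eqP + /eqP; rewrite !mulf_eq0 oppr_eq0 (negPf a0) !orbF.
    by move=> /eqP -> /eqP ->.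
  move=> x y z; split=> [/mem_pairP[s [t]]|h].
    rewrite !scale0r !addr0 !scalerDr !scalerA addrACA -scalerDl addrA.
    by case/(triple_inj d) => -> -> ->; ring.
  apply/mem_pairP; exists (- y / a), (- z / a).
  rewrite !scale0r !addr0 !scalerDr !scalerA addrACA -scalerDl addrA.
  have xE : x = - (y * b + z * c) / a.
    by apply: (canRL (mulfK a0)); apply/eqP; rewrite -subr_eq0 opprK addrA h eqxx.
  by congr (_ *: _ + _ *: _ + _ *: _); rewrite ?xE; field.
subst a; have [b0|b0] := eqVneq b 0; last first.
  apply: (key u (c *: v + (- b) *: w)); rewrite ?in_triple_l //.
  - by apply/mem_tripleP; exists 0, c, (- b); rewrite scale0r add0r.
  - move=> x y; rewrite scalerDr !scalerA addrA.
    case/(triple_free d) => -> _ /eqP; rewrite mulf_eq0 oppr_eq0 (negPf b0) orbF.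
    by move=> /eqP.
  move=> x y z; split=> [/mem_pairP[s [t]]|h].
    rewrite scalerDr !scalerA addrA.
    by case/(triple_inj d) => -> -> ->; ring.
  apply/mem_pairP; exists x, (- z / b).
  have yE : y = - (z * c) / b.
    apply: (canRL (mulfK b0)); apply/eqP.
    by rewrite -subr_eq0 opprK -[X in _ == X]h mulr0 add0r.
  by rewrite scalerDr !scalerA addrA; congr (_ *: _ + _ *: _ + _ *: _);
    rewrite ?yE; field.
subst b; rewrite eqxx /= in abc.
apply: (key u v); rewrite ?in_triple_l ?in_triple_m //.
  by move=> x y h; have [] := @triple_free u v w x y 0 d; rewrite // scale0r addr0.
move=> x y z; rewrite !mulr0 !add0r; split=> [/mem_pairP[s [t]]|/eqP].
  by rewrite -[RHS]addr0 -(scale0r w) => /(triple_inj d)[_ _ ->]; rewrite mul0r.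
rewrite mulf_eq0 (negPf abc) orbF => /eqP ->; apply/mem_pairP; exists x, y.
by rewrite scale0r addr0.
Qed.

Lemma eq_dim_subv U W : \dim U = \dim W -> (U <= W)%VS -> U = W.
Proof. by move=> dUW UW; apply/eqP; rewrite eqEdim UW dUW leqnn. Qed.

Lemma cap_neq0P U W :
  reflect (exists2 x, x != 0 & (x \in U) && (x \in W)) (U :&: W != 0)%VS.
Proof.
apply: (iffP idP) => [|[x x0 xUW]].
  by rewrite -vpick0 => p0; exists (vpick (U :&: W)); rewrite // -memv_cap memv_pick.
by apply: contraNneq x0 => UW0; rewrite -memv0 -UW0 memv_cap.
Qed.

End Subspaces.

(** * Roots over an algebraically closed field *)

Section ClosedField.
Variable k : closedFieldType.

Lemma root_of_size (p : {poly k}) : (size p > 1)%N -> exists x, p.[x] = 0.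
Proof.
move=> sp; have /closed_rootP[x /rootP] : size p != 1 by rewrite neq_ltn sp orbT.
by exists x.
Qed.

Lemma quadratic_root (a b c : k) : a != 0 -> exists x, a * x ^+ 2 + b * x + c = 0.
Proof.
move=> a0; have [|x] := @root_of_size (Poly [:: c; b; a]).
  by rewrite (@PolyK _ 0).
rewrite horner_Poly /= => h; exists x; rewrite -[RHS]h; ring.
Qed.

Lemma binary_quadratic_root (a b c : k) : exists x y : k,
  (x != 0) || (y != 0) /\ a * x ^+ 2 + b * x * y + c * y ^+ 2 = 0.
Proof.
have [->|a0] := eqVneq a 0; first by exists 1, 0; rewrite oner_eq0; split=> //; ring.
have [x h] := quadratic_root b c a0; exists x, 1; rewrite oner_eq0 orbT; split=> //.
by rewrite -[RHS]h; ring.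
Qed.

(** Euclid's argument: a root of X P - 1, with P the product of the X - z, is not a root of P. *)
Lemma exists_notin_seq (s : seq k) : exists x, x \notin s.
Proof.
have p0 : \prod_(z <- s) ('X - z%:P) != 0.
  by rewrite -size_poly_eq0 size_prod_XsubC.
have [|x] := @root_of_size ('X * \prod_(z <- s) ('X - z%:P) - 1).
  by rewrite size_polyDl ?size_polyN ?size_poly1 mulrC size_mulX // size_prod_XsubC.
rewrite !hornerE => h; exists x; apply/negP => xs.
have : (\prod_(z <- s) ('X - z%:P)).[x] = 0 by apply/rootP; rewrite root_prod_XsubC.
move=> h0; move/eqP: h; rewrite h0 mulr0 sub0r oppr_eq0 oner_eq0.
by [].
Qed.

End ClosedField.

(** * Lines on a nonsingular cubic surface *)

Definition nonsingular_form (k : comPzRingType) (V : lmodType k)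
    (C : V -> V -> V -> k) : Prop :=
  forall v, v != 0 -> cubic C v = 0 -> exists w, polar1 C v w != 0.

Definition on_cubic (k : fieldType) (V : vectType k) (C : V -> V -> V -> k)
    (U : {vspace V}) : Prop :=
  forall x, x \in U -> cubic C x = 0.

Definition is_line (k : fieldType) (V : vectType k) (C : V -> V -> V -> k)
    (U : {vspace V}) : Prop :=
  \dim U = 2%N /\ on_cubic C U.

Section Lines.
Variables (k : closedFieldType) (V : vectType k) (C : V -> V -> V -> k).
Hypothesis triC : trilinear C.
Hypothesis dimV : \dim {:V} = 4%N.
Hypothesis nsC : nonsingular_form C.
Local Notation f := (cubic C).
Local Notation D := (polar1 C).
Local Notation T := (polar2 C).
Implicit Types (u v w x y p r : V) (U W : {vspace V}).

(** On U the form at p + a x reduces to a D(p, x) + a^2 D(x, p). The values 1 and some t outside {0,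
    1} of a already force both coefficients to vanish. *)
Lemma polar1_on_cubic U p x : on_cubic C U -> p \in U -> x \in U -> D p x = 0.
Proof.
move=> fU pU xU; have [t] := exists_notin_seq [:: 0; 1 : k].
rewrite !inE negb_or => /andP[t0 t1].
have fE a : a * D p x + a ^+ 2 * D x p = 0.
  have := fU _ (memvD pU (memvZ a xU)).
  rewrite !(polarE triC) (fU p) // (fU x) // => h; rewrite -[RHS]h; ring.
have h1 : D x p = - D p x by apply/eqP; rewrite -addr_eq0 addrC -[X in _ == X](fE 1); apply/eqP; ring.
have := fE t; rewrite h1 => h; apply/eqP; apply: contraNT t1 => d0.
have : (t * (1 - t)) * D p x = 0 by rewrite -[RHS]h; ring.
by move/eqP; rewrite !mulf_eq0 (negPf t0) (negPf d0) orbF subr_eq0 eq_sym.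
Qed.

Lemma polar2_on_cubic U p x y :
  on_cubic C U -> p \in U -> x \in U -> y \in U -> T p x y = 0.
Proof.
move=> fU pU xU yU; have := polar1_on_cubic fU (memvD pU xU) yU.
rewrite (polarE triC) (polar1_on_cubic fU pU yU) (polar1_on_cubic fU xU yU).
by rewrite add0r addr0.
Qed.

Lemma on_cubic_pair u v : f u = 0 -> f v = 0 -> D u v = 0 -> D v u = 0 ->
  on_cubic C (<[u]> + <[v]>)%VS.
Proof.
move=> fu fv uv vu _ /mem_pairP[a [b ->]]; rewrite !(polarE triC) fu fv uv vu.
by rewrite !mulr0 !addr0.
Qed.

Lemma span4 W w x : \dim W = 3%N -> w \notin W -> exists2 y, y \in W & exists a : k, x = y + a *: w.
Proof.
move=> dW wW; apply/mem_addv_lineP; suff -> : (W + <[w]>)%VS = {:V}%VS by rewrite memvf.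
by apply: eq_dim_subv (subvf _); rewrite dim_addv_line dW wW dimV.
Qed.

(* Otherwise the gradient along U has its values in a line, and it would vanish
   at a zero of a binary quadratic form. *)
Lemma polar1_transverse U y : is_line C U -> y \notin U ->
  exists2 r, r \in U & D r y != 0.
Proof.
move=> [dU fU] yU; apply: contrapT => ny.
have Dy r : r \in U -> D r y = 0.
  by move=> rU; apply: contrapT => /eqP Dr; apply: ny; exists r.
have dW : \dim (U + <[y]>) = 3%N by rewrite dim_addv_line dU yU.
have [w wW] : exists w, w \notin (U + <[y]>)%VS.
  by apply: exists_notin dW _; rewrite dimV.
have [u uU u0] := dim_pos_neq0 dU.
have [v vu Uuv] := dim2_basis dU u0 uU.
have vU : v \in U by rewrite Uuv in_pair_r.
have [a [b [ab0 abE]]] := binary_quadratic_root (D u w) (T u v w) (D v w).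
pose r := a *: u + b *: v.
have rU : r \in U by rewrite memvD ?memvZ.
have r0 : r != 0 by apply: pair_neq0 => //; rewrite -Uuv.
have [x /eqP[]] := nsC r0 (fU _ rU).
have [_ /mem_addv_lineP[z zU [c ->]] [d ->]] := span4 x dW wW.
rewrite !(polar1Dr triC, polar1Zr triC) (polar1_on_cubic fU rU zU) (Dy _ rU).
suff -> : D r w = 0 by rewrite !mulr0 !addr0.
by rewrite /r !(polarE triC) -[RHS]abE; ring.
Qed.

(** By nonsingularity the linear form D(p, -) is nonzero, so its kernel, the tangent plane at p, is
    no larger than W. *)
Lemma tangent_mem W p x : p != 0 -> f p = 0 -> \dim W = 3%N ->
  (forall w, w \in W -> D p w = 0) -> D p x = 0 -> x \in W.
Proof.
move=> p0 fp dW DW Dx; apply: contraT => xW.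
have [y /eqP[]] := nsC p0 fp.
have [w /DW wW [a ->]] := span4 y dW xW.
by rewrite !(polarE triC) wW Dx mulr0 addr0.
Qed.

Lemma mem_dim1 U x y : (\dim U <= 1)%N -> x != 0 -> x \in U -> y \in U -> y \in <[x]>%VS.
Proof.
move=> dU x0 xU yU; suff <- : U = <[x]>%VS by [].
by apply/esym/eqP; rewrite eqEdim -memvE xU dim_vline x0.
Qed.

(** The coordinates c and b vanish on the two lines through p. The restriction of the form to their
    plane is b c times a linear form, the equation of the residual line. *)
Lemma cubic_two_lines p x y (a b c : k) :
    on_cubic C (<[p]> + <[x]>)%VS -> on_cubic C (<[p]> + <[y]>)%VS ->
  f (a *: p + b *: x + c *: y) =
    b * c * (a * T p x y + b * D x y + c * D y x).
Proof.
move=> fpx fpy; rewrite !(polarE triC).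
have [px py] := (@in_pair_l _ _ p x, @in_pair_l _ _ p y).
have [xp yp] := (@in_pair_r _ _ p x, @in_pair_r _ _ p y).
rewrite (fpx _ px) (fpx _ xp) (fpy _ yp).
rewrite (polar1_on_cubic fpx px xp) (polar1_on_cubic fpx xp px).
rewrite (polar1_on_cubic fpy py yp) (polar1_on_cubic fpy yp py).
ring.
Qed.

(** The third line is the kernel of the linear factor left by [cubic_two_lines]. Nonsingularity
    prevents this factor from vanishing on U or on W, so the three lines are distinct. *)
Lemma residual_line U W : is_line C U -> is_line C W -> U <> W ->
    (U :&: W != 0)%VS ->
  \dim (U + W) = 3%N /\ exists n, [/\ is_line C n, (n <= U + W)%VS, n <> U, n <> W &
    forall z, z \in (U + W)%VS -> f z = 0 -> [\/ z \in U, z \in W | z \in n]].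
Proof.
move=> lU lW UW /cap_neq0P[p p0 /andP[pU pW]].
have [[dU fU] [dW fW]] := (lU, lW).
have [x xp Ux] := dim2_basis dU p0 pU; have [y yp Wy] := dim2_basis dW p0 pW.
have UWE : (U + W = <[p]> + <[x]> + <[y]>)%VS.
  by rewrite Ux Wy addvA (addv_idPl (addvSl _ _)).
have yU : y \notin U.
  apply/negP => yU; apply: UW; apply: esym; apply: eq_dim_subv; rewrite ?dU //.
  by rewrite Wy subv_add -!memvE pU yU.
have xW : x \notin W.
  apply/negP => xW; apply: UW; apply: eq_dim_subv; rewrite ?dU //.
  by rewrite Ux subv_add -!memvE pW xW.
have d3 : \dim (<[p]> + <[x]> + <[y]>) = 3%N by rewrite dim_addv_line -Ux yU dU.
rewrite UWE; split=> //.
have fpx : on_cubic C (<[p]> + <[x]>)%VS by rewrite -Ux.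
have fpy : on_cubic C (<[p]> + <[y]>)%VS by rewrite -Wy.
have fE a b c := cubic_two_lines a b c fpx fpy.
(* For r = a p + b x on U, D(r, y) is b times the value of the linear factor at r. Hence a point of
   U with D(r, y) nonzero is off the third line; likewise s on W. *)
have [r] := polar1_transverse lU yU; rewrite {1}Ux => /mem_pairP[a [b rE]].
have [s] := polar1_transverse lW xW; rewrite {1}Wy => /mem_pairP[a' [c sE]].
have Dpy : D p y = 0 by apply: (polar1_on_cubic fW pW); rewrite Wy in_pair_r.
have Dpx : D p x = 0 by apply: (polar1_on_cubic fU pU); rewrite Ux in_pair_r.
rewrite rE sE !(polarE triC) Dpx Dpy !mulr0 !add0r.
rewrite (polar2AC C p y x) => sx ry.
have [|n [dn nW nE]] := @kernel_line _ _ p x y (T p x y) (D x y) (D y x) d3.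
  apply: contraNT ry; rewrite !negb_or !negbK => /and3P[/eqP -> /eqP -> _].
  by rewrite !mulr0 addr0.
exists n; split=> //.
- split=> // z zn; have /mem_tripleP[e [g [h zE]]] := subvP nW z zn.
  by rewrite zE fE; move: zn; rewrite zE => /nE ->; rewrite mulr0.
- move=> nU; move: ry; suff : a * T p x y + b * D x y = 0.
    move=> h; rewrite (_ : _ + _ = b * (a * T p x y + b * D x y)); last by ring.
    by rewrite h mulr0 eqxx.
  have /nE : a *: p + b *: x + 0 *: y \in n.
    by rewrite nU scale0r addr0 Ux; apply/mem_pairP; exists a, b.
  by rewrite mul0r addr0.
- move=> nW'; move: sx; suff : a' * T p x y + c * D y x = 0.
    move=> h; rewrite (_ : _ + _ = c * (a' * T p x y + c * D y x)); last by ring.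
    by rewrite h mulr0 eqxx.
  have /nE : a' *: p + 0 *: x + c *: y \in n.
    by rewrite nW' scale0r addr0 Wy; apply/mem_pairP; exists a', c.
  by rewrite mul0r addr0.
move=> z /mem_tripleP[e [g [h zE]]]; rewrite zE fE => /eqP.
rewrite !mulf_eq0 -orbA => /or3P[] /eqP e0.
- by constructor 2; rewrite e0 scale0r addr0 Wy; apply/mem_pairP; exists e, h.
- by constructor 1; rewrite e0 scale0r addr0 Ux; apply/mem_pairP; exists e, g.
- by constructor 3; apply/nE.
Qed.

End Lines.

(** * The pencil of planes through a line *)

Section Discriminant.
Variables (k : comPzRingType) (V : lmodType k) (C : V -> V -> V -> k).
Local Notation f := (cubic C).
Local Notation D := (polar1 C).
Local Notation T := (polar2 C).

(* If f vanishes on <u, v>, it restricts to z q(x, y, z) at x u + y v + z w, with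
   q = D(u,w) x^2 + T(u,v,w) x y + D(v,w) y^2 + D(w,u) x z + D(w,v) y z + f(w) z^2;
   this is the half discriminant of q. *)
Definition conic_disc u v w :=
  4%:R * D u w * D v w * f w + T u v w * D w u * D w v
  - D u w * D w v ^+ 2 - D v w * D w u ^+ 2 - f w * T u v w ^+ 2.

(* The coefficient of e in conic_disc u v (w + e w1). *)
Definition conic_disc_deriv u v w w1 :=
  4%:R * (D u w1 * D v w * f w + D u w * D v w1 * f w + D u w * D v w * D w w1)
  + T u v w1 * D w u * D w v + T u v w * T w w1 u * D w v
  + T u v w * D w u * T w w1 v
  - D u w1 * D w v ^+ 2 - 2%:R * D u w * D w v * T w w1 v
  - D v w1 * D w u ^+ 2 - 2%:R * D v w * D w u * T w w1 u
  - D w w1 * T u v w ^+ 2 - 2%:R * f w * T u v w * T u v w1.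

Hypothesis triC : trilinear C.
Variables u v : V.
Hypotheses (fu : f u = 0) (fv : f v = 0) (Duv : D u v = 0) (Dvu : D v u = 0).

Lemma polar2_swap_u w : T w u v = T u v w.
Proof. by rewrite polar2C polar2AC. Qed.

Lemma conic_disc_shift w a b :
  conic_disc u v (w + (a *: u + b *: v)) = conic_disc u v w.
Proof.
rewrite /conic_disc !(polarE triC) (polar2AC C w v u) polar2_swap_u fu fv Duv Dvu.
by ring.
Qed.

Lemma conic_disc_deriv_shift w w1 a b :
  conic_disc_deriv u v (w + (a *: u + b *: v)) w1 = conic_disc_deriv u v w w1.
Proof.
rewrite /conic_disc_deriv !(polarE triC) fu fv Duv Dvu.
rewrite !(polar2AC C w v u) !polar2_swap_u !(polar2AC C w w1).
rewrite !(polar2AC C u w1 v) !(polar2AC C v w1 u) !(polar2C C v u w1).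
by ring.
Qed.

Lemma conic_disc_basis a b c d w :
  conic_disc (a *: u + b *: v) (c *: u + d *: v) w =
    (a * d - b * c) ^+ 2 * conic_disc u v w.
Proof. by rewrite /conic_disc !(polarE triC) (polar2C C v u); ring. Qed.

Lemma conic_disc_deriv_basis a b c d w w1 :
  conic_disc_deriv (a *: u + b *: v) (c *: u + d *: v) w w1 =
    (a * d - b * c) ^+ 2 * conic_disc_deriv u v w w1.
Proof. by rewrite /conic_disc_deriv !(polarE triC) !(polar2C C v u); ring. Qed.

End Discriminant.

Section Pencil.
Variables (k : closedFieldType) (V : vectType k) (C : V -> V -> V -> k).
Hypothesis triC : trilinear C.
Hypothesis dimV : \dim {:V} = 4%N.
Hypothesis nsC : nonsingular_form C.
Local Notation f := (cubic C).
Local Notation D := (polar1 C).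
Local Notation T := (polar2 C).
Local Notation disc := (conic_disc C).
Local Notation ddisc := (conic_disc_deriv C).
Implicit Types (u v w x y p r : V) (U W : {vspace V}).

Lemma line_polar0 u v : on_cubic C (<[u]> + <[v]>)%VS ->
  [/\ f u = 0, f v = 0, D u v = 0 & D v u = 0].
Proof.
have [uU vU] := (@in_pair_l _ _ u v, @in_pair_r _ _ u v).
by move=> h; split; rewrite ?(polar1_on_cubic triC h) ?h.
Qed.

(** Vanishing of the discriminant, or of its derivative, depends only on the line and the plane:
    changing the basis multiplies by a squared determinant, and moving w along the line changes
    nothing. Bases can thus be adapted to special points. *)
Lemma conic_disc_change u v r r' w y :
    on_cubic C (<[u]> + <[v]>)%VS -> \dim (<[r]> + <[r']>) = 2%N ->
    r \in (<[u]> + <[v]>)%VS -> r' \in (<[u]> + <[v]>)%VS ->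
    y - w \in (<[u]> + <[v]>)%VS ->
  exists d, [/\ d != 0, disc r r' y = d * disc u v w &
    forall w1, ddisc r r' y w1 = d * ddisc u v w w1].
Proof.
move=> fuv dr /mem_pairP[a [b rE]] /mem_pairP[c [d r'E]] /mem_pairP[e [g yE]].
have [fu fv Duv Dvu] := line_polar0 fuv.
have {yE}-> : y = w + (e *: u + g *: v) by rewrite -yE addrC subrK.
exists ((a * d - b * c) ^+ 2); rewrite rE r'E; split.
(* If the determinant were zero, d r - b r' and - c r + a r' would vanish; independence of r and r'
   would make a, b, c, d all zero, hence r = 0. *)
- rewrite expf_eq0 /=; apply/eqP => det0.
  have h1 : d *: r + (- b) *: r' = 0.
    rewrite rE r'E !scalerDr !scalerA addrACA -!scalerDl.
    rewrite (_ : d * a + _ = a * d - b * c) 1?(_ : d * b + _ = 0); try by ring.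
    by rewrite det0 !scale0r addr0.
  have h2 : (- c) *: r + a *: r' = 0.
    rewrite rE r'E !scalerDr !scalerA addrACA -!scalerDl.
    rewrite (_ : _ + a * d = a * d - b * c) 1?(_ : _ + a * c = 0); try by ring.
    by rewrite det0 !scale0r addr0.
  have [h|] := boolP ((- c != 0) || (a != 0)).
    by move: (pair_neq0 dr h); rewrite h2 eqxx.
  rewrite negb_or !negbK => /andP[/eqP c0 /eqP a0].
  have [h|] := boolP ((d != 0) || (- b != 0)).
    by move: (pair_neq0 dr h); rewrite h1 eqxx.
  rewrite negb_or !negbK => /andP[/eqP d0 /eqP b0].
  move: dr; rewrite dim_pair rE a0 (_ : b = 0) ?scale0r ?addr0 ?eqxx.
    by case: (_ \notin _).
  by rewrite -[b]opprK b0 oppr0.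
- by rewrite conic_disc_basis // conic_disc_shift.
- by move=> w1; rewrite conic_disc_deriv_basis // conic_disc_deriv_shift.
Qed.

Section Plane.
Variables u v w : V.
Hypothesis duv : \dim (<[u]> + <[v]>) = 2%N.
Hypothesis fuv : on_cubic C (<[u]> + <[v]>)%VS.
Hypothesis wuv : w \notin (<[u]> + <[v]>)%VS.
Local Notation U := (<[u]> + <[v]>)%VS.

(** A singular conic contains a line through each of its points; r is taken where the conic meets U.
    With D(r, w) = 0 the discriminant has only three terms left, and y is found by an explicit
    formula. *)
Lemma conic_disc0_line : disc u v w = 0 ->
  exists r r' y, [/\ r \in U, U = (<[r]> + <[r']>)%VS, y - w \in U &
    on_cubic C (<[r]> + <[y]>)%VS].
Proof.
move=> disc0; have lU : is_line C U by [].
have [a [b [ab0 Ar]]] := binary_quadratic_root (D u w) (T u v w) (D v w).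
pose r := a *: u + b *: v.
have rU : r \in U by apply/mem_pairP; exists a, b.
have r0 : r != 0 by apply: pair_neq0.
have Drw : D r w = 0 by rewrite /r !(polarE triC) -[RHS]Ar; ring.
clearbody r; clear a b ab0 Ar.
have [r' _ UE] := dim2_basis duv r0 rU.
have r'U : r' \in U by rewrite UE in_pair_r.
have drr : \dim (<[r]> + <[r']>) = 2%N by rewrite -UE.
have ww : w - w \in U by rewrite subrr mem0v.
have [d [_ + _]] := conic_disc_change fuv drr rU r'U ww.
rewrite disc0 mulr0 /conic_disc Drw => disc0'.
have frr : on_cubic C (<[r]> + <[r']>)%VS by rewrite -UE.
have [fr fr' Drr' Dr'r] := line_polar0 frr.
have Dr'w : T r r' w = 0 -> D r' w != 0.
  move=> Trw; have [s] := polar1_transverse triC dimV nsC lU wuv.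
  rewrite UE => /mem_pairP[c [e ->]]; rewrite !(polarE triC) Drw Trw => h.
  by apply: contraNneq h => ->; rewrite !mulr0 !addr0.
(* Here r is a double root on U, and the vanishing discriminant makes it a singular point of the
   conic: any root of the remaining quadratic in c gives a line through r. *)
have [B0|B0] := eqVneq (T r r' w) 0.
  have D0 : D w r = 0.
    move: disc0'; rewrite B0 => h; apply/eqP.
    have : D r' w * D w r ^+ 2 == 0 by apply/eqP; apply: etrans (etrans (congr1 -%R h) (oppr0 _)); ring.
    by rewrite mulf_eq0 (negPf (Dr'w B0)) expf_eq0.
  have [c cE] := quadratic_root (D w r') (f w) (Dr'w B0).
  exists r, r', (w + c *: r'); rewrite -UE; split=> //.
    by rewrite addrAC subrr add0r memvZ.
  apply: on_cubic_pair => //; rewrite !(polarE triC) ?fr ?fr' ?Drw ?Drr' ?Dr'r ?D0.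
  - by rewrite -[RHS]cE; ring.
  - by rewrite mulr0 addr0.
  - by rewrite (polar2AC C w r' r) (polar2C C w r r') polar2AC B0; ring.
(* The coefficient is chosen to make D(y, r) vanish; then T(r, r', w)^2 f(y) is minus the
   discriminant, hence zero. *)
exists r, r', (w + (- (D w r / T r r' w)) *: r'); rewrite -UE; split=> //.
  by rewrite addrAC subrr add0r memvZ.
apply: on_cubic_pair => //; rewrite !(polarE triC) ?fr ?fr' ?Drw ?Drr' ?Dr'r.
- apply: (mulfI B0); apply: (mulfI B0); rewrite !mulr0.
  by apply: etrans (etrans (congr1 -%R disc0') (oppr0 _)); field.
- by rewrite mulr0 addr0.
- rewrite (polar2AC C w r' r) (polar2C C w r r') (polar2AC C r w r').
  by field.
Qed.

(** With r the common point of W and U, and a point y1 of W in place of w, the values D(r, y1),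
    D(y1, r) and f(y1) are zero, and each term of the discriminant contains one of them. *)
Lemma line_conic_disc0 W : is_line C W -> W <> U -> (W <= U + <[w]>)%VS ->
  disc u v w = 0.
Proof.
move=> [dW fW] WU Ws; have dUw : \dim (U + <[w]>) = 3%N by rewrite dim_addv_line duv wuv.
have : (0 < \dim (W :&: U))%N.
  have := dimv_sum_cap W U; rewrite dW duv => h.
  rewrite -(ltn_add2l (\dim (W + U))) h addn0.
  apply: (@leq_ltn_trans 3) => //; rewrite -dUw.
  by apply: dimvS; rewrite subv_add Ws addvSl.
rewrite lt0n dimv_eq0 => /cap_neq0P[r r0 /andP[rW rU]].
have [r' _ UE] := dim2_basis duv r0 rU; have [y yr WE] := dim2_basis dW r0 rW.
have r'U : r' \in U by rewrite UE in_pair_r.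
have drr : \dim (<[r]> + <[r']>) = 2%N by rewrite -UE.
have yW : y \in W by rewrite WE in_pair_r.
have /(subvP Ws)/mem_addv_lineP[z zU [c yE]] := yW.
have c0 : c != 0.
  apply/eqP => c0; apply: WU; apply: eq_dim_subv; first by rewrite dW.
  by rewrite WE subv_add -!memvE rU yE c0 scale0r addr0.
pose y1 := c^-1 *: y.
have y1W : y1 \in W by rewrite memvZ.
have y1w : y1 - w \in U.
  by rewrite /y1 yE scalerDr scalerA mulVf // scale1r addrK memvZ.
have [d [d0 + _]] := conic_disc_change fuv drr rU r'U y1w.
rewrite /conic_disc (polar1_on_cubic triC fW rW y1W) (polar1_on_cubic triC fW y1W rW).
rewrite fW // => /eqP; rewrite !(mulr0, mul0r, expr0n, subr0, addr0) eq_sym mulf_eq0.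
by rewrite (negPf d0) => /eqP.
Qed.

(* In the basis r, r', y of the plane, with <r, y> a second line, the derivative
   is minus D s w1 for the point s of <r, y> where the gradient kills the plane. *)
Lemma conic_disc_simple w1 : w1 \notin (U + <[w]>)%VS -> disc u v w = 0 ->
  ddisc u v w w1 != 0.
Proof.
move=> w1W disc0; have [r [r' [y [rU UE ywU fry]]]] := conic_disc0_line disc0.
have r'U : r' \in U by rewrite UE in_pair_r.
have drr : \dim (<[r]> + <[r']>) = 2%N by rewrite -UE.
have [d [d0 _ /(_ w1)]] := conic_disc_change fuv drr rU r'U ywU.
have yU : y \notin U.
  by apply: contra wuv => yU; rewrite -[w](subKr y) memvB.
have [fr fy Dry Dyr] := line_polar0 fry.
have frr : on_cubic C (<[r]> + <[r']>)%VS by rewrite -UE.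
have [_ fr' Drr' Dr'r] := line_polar0 frr.
(* For a r + b y on the second line, the derivative in direction r' is b (a T(r, y, r') + b D(y,
   r')); these coefficients kill the second factor. *)
pose s := D y r' *: r + (- T r r' y) *: y.
have -> : ddisc r r' y w1 = - D s w1.
  rewrite /conic_disc_deriv /s !(polarE triC) Dry fy Dyr.
  by rewrite (polar2C C y w1) (polar2AC C w1 y r) (polar2C C w1 r y) (polar2AC C r w1 y); ring.
move=> h; apply/eqP => dd0; move: h; rewrite dd0 mulr0 => /eqP; rewrite oppr_eq0 => /eqP Dsw1.
have dry : \dim (<[r]> + <[y]>) = 2%N.
  rewrite dim_pair; have -> : r != 0.
    by apply/eqP => r0; move: drr; rewrite r0 dim_pair eqxx; case: (_ \notin _).
  by rewrite (contra _ yU) // => /(subvP (addvSl _ <[r']>%VS)); rewrite -UE.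
have lry : is_line C (<[r]> + <[y]>)%VS by [].
have r'ry : r' \notin (<[r]> + <[y]>)%VS.
  apply: contra yU => r'ry; suff -> : U = (<[r]> + <[y]>)%VS by rewrite in_pair_r.
  by apply: eq_dim_subv; rewrite ?duv // UE subv_add -!memvE in_pair_l r'ry.
(* If both coefficients were zero, D(z, r') would vanish for every z of <r, y>, against
   [polar1_transverse]. *)
have s0 : s != 0.
  apply: pair_neq0 => //; have [z] := polar1_transverse triC dimV nsC lry r'ry.
  case/mem_pairP => a [b ->]; rewrite !(polarE triC) Drr' (polar2AC C r y r').
  apply: contraNT; rewrite negb_or !negbK oppr_eq0 => /andP[/eqP -> /eqP ->].
  by rewrite !mulr0 !addr0.
have sry : s \in (<[r]> + <[y]>)%VS by apply/mem_pairP; eexists; eexists.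
have dW : \dim (U + <[w]>) = 3%N by rewrite dim_addv_line duv wuv.
have [x /eqP[]] := nsC s0 (fry _ sry).
have Dsr : D s r = 0 by apply: (polar1_on_cubic triC fry sry); rewrite in_pair_l.
have Dsy : D s y = 0 by apply: (polar1_on_cubic triC fry sry); rewrite in_pair_r.
have Dsr' : D s r' = 0.
  by rewrite /s !(polarE triC) Drr' (polar2AC C r y r'); ring.
clearbody s.
have DsU z : z \in U -> D s z = 0.
  by rewrite UE => /mem_pairP[a [b ->]]; rewrite !(polar1Dr triC, polar1Zr triC) Dsr Dsr'; ring.
have Dsw : D s w = 0.
  by have := DsU _ ywU; rewrite -scaleN1r !(polarE triC) Dsy add0r mulN1r => /eqP; rewrite oppr_eq0 => /eqP.
have [_ /mem_addv_lineP[z zU [a ->]] [b ->]] := span4 dimV x dW w1W.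
by rewrite !(polar1Dr triC, polar1Zr triC) DsU // Dsw Dsw1; ring.
Qed.

End Plane.
End Pencil.

(** * Leading coefficients in a prescribed degree *)

Section FormalLeadingCoefficient.
Variable R : comNzRingType.
Implicit Types (p q : {poly R}) (n m : nat) (a b : R).

(** Here [a] may be zero, so the notion is stable under sums of equal degree and under products,
    without any check for cancellation. *)
Definition formal_lead p n a := (size p <= n.+1)%N /\ p`_n = a.

Lemma formal_leadM p q n m a b :
  formal_lead p n a -> formal_lead q m b -> formal_lead (p * q) (n + m) (a * b).
Proof.
move=> [sp <-] [sq <-]; split.
  apply: leq_trans (size_polyMleq _ _) _; rewrite -ltnS; case: (size p + size q)%N (leq_add sp sq) => //=.
  by move=> l; rewrite addSn addnS ltnS.
rewrite coefM (bigD1 (inord n)) //= inordK ?ltnS ?leq_addr // addKn.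
rewrite big1 ?addr0 // => i; rewrite -val_eqE /= inordK ?ltnS ?leq_addr // => ni.
have [lt_in|] := ltnP i n.
  by rewrite (@nth_default _ _ q) ?mulr0 // (leq_trans sq) // ltn_subRL ltn_add2r.
rewrite leq_eqVlt eq_sym (negPf ni) /= => lt_ni.
by rewrite nth_default ?mul0r // (leq_trans sp).
Qed.

Lemma formal_leadD p q n a b :
  formal_lead p n a -> formal_lead q n b -> formal_lead (p + q) n (a + b).
Proof.
move=> [sp <-] [sq <-]; split; last by rewrite coefD.
by apply: leq_trans (size_polyD _ _) _; rewrite geq_max sp.
Qed.

Lemma formal_leadN p n a : formal_lead p n a -> formal_lead (- p) n (- a).
Proof. by move=> [sp <-]; split; rewrite ?size_polyN ?coefN. Qed.

Lemma formal_leadC a : formal_lead a%:P 0 a.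
Proof. by split; rewrite ?coefC // (leq_trans (size_polyC_leq1 _)). Qed.

Lemma formal_lead_poly (s : seq R) a :
  formal_lead (Poly (rcons s a)) (size s) a.
Proof.
split; first by rewrite (leq_trans (size_Poly _)) ?size_rcons.
by rewrite coef_Poly nth_rcons ltnn eqxx.
Qed.

End FormalLeadingCoefficient.

Section ConicDiscPoly.
Variables (k : comNzRingType) (V : lmodType k) (C : V -> V -> V -> k).
Hypothesis triC : trilinear C.
Local Notation f := (cubic C).
Local Notation D := (polar1 C).
Local Notation T := (polar2 C).

(** The binary quintic of the pencil in an affine coordinate. The degree is 1 + 1 + 3 = 1 + 2 + 2 =
    5, as D(u, -), T(u, v, -) are linear, D(-, u) quadratic and f cubic; the coefficient of t^5 is
    the value at the point at infinity [w1]. *)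
Lemma conic_disc_poly u v w0 w1 : exists p : {poly k},
  [/\ formal_lead p 5 (conic_disc C u v w1),
      forall t, p.[t] = conic_disc C u v (w0 + t *: w1) &
      forall t, p^`().[t] = conic_disc_deriv C u v (w0 + t *: w1) w1].
Proof.
pose pA := Poly (rcons [:: D u w0] (D u w1)).
pose pC := Poly (rcons [:: D v w0] (D v w1)).
pose pB := Poly (rcons [:: T u v w0] (T u v w1)).
pose pD := Poly (rcons [:: D w0 u; T w0 w1 u] (D w1 u)).
pose pE := Poly (rcons [:: D w0 v; T w0 w1 v] (D w1 v)).
pose pG := Poly (rcons [:: f w0; D w0 w1; D w1 w0] (f w1)).
have lin (a b t : k) : (Poly (rcons [:: a] b)).[t] = a + t * b.
  by rewrite horner_Poly /=; ring.
have dlin (a b t : k) : (Poly (rcons [:: a] b))^`().[t] = b.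
  by rewrite /Poly /= !cons_poly_def !(derivD, derivM, derivC, derivX, deriv0) !(hornerD, hornerM, hornerC, hornerX); ring.
have hA t : pA.[t] = D u (w0 + t *: w1) by rewrite lin !(polarE triC).
have hC t : pC.[t] = D v (w0 + t *: w1) by rewrite lin !(polarE triC).
have hB t : pB.[t] = T u v (w0 + t *: w1) by rewrite lin !(polarE triC).
have hD t : pD.[t] = D (w0 + t *: w1) u.
  by rewrite horner_Poly /= !(polarE triC); ring.
have hE t : pE.[t] = D (w0 + t *: w1) v.
  by rewrite horner_Poly /= !(polarE triC); ring.
have hG t : pG.[t] = f (w0 + t *: w1).
  by rewrite horner_Poly /= !(polarE triC); ring.
have dD t : pD^`().[t] = T (w0 + t *: w1) w1 u.
  by rewrite /pD /Poly /= !cons_poly_def !(derivD, derivM, derivC, derivX, deriv0) !(hornerD, hornerM, hornerC, hornerX) !(polarE triC); ring.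
have dE t : pE^`().[t] = T (w0 + t *: w1) w1 v.
  by rewrite /pE /Poly /= !cons_poly_def !(derivD, derivM, derivC, derivX, deriv0) !(hornerD, hornerM, hornerC, hornerX) !(polarE triC); ring.
have dG t : pG^`().[t] = D (w0 + t *: w1) w1.
  rewrite /pG /Poly /= !cons_poly_def !(derivD, derivM, derivC, derivX, deriv0) !(hornerD, hornerM, hornerC, hornerX) !(polarE triC).
  by rewrite ?polar2uvu; ring.
exists (4%:R%:P * pA * pC * pG + pB * pD * pE - pA * (pE * pE) - pC * (pD * pD)
  - pG * (pB * pB)); split.
- have A1 : formal_lead pA 1 _ := formal_lead_poly _ _.
  have B1 : formal_lead pB 1 _ := formal_lead_poly _ _.
  have C1 : formal_lead pC 1 _ := formal_lead_poly _ _.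
  have D2 : formal_lead pD 2 _ := formal_lead_poly _ _.
  have E2 : formal_lead pE 2 _ := formal_lead_poly _ _.
  have G3 : formal_lead pG 3 _ := formal_lead_poly _ _.
  have F4 := formal_leadC (4%:R : k).
  have := formal_leadM (formal_leadM (formal_leadM F4 A1) C1) G3.
  move/formal_leadD/(_ (formal_leadM (formal_leadM B1 D2) E2)).
  move/formal_leadD/(_ (formal_leadN (formal_leadM A1 (formal_leadM E2 E2)))).
  move/formal_leadD/(_ (formal_leadN (formal_leadM C1 (formal_leadM D2 D2)))).
  move/formal_leadD/(_ (formal_leadN (formal_leadM G3 (formal_leadM B1 B1)))).
  by rewrite /conic_disc !expr2.
- move=> t; rewrite !(hornerD, hornerM, hornerN, hornerC) hA hB hC hD hE hG.
  by rewrite /conic_disc; ring.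
- move=> t; rewrite !(derivD, derivN, derivM, derivC) !(hornerD, hornerM, hornerN, hornerC).
  rewrite hA hB hC hD hE hG !dlin dD dE dG /conic_disc_deriv.
  by ring.
Qed.

End ConicDiscPoly.

Section SimpleRoots.
Variable k : closedFieldType.
Implicit Types p : {poly k}.

Lemma has_card_simple_roots p n : size p = n.+1 ->
  (forall x, p.[x] = 0 -> p^`().[x] != 0) -> has_card (fun x => p.[x] = 0) n.
Proof.
move=> sp simp; have p0 : p != 0 by rewrite -size_poly_eq0 sp.
have [r pE] := closed_field_poly_normal p.
have l0 : lead_coef p != 0 by rewrite lead_coef_eq0.
exists r; split.
- rewrite -separable_prod_XsubC -(eqp_separable (p := p)); last first.
    by rewrite {1}pE eqp_scale.
  rewrite separable_poly.unlock; apply/Pdiv.ClosedField.coprimepP => x.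
  by move/rootP; apply: simp.
- by move: sp; rewrite pE size_scale // size_prod_XsubC => -[].
move=> x; rewrite -root_prod_XsubC pE hornerZ; split=> [/eqP|/rootP ->].
  by rewrite mulf_eq0 (negPf l0).
by rewrite mulr0.
Qed.

End SimpleRoots.

Section Planes.
Variables (k : closedFieldType) (V : vectType k) (C : V -> V -> V -> k).
Hypothesis triC : trilinear C.
Hypothesis dimV : \dim {:V} = 4%N.
Hypothesis nsC : nonsingular_form C.
Implicit Types (u v w x y p r : V) (U W : {vspace V}).
Local Notation disc := (conic_disc C).
Local Notation ddisc := (conic_disc_deriv C).

Definition tritangent U W :=
  [/\ \dim W = 3%N, (U <= W)%VS & exists m, [/\ is_line C m, m <> U & (m <= W)%VS]].

Lemma conic_disc_on_line u v y : on_cubic C (<[u]> + <[v]>)%VS ->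
  y \in (<[u]> + <[v]>)%VS -> disc u v y = 0.
Proof.
move=> fuv yU; have [uU vU] := (@in_pair_l _ _ u v, @in_pair_r _ _ u v).
rewrite /conic_disc (fuv _ yU) (polar2_on_cubic triC fuv uU vU yU).
rewrite (polar1_on_cubic triC fuv uU yU) (polar1_on_cubic triC fuv vU yU); ring.
Qed.

Lemma conic_disc0_is_line u v w : \dim (<[u]> + <[v]>) = 2%N ->
    on_cubic C (<[u]> + <[v]>)%VS -> w \notin (<[u]> + <[v]>)%VS ->
    disc u v w = 0 ->
  exists m, [/\ is_line C m, m <> (<[u]> + <[v]>)%VS &
    (m <= <[u]> + <[v]> + <[w]>)%VS].
Proof.
move=> dU fU wU d0.
have [r [r' [y [rU UE ywU fry]]]] := conic_disc0_line triC dimV nsC dU fU wU d0.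
have yU : y \notin (<[u]> + <[v]>)%VS by apply: contra wU => yU; rewrite -[w](subKr y) memvB.
exists (<[r]> + <[y]>)%VS; split.
- split=> //; rewrite dim_pair; have -> : r != 0.
    by apply/eqP => r0; move: dU; rewrite UE r0 dim_pair eqxx; case: (_ \notin _).
  by rewrite (contra _ yU) // => /(subvP (addvSl _ <[r']>%VS)); rewrite -UE.
- by move=> e; rewrite -e in_pair_r in yU.
rewrite subv_add -!memvE (subvP (addvSl _ _)) //= -{1}[y](subrK w).
by rewrite memv_add ?memv_line.
Qed.

(** The planes through U other than U + <y> are U + <x + t y>. With y chosen so that its
    discriminant is nonzero, the quintic in t has degree exactly 5 and no plane is lost at infinity;
    its roots are simple by [conic_disc_simple]. *)
Lemma has_card_tritangent U : is_line C U -> has_card (tritangent U) 5.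
Proof.
move=> lU; have [dU fU] := lU; have [u uU u0] := dim_pos_neq0 dU.
have [v _ UE] := dim2_basis dU u0 uU.
have duv : \dim (<[u]> + <[v]>) = 2%N by rewrite -UE.
have fuv : on_cubic C (<[u]> + <[v]>)%VS by rewrite -UE.
have d34 : (3 < \dim {:V})%N by rewrite dimV.
have [y yU dy] : exists2 y, y \notin U & disc u v y != 0.
  have [y0 y0U] : exists y, y \notin U by apply: exists_notin dU _; rewrite dimV.
  have dW : \dim (U + <[y0]>) = 3%N by rewrite dim_addv_line dU y0U.
  have [w1 w1W] := exists_notin dW d34.
  suff [y dy] : exists y, disc u v y != 0.
    by exists y => //; apply: contra dy => yU; apply/eqP/conic_disc_on_line; rewrite -?UE.
  (* If the discriminant vanishes at y0, its derivative towards w1 does not, so it is a nonzero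
     polynomial along that pencil and has a nonroot. *)
  have [d0|] := eqVneq (disc u v y0) 0; last by exists y0.
  have [p [_ pE p'E]] := conic_disc_poly triC u v y0 w1.
  have /closed_nonrootP[t pt] : p != 0.
    apply: contraTneq (conic_disc_simple triC dimV nsC duv fuv (w := y0) (w1 := w1) _ _ d0).
    - by move=> p0; have := p'E 0; rewrite p0 deriv0 horner0 scale0r addr0 => <-; rewrite eqxx.
    - by rewrite -UE.
    - by rewrite -UE.
  by exists (y0 + t *: w1); rewrite -pE.
have dW : \dim (U + <[y]>) = 3%N by rewrite dim_addv_line dU yU.
have [x xW] := exists_notin dW d34.
have [p [[sp p5] pE p'E]] := conic_disc_poly triC u v x y.
have {}sp : size p = 6%N.
  apply/eqP; rewrite eqn_leq sp /= ltnNge; apply/negP => /leq_sizeP/(_ 5%N (leqnn _)).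
  by rewrite p5 => /eqP; rewrite (negPf dy).
have wU t : x + t *: y \notin U.
  apply: contra xW => h; apply/mem_addv_lineP; exists (x + t *: y) => //.
  by exists (- t); rewrite scaleNr addrK.
have yw t : y \notin (U + <[x + t *: y]>)%VS.
  apply/negP => yw; have xw : x \in (U + <[x + t *: y]>)%VS.
    rewrite -{1}[x](addrK (t *: y)) memvB ?memvZ //.
    by rewrite (subvP (addvSr _ _)) ?memv_line.
  have : (U + <[y]> + <[x]> <= U + <[x + t *: y]>)%VS.
    by rewrite !subv_add addvSl -!memvE yw xw.
  by move/dimvS; rewrite !dim_addv_line dU yU xW wU.
have cp : has_card (fun t => p.[t] = 0) 5.
  apply: has_card_simple_roots => // t; rewrite pE p'E => d0.
  by apply: (conic_disc_simple triC dimV nsC duv fuv); rewrite -?UE.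
have inj : {in [set t | p.[t] = 0]%classic &, injective (fun t => (U + <[x + t *: y]>)%VS)}.
  move=> t t' _ _ /= e; apply/eqP; rewrite -subr_eq0; apply: contraT => tt.
  have : (x + t *: y) - (x + t' *: y) \in (U + <[x + t *: y]>)%VS.
    by rewrite memvB //; [|rewrite e]; rewrite (subvP (addvSr _ _)) ?memv_line.
  rewrite opprD addrACA subrr add0r -scalerBl => /(memvZ (t - t')^-1).
  by rewrite scalerA mulVf // scale1r (negPf (yw t)).
apply: has_card_ext (has_card_image inj cp) => W; split.
  move=> [t pt <-]; split; first by rewrite dim_addv_line dU wU.
    by rewrite addvSl.
  by rewrite UE; apply: conic_disc0_is_line; rewrite -?UE // -pE.
move=> [dW3 UW [m [lm mU mW]]].
(* Otherwise W would be the plane at infinity U + <y>, whose discriminant is nonzero. *)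
have yW : y \notin W.
  apply: contra dy => yW; apply/eqP.
  apply: (line_conic_disc0 triC duv fuv _ lm) => //; rewrite -?UE //.
  suff -> : (U + <[y]>)%VS = W by [].
  by apply: eq_dim_subv; rewrite ?dW ?dW3 // subv_add UW -memvE.
have [w wW [t xE]] := span4 dimV x dW3 yW.
have wE : w = x + (- t) *: y by rewrite xE scaleNr addrK.
have WE : (U + <[w]>)%VS = W.
  by apply: eq_dim_subv; rewrite ?dW3 ?subv_add ?UW -?memvE // dim_addv_line dU wE wU.
exists (- t); last by rewrite -wE.
rewrite /= pE -wE; apply: (line_conic_disc0 triC duv fuv _ lm) => //; rewrite -?UE //.
  by rewrite wE.
by rewrite WE.
Qed.

End Planes.

(** * Counting lines *)

Section Avoidance.
Variables (k : closedFieldType) (V : vectType k).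
Implicit Types (x : V) (U W : {vspace V}).

(** Over an infinite field a space is not a finite union of proper subspaces. *)
Lemma exists_avoid U (Ws : seq {vspace V}) :
    (forall W, W \in Ws -> ~~ (U <= W)%VS) ->
  exists2 x, x \in U & forall W, W \in Ws -> x \notin W.
Proof.
elim: Ws => [|W Ws IH] UWs; first by exists 0; rewrite ?mem0v.
have [|x xU xWs] := IH; first by move=> W' W's; apply: UWs; rewrite inE W's orbT.
have /subvPn[b bU bW] : ~~ (U <= W)%VS by apply: UWs; rewrite inE eqxx.
have bx W' : W' \in W :: Ws -> b \in W' -> x \notin W'.
  by rewrite inE => /orP[/eqP ->|/xWs //]; rewrite (negPf bW).
(* By [bx] no W' contains both x and b, so each one contains x + t b for at most one t. *)
have [bad badP] : exists bad : seq k, forall t W',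
    W' \in W :: Ws -> x + t *: b \in W' -> t \in bad.
  elim: (W :: Ws) bx => [|W' s IHs] bx; first by exists [::].
  have [|bad badP] := IHs; first by move=> W1 W1s; apply: bx; rewrite inE W1s orbT.
  have [[t tW']|nt] := pselect (exists t : k, x + t *: b \in W'); last first.
    exists bad => t W1; rewrite inE => /orP[/eqP -> tW|]; last exact: badP.
    by case: nt; exists t.
  exists (t :: bad) => t' W1; rewrite !inE => /orP[/eqP ->|W1s] t'W; last first.
    by rewrite (badP _ _ W1s t'W) orbT.
  apply/orP; left; apply: contraT => tt.
  have bW' : b \in W'.
    have := memvB t'W tW'; rewrite opprD addrACA subrr add0r -scalerBl.
    by move/(memvZ (t' - t)^-1); rewrite scalerA mulVf ?scale1r // subr_eq0.
  have := bx W' _ bW'; rewrite inE eqxx => /(_ isT) /negP[].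
  by rewrite -[x](addrK (t *: b)) memvB // memvZ.
have [t tbad] := exists_notin_seq bad; exists (x + t *: b).
  by rewrite memvD // memvZ.
by move=> W' W's; apply: contra tbad; apply: badP.
Qed.

Lemma cap_neq0_dim U W X : (U <= X)%VS -> (W <= X)%VS ->
  (\dim X < \dim U + \dim W)%N -> (U :&: W != 0)%VS.
Proof.
move=> UX WX lt; rewrite -dimv_eq0 -lt0n -(ltn_add2l (\dim (U + W))).
rewrite dimv_sum_cap addn0; apply: leq_ltn_trans lt; apply: dimvS.
by rewrite subv_add UX.
Qed.

End Avoidance.

Section LineCount.
Variables (k : closedFieldType) (V : vectType k) (C : V -> V -> V -> k).
Hypothesis triC : trilinear C.
Hypothesis dimV : \dim {:V} = 4%N.
Hypothesis nsC : nonsingular_form C.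
Implicit Types (u v w x y p r : V) (U W m n b t : {vspace V}).
Local Notation line := (is_line C).

Lemma line_dim3 U m : line U -> line m -> U <> m -> (U :&: m != 0)%VS ->
  \dim (U + m) = 3%N.
Proof. by move=> lU lm Um /(residual_line triC dimV nsC lU lm Um)[]. Qed.

(** All lines of the surface through p lie in its tangent plane at p, which is U + m. *)
Lemma concurrent_sub U m b p : line U -> line m -> line b -> U <> m -> p != 0 ->
  p \in U -> p \in m -> p \in b -> (b <= U + m)%VS.
Proof.
move=> lU lm lb Um p0 pU pm pb; have [[[_ fU] [_ fm]] [_ fb]] := (lU, lm, lb).
have d3 : \dim (U + m) = 3%N.
  by apply: line_dim3 => //; apply/cap_neq0P; exists p => //; rewrite pU.
apply/subvP => x xb; apply: (tangent_mem triC dimV nsC p0 (fU _ pU) d3).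
  move=> _ /memv_addP[y yU [z zm ->]].
  by rewrite (polar1Dr triC) (polar1_on_cubic triC fU) // (polar1_on_cubic triC fm) ?addr0.
exact: (polar1_on_cubic triC fb).
Qed.

Lemma line_union3 b U m n : \dim b = 2%N -> \dim U = 2%N -> \dim m = 2%N -> \dim n = 2%N ->
  (forall x, x \in b -> [\/ x \in U, x \in m | x \in n]) -> [\/ b = U, b = m | b = n].
Proof.
move=> db dU dm dn H; apply: contrapT => neq.
have [|x /H xUmn xn] := @exists_avoid _ _ b [:: U; m; n].
  move=> W; rewrite !inE => Ws; apply/negP => bW; apply: neq.
  by case/or3P: Ws bW => /eqP -> /eq_dim_subv bW; [constructor 1|constructor 2|constructor 3];
    apply: bW; rewrite db.
by case: xUmn; apply/negP; apply: xn; rewrite !inE eqxx ?orbT.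
Qed.

Lemma tritangent_lines U W : line U -> tritangent C U W -> exists m n,
  [/\ [/\ line m, line n, m <> U, n <> U & n <> m], (m <= W)%VS, (n <= W)%VS,
    (forall x, x \in W -> cubic C x = 0 -> [\/ x \in U, x \in m | x \in n]) &
    forall b, line b -> (b <= W)%VS -> [\/ b = U, b = m | b = n] ].
Proof.
move=> lU [dW UW [m [lm mU mW]]]; have [[dU fU] [dm fm]] := (lU, lm).
have Um0 : (U :&: m != 0)%VS by apply: (cap_neq0_dim UW mW); rewrite dW dU dm.
have [|d3 [n [ln nW nU nm zn]]] := residual_line triC dimV nsC lU lm _ Um0.
  by move=> e; apply: mU.
have UmW : (U + m)%VS = W by apply: eq_dim_subv; rewrite ?d3 // subv_add UW.
rewrite UmW in nW zn; exists m, n; split=> // b [db fb] /subvP bW.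
apply: line_union3 => //; first by have [] := ln.
by move=> x xb; apply: zn; [apply: bW | apply: fb].
Qed.

Lemma has_card_plane_lines U W : line U -> tritangent C U W ->
  has_card (fun m => [/\ line m, m <> U & (m <= W)%VS]) 2.
Proof.
move=> lU /(tritangent_lines lU)[m [n [[lm ln mU nU nm] mW nW _ H]]].
exists [:: m; n]; split=> //; first by rewrite /= inE eq_sym andbT; apply/eqP.
move=> b; rewrite !inE; split; last by case/orP => /eqP ->.
by move=> [lb bU /(H _ lb)[/bU//|->|->]]; rewrite eqxx ?orbT.
Qed.

Definition meets U m := [/\ line m, m <> U & (U :&: m != 0)%VS].

Lemma meets_sub U m W : line U -> \dim W = 3%N -> (U <= W)%VS ->
  (meets U m /\ (U + m)%VS = W) <-> [/\ line m, m <> U & (m <= W)%VS].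
Proof.
move=> lU dW UW; split=> [[[lm mU Um] <-]|[lm mU mW]]; first by rewrite addvSr.
have [[dU _] [dm _]] := (lU, lm).
have Um0 : (U :&: m != 0)%VS by apply: (cap_neq0_dim UW mW); rewrite dW dU dm.
split=> //; apply: eq_dim_subv; last by rewrite subv_add UW.
by rewrite dW line_dim3 // => e; apply: mU.
Qed.

Lemma meets_tritangent U m : line U -> meets U m -> tritangent C U (U + m).
Proof.
move=> lU [lm mU Um]; split; [|exact: addvSl|].
  by apply: line_dim3 => // e; apply: mU.
by exists m; split=> //; apply: addvSr.
Qed.

Lemma has_card_meets U : line U -> has_card (meets U) 10.
Proof.
move=> lU; have := has_card_tritangent triC dimV nsC lU.
move=> /(has_card_fib (f := fun m => (U + m)%VS) (A := meets U) (c := 2)); apply.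
  by move=> m; apply: meets_tritangent.
move=> W tW; have [dW UW _] := tW.
apply: has_card_ext (has_card_plane_lines lU tW) => m.
by split=> /(meets_sub m lU dW UW).
Qed.

Lemma line_plane_cap b W : line b -> \dim W = 3%N -> ~~ (b <= W)%VS ->
  exists2 x, x != 0 & [/\ x \in b, x \in W & forall y, y \in b -> y \in W -> y \in <[x]>%VS].
Proof.
move=> [db _] dW bW; have : (b :&: W != 0)%VS.
  by apply: (cap_neq0_dim (subvf _) (subvf _)); rewrite dimV db dW.
case/cap_neq0P => x x0 /andP[xb xW]; exists x => //; split=> // y yb yW.
have : (\dim (b :&: W) <= 1)%N.
  rewrite -ltnS -db ltn_neqAle dimvS ?capvSl // andbT.
  apply: contra bW => /eqP e; apply/capv_idPl/eq_dim_subv => //; exact: capvSl.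
by move=> d1; apply: (mem_dim1 d1 x0); rewrite memv_cap ?xb ?yb.
Qed.

Definition transversal U b t := [/\ line t, (U :&: t != 0)%VS & (b :&: t != 0)%VS].

(** Each of the five planes through U carries exactly one transversal. The line b meets the plane in
    a single point, which lies on one of the residual lines m, n since b is skew to U; it cannot lie
    on both, or b would be in the plane by [concurrent_sub]. *)
Lemma has_card_transversal U b : line U -> line b -> (U :&: b == 0)%VS ->
  has_card (transversal U b) 5.
Proof.
move=> lU lb Ub; have := has_card_tritangent triC dimV nsC lU.
move=> /(has_card_fib (f := fun m => (U + m)%VS) (A := transversal U b) (c := 1)).
have neq t : transversal U b t -> t <> U.
  by move=> [lt _ bt] e; rewrite e capvC Ub in bt.
apply.
  by move=> t tt; apply: meets_tritangent => //; have := neq t tt; case: tt.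
move=> W tW; have [dW UW _] := tW; have [dU _] := lU; have [db fb] := lb.
have bW : ~~ (b <= W)%VS.
  apply: contraL Ub => bW; apply: (cap_neq0_dim UW bW); by rewrite dW dU db.
have [x x0 [xb xW xP]] := line_plane_cap lb dW bW.
have [m [n [[lm ln mU nU nm] mW nW fW lW]]] := tritangent_lines lU tW.
have bt t : line t -> (t <= W)%VS -> (b :&: t != 0)%VS -> x \in t.
  move=> _ /subvP tW' /cap_neq0P[y y0 /andP[yb yt]].
  have /vlineP[a ya] := xP y yb (tW' _ yt).
  have a0 : a != 0 by apply: contraNneq y0 => a0; rewrite ya a0 scale0r.
  by rewrite -[x]scale1r -(mulVf a0) -scalerA -ya memvZ.
have tb t : x \in t -> (b :&: t != 0)%VS.
  by move=> xt; apply/cap_neq0P; exists x; rewrite ?xb.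
have key m1 n1 : line m1 -> line n1 -> m1 <> U -> n1 <> m1 -> (m1 <= W)%VS -> (n1 <= W)%VS ->
    (forall t, line t -> (t <= W)%VS -> [\/ t = U, t = m1 | t = n1]) -> x \in m1 ->
    has_card (fun t => transversal U b t /\ (U + t)%VS = W) 1.
  move=> lm1 ln1 m1U nm1 m1W n1W H xm1.
  apply: has_card_ext (has_card1 m1) => t; split=> [->|[tt e]].
    have [|[_ _ ?] ?] := (meets_sub m1 lU dW UW).2; first by split.
    by split=> //; split=> //; apply: tb.
  have [lt Ut bt'] := tt; have tW' : (t <= W)%VS by rewrite -e addvSr.
  have [/(neq _ tt)//|//|tn] := H t lt tW'.
  have xn : x \in n1 by rewrite -tn; apply: bt.
  have /negP[] := bW; apply: subv_trans (concurrent_sub lm1 ln1 lb _ x0 xm1 xn xb) _.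
    by move=> e'; apply: nm1.
  by rewrite subv_add m1W.
have [xU|xm|xn] := fW x xW (fb _ xb).
- have /negP[] : (U :&: b != 0)%VS by apply/cap_neq0P; exists x; rewrite ?xU.
  by [].
- exact: (key m n).
- apply: (key n m) => //; first by move=> e; apply: nm.
  by move=> t lt /(lW t lt)[]; [constructor 1|constructor 3|constructor 2].
Qed.

(** 27 = 3 + 3 * 8. A line outside a tritangent plane meets it on one of its three lines, and each
    of these meets 10 - 2 lines outside the plane. *)
Lemma has_card_lines U : line U -> has_card line 27.
Proof.
move=> lU; have [W tW] : exists W, tritangent C U W.
  have [[|W s] [_ // _ H]] := has_card_tritangent triC dimV nsC lU.
  by exists W; apply/H; rewrite inE eqxx.
have [dW UW _] := tW; have [m [n [[lm ln mU nU nm] mW nW fW lW]]] := tritangent_lines lU tW.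
have tm : tritangent C m W by split=> //; exists U; split=> // e; apply: mU.
have tn : tritangent C n W by split=> //; exists U; split=> // e; apply: nU.
have out U' : line U' -> tritangent C U' W ->
    has_card (fun b => meets U' b /\ ~ [/\ line b, b <> U' & (b <= W)%VS]) 8.
  move=> lU' tU'; have [_ U'W _] := tU'.
  apply: has_cardD (has_card_meets lU') (has_card_plane_lines lU' tU').
  by move=> b /(meets_sub b lU' dW U'W)[].
have cW : has_card (fun b => b = U \/ [/\ line b, b <> U & (b <= W)%VS]) 3.
  apply: has_cardU (has_card1 U) (has_card_plane_lines lU tW).
  by move=> b -> [].
(* No line is counted twice: outside W, a line meeting two of the three would do so at their common
   point, and would be coplanar with them. *)
have disj U1 U2 b : line U1 -> line U2 -> U1 <> U2 -> (U1 <= W)%VS -> (U2 <= W)%VS ->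
    line b -> ~~ (b <= W)%VS -> (U1 :&: b != 0)%VS -> (U2 :&: b != 0)%VS -> False.
  move=> l1 l2 U12 U1W U2W lb bW /cap_neq0P[y y0 /andP[yU1 yb]] /cap_neq0P[z z0 /andP[zU2 zb]].
  have [x x0 [xb xW xP]] := line_plane_cap lb dW bW.
  have /vlineP[a ya] := xP y yb (subvP U1W _ yU1).
  have /vlineP[c zc] := xP z zb (subvP U2W _ zU2).
  have a0 : a != 0 by apply: contraNneq y0 => a0; rewrite ya a0 scale0r.
  have c0 : c != 0 by apply: contraNneq z0 => c0; rewrite zc c0 scale0r.
  have yU2 : y \in U2.
    by rewrite ya -[a](mulfVK c0) -scalerA -zc memvZ.
  have /negP[] := bW; apply: subv_trans (concurrent_sub l1 l2 lb U12 y0 yU1 yU2 yb) _.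
  by rewrite subv_add U1W.
have nin U' b : meets U' b -> ~ [/\ line b, b <> U' & (b <= W)%VS] -> ~~ (b <= W)%VS.
  by move=> [lb bU' _] h; apply/negP => bW; apply: h.
have c1 := has_cardU _ (has_cardU _ (has_cardU _ cW (out _ lU tW)) (out _ lm tm)) (out _ ln tn).
apply: has_card_ext (c1 _ _ _).
- move=> b; split.
    case=> [[[[->|[]]|[[]]]|[[]]]|[[]]] //.
  move=> lb; have [bW|/negP bW] := pselect (b <= W)%VS.
    do 3!left; have [->|bU] := pselect (b = U); by [left|right].
  have [x x0 [xb xW xP]] := line_plane_cap lb dW bW.
  have nW' U' : ~ [/\ line b, b <> U' & (b <= W)%VS] by case=> _ _; rewrite (negPf bW).
  have bne U' : (U' <= W)%VS -> b <> U' by move=> U'W e; rewrite e U'W in bW.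
  have [_ fb] := lb; have mt U' : x \in U' -> (U' :&: b != 0)%VS.
    by move=> xU'; apply/cap_neq0P; exists x; rewrite ?xU'.
  have [xU|xm|xn] := fW x xW (fb _ xb).
  - by left; left; right; split=> //; split=> //; [apply: bne|apply: mt].
  - by left; right; split=> //; split=> //; [apply: bne|apply: mt].
  - by right; split=> //; split=> //; [apply: bne|apply: mt].
- move=> b [[[->|[_ _ bW]]|[mb' h']]|[mb' h']] [mb h]; have := nin _ _ mb h; rewrite ?UW ?bW //.
    have [[lb _ Ub] [_ _ mb0]] := (mb', mb).
    by move=> bW; apply: (disj U n b) => // e; apply: nU.
  have [[lb _ Ub] [_ _ mb0]] := (mb', mb).
  by move=> bW; apply: (disj m n b) => // e; apply: nm.
- move=> b [[->|[_ _ bW]]|[mb' h']] [mb h]; have := nin _ _ mb h; rewrite ?UW ?bW //.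
  have [[lb _ Ub] [_ _ mb0]] := (mb', mb).
  by move=> bW; apply: (disj U m b) => // e; apply: mU.
- move=> b [->|[_ _ bW]] [mb h]; have := nin _ _ mb h; rewrite ?UW ?bW //.
Qed.

(** 16 = 27 - 1 - 10. *)
Lemma has_card_skew U : line U -> has_card (fun b => line b /\ (U :&: b == 0)%VS) 16.
Proof.
move=> lU; have c11 := has_cardU _ (has_card1 U) (has_card_meets lU).
have {}c11 : has_card (fun b => b = U \/ meets U b) 11 by apply: c11 => b -> [].
have := has_cardD _ (has_card_lines lU) c11 => c16.
apply: has_card_ext (c16 _); last by move=> b [->|[]].
move=> b; split=> [[lb h]|[lb Ub]].
  split=> //; apply: contraT => Ub; case: h.
  by have [->|bU] := pselect (b = U); [left|right].
split=> // -[e|[_ _]]; last by rewrite Ub.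
have [dU _] := lU; move: Ub; rewrite e capvv -dimv_eq0 dU.
by [].
Qed.

Definition quadrilateral (q : ({vspace V} * {vspace V}) * ({vspace V} * {vspace V})) :=
  let: ((a, b), (t, t')) := q in
  [/\ line a, line b, (a :&: b == 0)%VS & [/\ transversal a b t, transversal a b t' & t' <> t]].

Lemma has_card_quadrilateral U : line U -> has_card quadrilateral 8640.
Proof.
move=> lU; have cab : has_card (fun ab : {vspace V} * {vspace V} =>
    [/\ line ab.1, line ab.2 & (ab.1 :&: ab.2 == 0)%VS]) (27 * 16).
  apply: (has_card_fib (f := fst) _ (has_card_lines lU)) => [ab []//|a la].
  apply: has_card_ext (has_card_image (f := pair a) _ (has_card_skew la)).
    move=> [a' b]; split=> [[b' [lb ab] [<- <-]]|[[/= la' lb ab] e]] //.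
    by exists b; rewrite -?e.
  by move=> b b' _ _ [].
apply: (@has_card_fib _ _ fst _ _ (27 * 16)%N 20 _ cab).
  by move=> [[a b] [t t']] [].
move=> [a b] [/= la lb ab].
have ct := has_card_transversal la lb ab.
have ctt : has_card (fun tt : {vspace V} * {vspace V} =>
    [/\ transversal a b tt.1, transversal a b tt.2 & tt.2 <> tt.1]) (5 * 4).
  apply: (has_card_fib (f := fst) _ ct) => [tt []//|t tt].
  apply: has_card_ext (has_card_image (f := pair t) _ (has_cardD1 tt ct)).
    move=> [t1 t2]; split=> [[t' [tt' ne] [<- <-]]|[[/= ? ? ?] e]] //.
    by exists t2; rewrite -?e.
  by move=> b1 b2 _ _ [].
apply: has_card_ext (has_card_image (f := pair (a, b)) _ ctt).
  move=> [[a' b'] [t t']]; split=> [[[t1 t1'] [/= ? ? ?] [<- <- <- <-]]|[[? ? ? [? ? ?]] [e e']]] //.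
  by exists (t, t'); rewrite -?e -?e'.
by move=> tt1 tt2 _ _ [].
Qed.

End LineCount.

Local Open Scope classical_set_scope.
Local Open Scope ring_scope.

(** * Extension of specializations *)

Lemma mulVexp_sub (L : fieldType) (t : L) i n : t != 0 -> (i <= n)%N ->
  t^-1 ^+ i * t ^+ n = t ^+ (n - i).
Proof.
move=> t0 le; rewrite exprVn -{1}(subnK le) exprD mulrCA mulVf ?mulr1 //.
by rewrite expf_neq0.
Qed.

Section Place.
Variables (k : closedFieldType) (K : fieldType) (iota : {rmorphism k -> K}).

(* The graph of a ring homomorphism, over k, from a subring of K to k. *)
Record specialization (G : set (K * k)) : Prop := Specialization {
  spec_const : forall c, G (iota c, c);
  specB : forall x y a b, G (x, a) -> G (y, b) -> G (x - y, a - b);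
  specM : forall x y a b, G (x, a) -> G (y, b) -> G (x * y, a * b);
  spec0 : forall b, G (0, b) -> b = 0 }.

Definition maximal_specialization G := specialization G /\
  forall G', specialization G' -> G `<=` G' -> G' `<=` G.

Lemma exists_maximal_specialization G0 : specialization G0 ->
  exists2 G, maximal_specialization G & G0 `<=` G.
Proof.
(* Zorn's lemma ranges over the sets A whose union with [G0] is a specialization; adjoining [G0]
   takes care of the empty chain. *)
move=> sG0; have [F sF totF|A [sA maxA]] :=
    @Zorn_bigcup _ (fun A => specialization (G0 `|` A)).
  have pair p q : (G0 `|` \bigcup_(X in F) X) p -> (G0 `|` \bigcup_(X in F) X) q ->
      exists2 H, specialization H & [/\ H p, H q & H `<=` G0 `|` \bigcup_(X in F) X].
    have sub X : F X -> G0 `|` X `<=` G0 `|` \bigcup_(X in F) X.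
      by move=> FX z [|Xz]; [left|right; exists X].
    move=> [G0p|[X FX Xp]] [G0q|[Y FY Yq]].
    - by exists G0; last by split=> // z; left.
    - by exists (G0 `|` Y); [apply: sF|split; [left|right|apply: sub]].
    - by exists (G0 `|` X); [apply: sF|split; [right|left|apply: sub]].
    have [XY|YX] := totF _ _ FX FY.
      by exists (G0 `|` Y); [apply: sF|split; [right; apply: XY|right|apply: sub]].
    by exists (G0 `|` X); [apply: sF|split; [right|right; apply: YX|apply: sub]].
  split=> [c|x y a b xa yb|x y a b xa yb|b xb].
  - by left; apply: spec_const.
  - by have [H sH [Hx Hy]] := pair _ _ xa yb; apply; apply: specB.
  - by have [H sH [Hx Hy]] := pair _ _ xa yb; apply; apply: specM.
  - by have [H sH [Hx _ _]] := pair _ _ xb xb; apply: spec0 Hx.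
exists (G0 `|` A); last by move=> z; left.
split=> // G' sG' GG'; apply: contrapT => nG'.
apply: (maxA G'); last first.
  by rewrite (_ : G0 `|` G' = G') //; apply/setUidPr => z G0z; apply: GG'; left.
split; first by move=> z Az; apply: GG'; right.
by move=> G'A; apply: nG' => z /G'A; right.
Qed.

Variable G : set (K * k).
Hypothesis sG : specialization G.

Lemma spec00 : G (0, 0). Proof. by have := spec_const sG 0; rewrite rmorph0. Qed.
Lemma spec11 : G (1, 1). Proof. by have := spec_const sG 1; rewrite rmorph1. Qed.
Lemma specN x a : G (x, a) -> G (- x, - a).
Proof. by rewrite -[- x]sub0r -[- a]sub0r; apply: specB spec00. Qed.
Lemma specD x y a b : G (x, a) -> G (y, b) -> G (x + y, a + b).
Proof. by move=> xa /specN/(specB sG xa); rewrite !opprK. Qed.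
Lemma specX x a n : G (x, a) -> G (x ^+ n, a ^+ n).
Proof.
move=> xa; elim: n => [|n IH]; first by rewrite !expr0; apply: spec11.
by rewrite !exprS; apply: specM.
Qed.
Lemma spec_sum I (r : seq I) (P : pred I) x a :
  (forall i, G (x i, a i)) -> G (\sum_(i <- r | P i) x i, \sum_(i <- r | P i) a i).
Proof.
move=> xa; elim/big_rec2: _ => [|i y z _]; [exact: spec00|exact: specD].
Qed.

Lemma spec_fun x a b : G (x, a) -> G (x, b) -> a = b.
Proof. by move=> xa /(specB sG xa); rewrite subrr => /(spec0 sG)/subr0_eq. Qed.

Definition spec_poly (P : {poly K}) (Q : {poly k}) := forall i, G (P`_i, Q`_i).

Lemma spec_polyB P P' Q Q' :
  spec_poly P Q -> spec_poly P' Q' -> spec_poly (P - P') (Q - Q').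
Proof. by move=> h h' i; rewrite !coefB; apply: specB. Qed.

Lemma spec_polyM P P' Q Q' :
  spec_poly P Q -> spec_poly P' Q' -> spec_poly (P * P') (Q * Q').
Proof. by move=> h h' i; rewrite !coefM; apply: spec_sum => j; apply: specM. Qed.

Lemma spec_poly_map Q : spec_poly (map_poly iota Q) Q.
Proof. by move=> i; rewrite coef_map; apply: spec_const. Qed.

Lemma spec_polyC x a : G (x, a) -> spec_poly x%:P a%:P.
Proof. by move=> xa i; rewrite !coefC; case: eqP => // _; apply: spec00. Qed.

Definition adjoin x al := [set p | exists P Q,
  [/\ spec_poly P Q, p.1 = P.[x] & p.2 = Q.[al]]].

Lemma sub_adjoin x al : G `<=` adjoin x al.
Proof.
move=> [y b] yb; exists y%:P, b%:P; rewrite !hornerC; split=> //.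
exact: spec_polyC.
Qed.

Lemma adjoin_specialization x al :
    (forall P Q, spec_poly P Q -> P.[x] = 0 -> Q.[al] = 0) ->
  specialization (adjoin x al).
Proof.
move=> H; split.
- by move=> c; apply: sub_adjoin; apply: (spec_const sG).
- move=> _ _ _ _ [P [Q [PQ /= -> ->]]] [P' [Q' [PQ' /= -> ->]]].
  by exists (P - P'), (Q - Q'); rewrite !hornerD !hornerN; split=> //=; apply: spec_polyB.
- move=> _ _ _ _ [P [Q [PQ /= -> ->]]] [P' [Q' [PQ' /= -> ->]]].
  by exists (P * P'), (Q * Q'); rewrite !hornerM; split=> //=; apply: spec_polyM.
- by move=> b [P [Q [PQ /= /esym P0 ->]]]; apply: H P0.
Qed.

Hypothesis maxG : forall G', specialization G' -> G `<=` G' -> G' `<=` G.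

(** By maximality, x can be sent to al as soon as every relation of x over the domain of [G] reduces
    to a relation of al. *)
Lemma spec_extend x al :
  (forall P Q, spec_poly P Q -> P.[x] = 0 -> Q.[al] = 0) -> G (x, al).
Proof.
move=> /adjoin_specialization sA; apply: (maxG sA (@sub_adjoin x al)).
exists 'X, 'X; rewrite !hornerX; split=> // i; rewrite !coefX.
by case: eqP => _; [apply: spec11 | apply: spec00].
Qed.

(** The domain of a maximal specialization is a local ring. A relation of 1/x, multiplied by a power
    of x, becomes one inside the domain of [G]. *)
Lemma specV x b : G (x, b) -> b != 0 -> G (x^-1, b^-1).
Proof.
move=> xb b0; have x0 : x != 0.
  by apply: contraNneq b0 => x0; apply/eqP/(spec0 sG); rewrite -x0.
apply: spec_extend => P Q PQ Px; pose n := maxn (size P) (size Q).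
have rev (L : fieldType) (R : {poly L}) (t : L) : t != 0 -> (size R <= n)%N ->
    R.[t^-1] * t ^+ n = \sum_(i < n) R`_i * t ^+ (n - i).
  move=> t0 sR; rewrite (horner_coef_wide _ sR) mulr_suml; apply: eq_bigr => i _.
  by rewrite -mulrA mulVexp_sub // ltnW.
have : G (\sum_(i < n) P`_i * x ^+ (n - i), \sum_(i < n) Q`_i * b ^+ (n - i)).
  by apply: spec_sum => i; apply: specM => //; apply: specX.
rewrite -!rev ?leq_maxl ?leq_maxr // Px mul0r => /(spec0 sG)/eqP.
by rewrite mulf_eq0 expf_eq0 (negPf b0) andbF orbF => /eqP.
Qed.

(** The reductions of the relations of x form an ideal of k[X]. If it is zero, x may be sent
    anywhere; if it is proper, to a root of its generator, as k is algebraically closed; otherwise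
    some relation reduces to 1. *)
Lemma spec_or_relation x :
  (exists al, G (x, al)) \/ exists2 P, spec_poly P 1 & P.[x] = 0.
Proof.
pose J (Q : {poly k}) := exists2 P, spec_poly P Q & P.[x] = 0.
have [[Q0 [Q00 JQ0]]|J0] := pselect (exists Q : {poly k}, Q != 0 /\ J Q); last first.
  left; exists 0; apply: spec_extend => P Q PQ Px.
  have [->|Q0] := eqVneq Q 0; first by rewrite horner0.
  by case: J0; exists Q; split=> //; exists P.
have : exists n, `[< exists Q : {poly k}, [/\ Q != 0, J Q & size Q = n] >].
  by exists (size Q0); apply/asboolP; exists Q0.
case/ex_minnP => n /asboolP[Q [Qn0 [P PQ Px] sQ]] minQ.
have [sQ1|sQ1] := leqP (size Q) 1.
  right; have c0 : Q`_0 != 0 by rewrite -polyC_eq0 -size1_polyC.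
  exists (map_poly iota ((Q`_0)^-1)%:P * P); last by rewrite hornerM Px mulr0.
  rewrite (_ : 1 = (Q`_0)^-1%:P * Q); last first.
    by rewrite {2}(size1_polyC sQ1) -polyCM mulVf.
  by apply: spec_polyM => //; apply: spec_poly_map.
have [al Qal] := root_of_size sQ1; left; exists al.
apply: spec_extend => P' Q' PQ' Px'.
have /eqP : Q' %% Q = 0.
  apply: contrapT => /eqP m0; have := ltn_modp Q' Q; rewrite Qn0 => lt.
  suff /minQ : `[< exists Q1 : {poly k}, [/\ Q1 != 0, J Q1 & size Q1 = size (Q' %% Q)] >].
    by rewrite leqNgt -sQ lt.
  apply/asboolP; exists (Q' %% Q); split=> //.
  rewrite -[Q' %% Q](addKr (Q' %/ Q * Q)) -divp_eq addrC.
  exists (P' - map_poly iota (Q' %/ Q) * P).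
    by apply: spec_polyB => //; apply: spec_polyM => //; apply: spec_poly_map.
  by rewrite hornerD hornerN hornerM Px Px' mulr0 subr0.
rewrite -/(Q %| Q') => /dvdpP[R ->].
by rewrite hornerM Qal mulr0.
Qed.

(* The relation P' for 1/x eliminates the leading term of the relation P for x. *)
Lemma relation_descent x n P P' : x != 0 ->
    spec_poly P 1 -> P.[x] = 0 -> (size P <= n.+1)%N ->
    spec_poly P' 1 -> P'.[x^-1] = 0 -> (size P' <= n.+1)%N ->
  exists P2, [/\ spec_poly P2 1, P2.[x] = 0 & (size P2 <= n)%N].
Proof.
move=> x0 PQ Px sP PQ' Px' sP'.
case: n => [|n] in sP sP' *.
  move: (PQ 0) Px; rewrite (size1_polyC sP) hornerC coefC coef1 /= => g e.
  by move: g; rewrite e => /(spec0 sG)/eqP; rewrite oner_eq0.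
pose R (L : fieldType) (S : {poly L}) := \poly_(j < n.+2) S`_(n.+1 - j).
have RS (S : {poly K}) (S' : {poly k}) : spec_poly S S' -> spec_poly (R _ S) (R _ S').
  by move=> SS i; rewrite !coef_poly; case: ltnP => // _; apply: spec00.
have q0 : G (P'`_0, 1) by have := PQ' 0; rewrite coef1.
have q00 : P'`_0 != 0.
  by apply/eqP => e; move: q0; rewrite e => /(spec0 sG)/eqP; rewrite oner_eq0.
have pn : G (P`_n.+1, 0) by have := PQ n.+1; rewrite coef1.
(* The reversal of P' vanishes at x, and its leading coefficient reduces to 1. The top coefficient
   of P reduces to 0, so the multiplier does too, and the difference still reduces to 1. *)
exists (P - (P`_n.+1 / P'`_0)%:P * R _ P'); split.
- rewrite (_ : 1 = 1 - 0%:P * R k 1); last by rewrite mul0r subr0.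
  apply: spec_polyB => //; apply: spec_polyM (RS _ _ PQ'); apply: spec_polyC.
  by have := specM sG pn (specV q0 (oner_neq0 _)); rewrite mul0r.
- suff Rx : (R K P').[x] = x ^+ n.+1 * P'.[x^-1].
    by rewrite hornerD hornerN hornerM Px Rx Px' !mulr0 subr0.
  rewrite horner_poly (reindex_inj rev_ord_inj) /= (horner_coef_wide _ sP') mulr_sumr.
  apply: eq_bigr => i _; have le : (i <= n.+1)%N by rewrite -ltnS.
  by rewrite subSS subKn // mulrCA [x ^+ _ * _]mulrC mulVexp_sub.
apply/leq_sizeP => j; rewrite coefB coefCM coef_poly.
rewrite leq_eqVlt => /orP[/eqP <-|lt].
  by rewrite ltnS leqnn subnn mulfVK // subrr.
by rewrite ltnNge lt /= mulr0 subr0 nth_default // (leq_trans sP).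
Qed.

(** The domain of [G] is a valuation ring. If neither x nor 1/x had a value, both would satisfy
    relations reducing to 1, and [relation_descent] would shorten the longer one forever. *)
Lemma spec_total x : x != 0 -> (exists b, G (x, b)) \/ (exists b, G (x^-1, b)).
Proof.
move=> x0; have [|[P PQ Px]] := spec_or_relation x; first by left.
have [|[P' PQ' Px']] := spec_or_relation x^-1; first by right.
suff [] : False by [].
have [N] := ubnP (size P + size P')%N.
elim: N => [//|N IH] in P PQ Px P' PQ' Px' * => lt.
have [le|le] := leqP (size P') (size P).
  case E : (size P) le => [|n] le.
    move: (PQ 0) ; rewrite nth_default ?E // coef1 => /(spec0 sG)/eqP.
    by rewrite oner_eq0.
  have [||P2 [PQ2 Px2 s2]] := @relation_descent x n P P' x0 PQ Px _ PQ' Px' _; rewrite ?E //.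
  apply: (IH P2 _ _ P') => //; apply: leq_ltn_trans (leq_add s2 (leqnn _)) _.
  by move: lt; rewrite E addSn ltnS.
case E : (size P') le => [//|n] le.
have [|||P2 [PQ2 Px2 s2]] :=
  @relation_descent x^-1 n P' P (invr_neq0 x0) PQ' Px' _ PQ _ _; rewrite ?E ?invrK //.
  exact: ltnW.
apply: (IH P _ _ P2) => //; apply: leq_ltn_trans (leq_add (leqnn _) s2) _.
by move: lt; rewrite E addnS ltnS.
Qed.

(** The chosen [a] is an entry of least valuation. *)
Lemma spec_primitive (s : seq K) : has (fun a => a != 0) s ->
  exists2 a, (a \in s) && (a != 0) & forall b, b \in s -> exists c, G (b / a, c).
Proof.
elim: s => [//|b s IH] /=; have [hs _|hs] := boolP (has _ s); last first.
  rewrite orbF => b0; exists b; first by rewrite inE eqxx b0.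
  move=> c; rewrite inE => /orP[/eqP ->|cs].
    by exists 1; rewrite divff //; apply: spec11.
  move/hasPn/(_ c cs): hs; rewrite negbK => /eqP ->.
  by exists 0; rewrite mul0r; apply: spec00.
have [a /andP[as_ a0] aP] := IH hs.
have [[c bac]|nc] := pselect (exists c, G (b / a, c)).
  exists a; first by rewrite inE as_ orbT a0.
  by move=> e; rewrite inE => /orP[/eqP ->|/aP //]; exists c.
have b0 : b != 0.
  by apply/eqP => b0; case: nc; exists 0; rewrite b0 mul0r; apply: spec00.
have [/nc//|[c]] := @spec_total (b / a) (mulf_neq0 b0 (invr_neq0 a0)).
rewrite invf_div => abc; exists b; first by rewrite inE eqxx b0.
move=> e; rewrite inE => /orP[/eqP ->|/aP[g ega]].
  by exists 1; rewrite divff //; apply: spec11.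
by exists (g * c); have := specM sG ega abc; rewrite mulrA divfK.
Qed.

End Place.

(** * Algebraic independence of the perturbation coefficients *)

Section Independence.
Variable k : fieldType.
Local Notation A4 := {mpoly k[4]}.
Variable B : 'I_5 -> A4.

(* The coefficients of the perturbation, as polynomials in a fifth variable over
   k[X_0, X_1, X_2, X_3]; their leading terms make them algebraically independent. *)
Definition lead_var (i : 'I_5) : A4 :=
  if unlift ord_max i is Some j then 'X_j else 1.
Definition perturb (i : 'I_5) : {poly A4} := 'X * (lead_var i)%:P + (B i)%:P.
Local Notation h := ((@polyC A4) \o (@mpolyC 4 k)).

Lemma formal_lead_exp (R : comNzRingType) (p : {poly R}) n a e :
  formal_lead p n a -> formal_lead (p ^+ e) (n * e) (a ^+ e).
Proof.
move=> pa; elim: e => [|e IH].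
  by rewrite muln0 !expr0; apply: formal_leadC.
by rewrite mulnS !exprS; apply: formal_leadM.
Qed.

Lemma formal_lead_prod (R : comNzRingType) I (s : seq I) (p : I -> {poly R}) n a :
  (forall i, formal_lead (p i) (n i) (a i)) ->
  formal_lead (\prod_(i <- s) p i) (\sum_(i <- s) n i) (\prod_(i <- s) a i).
Proof.
move=> pa; elim: s => [|i s IH]; first by rewrite !big_nil; apply: formal_leadC.
by rewrite !big_cons; apply: formal_leadM.
Qed.

Lemma formal_lead_perturb (m : 'X_{1..5}) :
  formal_lead (mmap1 perturb m) (mdeg m) (mmap1 lead_var m).
Proof.
rewrite mdegE; apply: formal_lead_prod => i.
have -> : perturb i = Poly (rcons [:: B i] (lead_var i)).
  by rewrite /perturb /Poly /= !cons_poly_def; ring.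
by have := formal_lead_exp (m i) (formal_lead_poly [:: B i] (lead_var i)); rewrite mul1n.
Qed.

(** The last variable has [lead_var] equal to 1, so its exponent disappears from the leading
    coefficient; the total degree recovers it. *)
Definition trunc4 (m : 'X_{1..5}) : 'X_{1..4} := [multinom m (lift ord_max i) | i < 4].

Lemma mmap1_lead_var m : mmap1 lead_var m = 'X_[trunc4 m].
Proof.
rewrite /mmap1 (bigD1_ord ord_max) //= /lead_var unlift_none expr1n mul1r.
by rewrite mpolyXE_id; apply: eq_bigr => i _; rewrite liftK mnmE.
Qed.

Lemma trunc4_inj m m' : mdeg m = mdeg m' -> trunc4 m = trunc4 m' -> m = m'.
Proof.
move=> dm tm; have em j : m (lift ord_max j) = m' (lift ord_max j).
  by have := congr1 (fun t : 'X_{1..4} => t j) tm; rewrite !mnmE.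
apply/mnmP => i; case: (unliftP ord_max i) => [j ->|->] //.
move: dm; rewrite !mdegE !(bigD1_ord (ord_max : 'I_5)) //=.
by rewrite (eq_bigr _ (fun j _ => em j)) => /addIn.
Qed.

(** The leading monomial [m0] of P is still visible in the image, in degree [mdeg m0] at the
    monomial [trunc4 m0]: monomials of lower degree do not reach this degree, and others of equal
    degree have another truncation. *)
Lemma perturb_independent (P : {mpoly k[5]}) : mmap h perturb P = 0 -> P = 0.
Proof.
move=> P0; apply/eqP; apply: contraT => Pn0; pose m0 := mlead P.
have m0P : m0 \in msupp P := mlead_supp Pn0.
suff : P@_m0 = 0 by move/eqP; rewrite mleadc_eq0 (negPf Pn0).
have := congr1 (fun Q : {poly A4} => (Q`_(mdeg m0))@_(trunc4 m0)) P0.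
rewrite coef0 mcoeff0 /mmap coef_sum raddf_sum /= (bigD1_seq m0) ?msupp_uniq //=.
rewrite coefCM mcoeffCM (formal_lead_perturb m0).2 mmap1_lead_var mcoeffX eqxx mulr1.
rewrite big1_seq ?addr0 // => m /andP[mm0 mP].
rewrite coefCM mcoeffCM; have le : (mdeg m <= mdeg m0)%N.
  by rewrite -ltnS mlead_deg // msize_mdeg_lt.
have [sm cm] := formal_lead_perturb m.
move: le; rewrite leq_eqVlt => /orP[/eqP e|lt].
  rewrite -e cm mmap1_lead_var mcoeffX; case: eqP => [/(trunc4_inj e) e'|_].
    by rewrite e' eqxx in mm0.
  by rewrite mulr0.
by rewrite nth_default ?mcoeff0 ?mulr0 // (leq_trans sm).
Qed.

End Independence.

(** * Existence of a line *)

Section TriForm.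
Variable R : comNzRingType.
Variable c : 'I_4 -> 'I_4 -> 'I_4 -> R.

(** Coordinates make it possible to push a trilinear form along a ring morphism. *)
Definition tri_form (x y w : 'cV[R]_4) : R :=
  \sum_i \sum_j \sum_l c i j l * x i 0 * y j 0 * w l 0.

Lemma tri_form_trilinear : trilinear tri_form.
Proof.
split=> a u u' v w; rewrite /tri_form mulr_sumr -big_split; apply: eq_bigr => i _;
  rewrite mulr_sumr -big_split; apply: eq_bigr => j _;
  rewrite mulr_sumr -big_split; apply: eq_bigr => l _ /=; rewrite !mxE; ring.
Qed.
End TriForm.

Lemma tri_form_map (R S : comNzRingType) (phi : {rmorphism R -> S}) c x y w :
  phi (tri_form c x y w) =
    tri_form (fun i j l => phi (c i j l)) (map_mx phi x) (map_mx phi y) (map_mx phi w).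
Proof.
rewrite rmorph_sum; apply: eq_bigr => i _; rewrite rmorph_sum; apply: eq_bigr => j _.
by rewrite rmorph_sum; apply: eq_bigr => l _; rewrite !rmorphM !mxE.
Qed.

Lemma trilinear_tri_form (k : comNzRingType) (C : 'cV[k]_4 -> 'cV[k]_4 -> 'cV[k]_4 -> k) :
    trilinear C ->
  forall x y w, C x y w = tri_form (fun i j l => C (delta_mx i 0) (delta_mx j 0) (delta_mx l 0)) x y w.
Proof.
move=> triC x y w.
have dE (z : 'cV[k]_4) : z = \sum_i z i 0 *: delta_mx i 0.
  rewrite {1}[z]matrix_sum_delta; apply: eq_bigr => i _.
  by rewrite big_ord1.
have s1 v1 v2 : C x v1 v2 = \sum_i x i 0 * C (delta_mx i 0) v1 v2.
  rewrite {1}(dE x) (big_morph (fun z => C z v1 v2) (op1 := +%R) (id1 := 0)).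
  - by apply: eq_bigr => i _; rewrite (trilinearZ1 triC).
  - by move=> ? ?; rewrite (trilinearD1 triC).
  - by rewrite (trilinear01 triC).
have s2 v1 v2 : C v1 y v2 = \sum_i y i 0 * C v1 (delta_mx i 0) v2.
  rewrite {1}(dE y) (big_morph (fun z => C v1 z v2) (op1 := +%R) (id1 := 0)).
  - by apply: eq_bigr => i _; rewrite (trilinearZ2 triC).
  - by move=> ? ?; rewrite (trilinearD2 triC).
  - by rewrite (trilinear02 triC).
have s3 v1 v2 : C v1 v2 w = \sum_i w i 0 * C v1 v2 (delta_mx i 0).
  rewrite {1}(dE w) (big_morph (fun z => C v1 v2 z) (op1 := +%R) (id1 := 0)).
  - by apply: eq_bigr => i _; rewrite (trilinearZ3 triC).
  - by move=> ? ?; rewrite (trilinearD3 triC).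
  - by rewrite (trilinear03 triC).
rewrite s1; apply: eq_bigr => i _; rewrite s2 mulr_sumr; apply: eq_bigr => j _.
by rewrite s3 !mulr_sumr; apply: eq_bigr => l _; ring.
Qed.

Section SpecializeLine.
Variables (k : closedFieldType) (K : fieldType) (iota : {rmorphism k -> K}).
Variable G : set (K * k).
Hypothesis maxG : maximal_specialization iota G.

(** Properness of projective space: after division by a coordinate of least valuation, all
    coordinates specialize and one of them is 1. *)
Lemma spec_primitive_vec (x : 'cV[K]_4) : x != 0 -> exists i,
  x i 0 != 0 /\ exists xb : 'cV[k]_4, forall j, G (x j 0 / x i 0, xb j 0).
Proof.
have [sG mG] := maxG; move=> x0.
have [|a /andP[/mapP[i _ ->] xi0] aP] := spec_primitive sG mG (s := [seq x i 0 | i <- enum 'I_4]).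
  apply/negPn/negP => /hasPn h; case/negP: x0; apply/eqP/matrixP => i j.
  by rewrite (ord1 j) mxE; apply/eqP/negPn/h/map_f; rewrite mem_enum.
exists i; split=> //.
have /choice[f fP] : forall j, exists b, G (x j 0 / x i 0, b).
  by move=> j; apply: aP; apply: map_f; rewrite mem_enum.
by exists (\col_j f j) => j; rewrite mxE.
Qed.

(* Reduction of the row echelon form, so that the rank does not drop. *)
Lemma specialize_line (Phi : 'cV[K]_4 -> K) (phi : 'cV[k]_4 -> k) (u v : 'cV[K]_4) :
    (forall (x : 'cV[K]_4) (xb : 'cV[k]_4), (forall i, G (x i 0, xb i 0)) -> G (Phi x, phi xb)) ->
    (forall a b : K, Phi (a *: u + b *: v) = 0) ->
    (forall a b : K, a *: u + b *: v = 0 -> a = 0 /\ b = 0) ->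
  exists ub vb : 'cV[k]_4, [/\ ub != 0, vb \notin <[ub]>%VS &
    forall a b : k, phi (a *: ub + b *: vb) = 0].
Proof.
have [sG mG] := maxG; move=> GPhi Phi0 free.
have [|i [ui0 [ub ubP]]] := @spec_primitive_vec u.
  by apply/eqP => u0; have [|/eqP] := free 1 0; rewrite ?u0 ?scaler0 ?scale0r ?addr0 // oner_eq0.
(* Clearing the coordinate i makes the reductions echelon: ub is 1 at i, while vb is 0 at i and 1 at
   j. *)
pose v1 := v - (v i 0 / u i 0) *: u.
have [|j [vj0 [vb vbP]]] := @spec_primitive_vec v1.
  apply/eqP => v0; have [|_ /eqP] := free (- (v i 0 / u i 0)) 1; last by rewrite oner_eq0.
  by rewrite scale1r scaleNr addrC.
have ubi : ub i 0 = 1.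
  by apply: (spec_fun sG (ubP i)); rewrite divff //; apply: (spec11 sG).
have vbi : vb i 0 = 0.
  apply: (spec_fun sG (vbP i)); rewrite /v1 !mxE divfK // subrr mul0r.
  exact: (spec00 sG).
have vbj : vb j 0 = 1.
  by apply: (spec_fun sG (vbP j)); rewrite divff //; apply: (spec11 sG).
exists ub, vb; split.
- by apply/eqP => e; move: ubi; rewrite e mxE => /eqP; rewrite eq_sym oner_eq0.
- apply/negP => /vlineP[a e]; move: vbi vbj; rewrite e !mxE ubi mulr1 => ->.
  by rewrite mul0r => /eqP; rewrite eq_sym oner_eq0.
move=> a b; apply: (spec0 sG).
have {1}-> : 0 = Phi ((iota a / u i 0 - iota b / v1 j 0 * (v i 0 / u i 0)) *: u + (iota b / v1 j 0) *: v).
  by rewrite Phi0.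
apply: GPhi => l.
have := specD sG (specM sG (spec_const sG a) (ubP l)) (specM sG (spec_const sG b) (vbP l)).
by rewrite /v1 !mxE; congr (G (_, _)); ring.
Qed.

End SpecializeLine.

(** On the line, x has coordinates s and t at i0 and i1, so the form restricts to a binary cubic in
    s and t; the four subtracted terms are exactly its monomials. *)
Lemma perturbed_line (K : comNzRingType) (CK : 'cV[K]_4 -> 'cV[K]_4 -> 'cV[K]_4 -> K)
    (i0 i1 i2 i3 : 'I_4) (u v : 'cV[K]_4) (z a b c d s t : K) :
    trilinear CK -> u i0 0 = 1 -> u i1 0 = 0 -> u i2 0 = a -> u i3 0 = c ->
    v i0 0 = 0 -> v i1 0 = 1 -> v i2 0 = b -> v i3 0 = d ->
  let x := s *: u + t *: v in
  cubic CK x + z * (x i0 0 ^+ 2 * x i2 0 + x i1 0 ^+ 2 * x i3 0)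
  - (z * a + cubic CK u) * x i0 0 ^+ 3
  - (z * b + polar1 CK u v) * (x i0 0 ^+ 2 * x i1 0)
  - (z * c + polar1 CK v u) * (x i0 0 * x i1 0 ^+ 2)
  - (z * d + cubic CK v) * x i1 0 ^+ 3 = 0.
Proof.
move=> triK u0 u1 u2 u3 v0 v1 v2 v3 /=.
rewrite !mxE u0 u1 u2 u3 v0 v1 v2 v3 !(cubicD triK, cubicZ triK).
by rewrite !(polar1Zl triK, polar1Zr triK); ring.
Qed.

Lemma echelon_free (K : comNzRingType) (i0 i1 : 'I_4) (u v : 'cV[K]_4) (a b : K) :
    u i0 0 = 1 -> u i1 0 = 0 -> v i0 0 = 0 -> v i1 0 = 1 ->
  a *: u + b *: v = 0 -> a = 0 /\ b = 0.
Proof.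
move=> u0 u1 v0 v1 /matrixP e; have := e i0 0; have := e i1 0.
by rewrite !mxE u0 u1 v0 v1 !mulr0 !mulr1 add0r addr0 => -> ->.
Qed.

Section ExistsLine.
Variables (k : closedFieldType) (C : 'cV[k]_4 -> 'cV[k]_4 -> 'cV[k]_4 -> k).
Hypothesis triC : trilinear C.
Local Notation A4 := {mpoly k[4]}.
Local Notation K := {fraction {poly A4}}.

Let i0 : 'I_4 := inord 0.
Let i1 : 'I_4 := inord 1.
Let i2 : 'I_4 := inord 2.
Let i3 : 'I_4 := inord 3.
Let c i j l := C (delta_mx i 0) (delta_mx j 0) (delta_mx l 0).
Let CA := tri_form (fun i j l => (c i j l)%:MP_[4]).
Let uA : 'cV[A4]_4 := \col_i [:: 1; 0; 'X_i0; 'X_i2]`_i.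
Let vA : 'cV[A4]_4 := \col_i [:: 0; 1; 'X_i1; 'X_i3]`_i.
(** The list has four entries: at the last index [B] takes the default value 0, which makes [y 4]
    the free variable itself. *)
Let B (i : 'I_5) : A4 := [:: cubic CA uA; polar1 CA uA vA; polar1 CA vA uA; cubic CA vA]`_i.
Let y (i : nat) : K := tofrac (perturb B (inord i)).
Let h : {rmorphism k -> {poly A4}} := (@polyC A4) \o (@mpolyC 4 k).
Let iota : {rmorphism k -> K} := (@tofrac {poly A4}) \o h.
Let phi : {rmorphism A4 -> K} := (@tofrac {poly A4}) \o (@polyC A4).

(** A polynomial in [y 0], ..., [y 4] goes to its constant term; this is well defined by
    [perturb_independent]. *)
Definition initial_specialization : set (K * k) :=
  [set p | exists P : {mpoly k[5]}, p = (tofrac (mmap h (perturb B) P), P.@[fun=> 0])].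

Lemma initial_specializationP : specialization iota initial_specialization.
Proof.
split.
- by move=> a; exists a%:MP; rewrite mmapC mevalC.
- move=> _ _ _ _ [P [-> ->]] [Q [-> ->]]; exists (P - Q).
  by rewrite raddfB rmorphB mevalB.
- move=> _ _ _ _ [P [-> ->]] [Q [-> ->]]; exists (P * Q).
  by rewrite rmorphM rmorphM mevalM.
move=> b [P [/esym/eqP]]; rewrite tofrac_eq0 => /eqP /perturb_independent -> ->.
by rewrite meval0.
Qed.

Lemma initial_y i : (i < 5)%N -> initial_specialization (y i, 0).
Proof.
move=> i5; exists 'X_(inord i); rewrite mevalXU; congr (_, _).
by rewrite mmapX mmap1U.
Qed.

Lemma lead_var_inord i : (i < 4)%N -> lead_var k (inord i) = 'X_(inord i).
Proof.
move=> i4; rewrite /lead_var (_ : inord i = lift ord_max (inord i : 'I_4)) ?liftK //.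
by apply: val_inj; rewrite /= (inordK i4) inordK ?ltnS ?(ltnW i4) // /bump leqNgt i4.
Qed.

Lemma y_lt4 i : (i < 4)%N ->
  y i = tofrac 'X * phi 'X_(inord i) + phi (B (inord i)).
Proof.
move=> i4; rewrite /y /perturb lead_var_inord // rmorphD rmorphM.
by [].
Qed.

Lemma y4 : y 4 = tofrac 'X.
Proof.
rewrite /y /perturb /B inordK // (_ : inord 4 = ord_max); last first.
  by apply: val_inj; rewrite /= inordK.
by rewrite /lead_var unlift_none mulr1 addr0.
Qed.

Lemma B_nth i : (i < 4)%N ->
  B (inord i) = nth 0 [:: cubic CA uA; polar1 CA uA vA; polar1 CA vA uA; cubic CA vA] i.
Proof. by move=> i4; rewrite /B inordK // ltnW. Qed.

Let CK := tri_form (fun a b d => iota (c a b d)).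
Let uK := map_mx phi uA.
Let vK := map_mx phi vA.

Lemma phi_cubic x : phi (cubic CA x) = cubic CK (map_mx phi x).
Proof. exact: (tri_form_map phi). Qed.

Lemma phi_polar1 x w : phi (polar1 CA x w) = polar1 CK (map_mx phi x) (map_mx phi w).
Proof. by rewrite /polar1 !(rmorphD phi) /CA !(tri_form_map phi). Qed.

(* y 4 is the free variable, and y 0, y 1, y 2, y 3 are what makes Phi vanish on the
   span of uK = (1, 0, X_0, X_2) and vK = (0, 1, X_1, X_3). *)
Let Phi (x : 'cV[K]_4) := cubic CK x
  + y 4 * (x i0 0 ^+ 2 * x i2 0 + x i1 0 ^+ 2 * x i3 0)
  - y 0 * x i0 0 ^+ 3 - y 1 * (x i0 0 ^+ 2 * x i1 0)
  - y 2 * (x i0 0 * x i1 0 ^+ 2) - y 3 * x i1 0 ^+ 3.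

Lemma uK_coords :
  [/\ uK i0 0 = 1, uK i1 0 = 0, uK i2 0 = phi 'X_i0 & uK i3 0 = phi 'X_i2].
Proof. by split; rewrite !mxE inordK ?rmorph1 ?rmorph0. Qed.

Lemma vK_coords :
  [/\ vK i0 0 = 0, vK i1 0 = 1, vK i2 0 = phi 'X_i1 & vK i3 0 = phi 'X_i3].
Proof. by split; rewrite !mxE inordK ?rmorph1 ?rmorph0. Qed.

Lemma Phi_line a b : Phi (a *: uK + b *: vK) = 0.
Proof.
have triK : trilinear CK := tri_form_trilinear _.
have [u0 u1 u2 u3] := uK_coords; have [v0 v1 v2 v3] := vK_coords.
rewrite /Phi y4 !y_lt4 // !B_nth // !phi_cubic !phi_polar1.
exact: (perturbed_line _ _ _ triK u0 u1 u2 u3 v0 v1 v2 v3).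
Qed.

Lemma exists_line : exists U, is_line C U.
Proof.
have [G maxG G0G] := exists_maximal_specialization initial_specializationP.
have [sG _] := maxG.
have Gy i : (i < 5)%N -> G (y i, 0) by move=> /initial_y/G0G.
have [||ub [vb [ub0 vub fuv]]] := @specialize_line _ _ iota G maxG Phi (cubic C) uK vK _ (@Phi_line).
- move=> x xb Gx; rewrite /cubic (trilinear_tri_form triC).
  (* The zeros stand for the values of the [y i], so that the right side follows the shape of
     [Phi]. *)
  have -> : tri_form c xb xb xb = tri_form c xb xb xb
    + 0 * (xb i0 0 ^+ 2 * xb i2 0 + xb i1 0 ^+ 2 * xb i3 0)
    - 0 * xb i0 0 ^+ 3 - 0 * (xb i0 0 ^+ 2 * xb i1 0)
    - 0 * (xb i0 0 * xb i1 0 ^+ 2) - 0 * xb i1 0 ^+ 3 by ring.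
  do !apply: (specB sG); rewrite /Phi.
  + apply: (specD sG).
      apply: (spec_sum sG) => i; apply: (spec_sum sG) => j; apply: (spec_sum sG) => l.
      by do !apply: (specM sG) => //; apply: (spec_const sG).
    apply: (specM sG); first exact: Gy.
    by apply: (specD sG); apply: (specM sG) => //; apply: (specX sG).
  + by apply: (specM sG); [exact: Gy | apply: (specX sG)].
  + by apply: (specM sG); [exact: Gy | apply: (specM sG) => //; apply: (specX sG)].
  + by apply: (specM sG); [exact: Gy | apply: (specM sG) => //; apply: (specX sG)].
  + by apply: (specM sG); [exact: Gy | apply: (specX sG)].
- have [u0 u1 _ _] := uK_coords; have [v0 v1 _ _] := vK_coords.
  by move=> a b; apply: (echelon_free u0 u1 v0 v1).
exists (<[ub]> + <[vb]>)%VS; split; first by rewrite dim_pair ub0 vub.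
by move=> x /mem_pairP[a [b ->]].
Qed.

End ExistsLine.

(** * A cubic form is determined by its zeros *)

Section CubicZeros.
Variable k : closedFieldType.

Definition cubic_disc (R : comPzRingType) (a b c d : R) :=
  b ^+ 2 * c ^+ 2 - 4%:R * a * c ^+ 3 - 4%:R * b ^+ 3 * d
  - 27%:R * a ^+ 2 * d ^+ 2 + 18%:R * a * b * c * d.

Lemma cubic_three_roots (a b c d : k) : a != 0 -> cubic_disc a b c d != 0 ->
  exists r1 r2 r3 : k, [/\ r1 != r2, r1 != r3, r2 != r3 &
    forall r, r \in [:: r1; r2; r3] -> a * r ^+ 3 + b * r ^+ 2 + c * r + d = 0].
Proof.
move=> a0 disc0; have [|r1 E1] := @root_of_size _ (Poly [:: d; c; b; a]).
  by rewrite (@PolyK _ 0).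
have {}E1 : a * r1 ^+ 3 + b * r1 ^+ 2 + c * r1 + d = 0.
  by rewrite -[RHS]E1 horner_Poly /=; ring.
(* A root of the quotient of the cubic by X - r1; r3 is then forced by the sum of the roots. *)
have [r2 E2] := quadratic_root (b + a * r1) (c + b * r1 + a * r1 ^+ 2) a0.
pose r3 := - (b / a) - r1 - r2.
have bE : b = - a * (r1 + r2 + r3) by rewrite /r3; field.
have cE : c = a * (r1 * r2 + r1 * r3 + r2 * r3).
  by apply/eqP; rewrite -subr_eq0 -[X in _ == X]E2 {1 2}bE; apply/eqP; ring.
have dE : d = - a * r1 * r2 * r3.
  by apply/eqP; rewrite -subr_eq0 -[X in _ == X]E1 {1}bE {1}cE; apply/eqP; ring.
clearbody r3; subst b; subst c; subst d.
have discE : cubic_disc a (- a * (r1 + r2 + r3))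
    (a * (r1 * r2 + r1 * r3 + r2 * r3)) (- a * r1 * r2 * r3)
    = a ^+ 4 * ((r1 - r2) * (r1 - r3) * (r2 - r3)) ^+ 2.
  by rewrite /cubic_disc; ring.
move: disc0; rewrite discE mulf_eq0 negb_or !expf_eq0 /= !mulf_eq0 !negb_or !subr_eq0.
move=> /andP[_ /andP[/andP[r12 r13] r23]]; exists r1, r2, r3; split=> // r.
by rewrite !inE => /or3P[] /eqP ->; ring.
Qed.

Lemma quadratic_three_roots (a b c r1 r2 r3 : k) :
    r1 != r2 -> r1 != r3 -> r2 != r3 ->
    (forall r, r \in [:: r1; r2; r3] -> a * r ^+ 2 + b * r + c = 0) ->
  c = 0.
Proof.
move=> r12 r13 r23 H; have : Poly [:: c; b; a] = 0.
  apply: (@roots_geq_poly_eq0 _ _ [:: r1; r2; r3]).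
  - apply/allP => r /H h; apply/rootP; rewrite horner_Poly /= -[RHS]h; ring.
  - by rewrite /= !inE negb_or r12 r13 r23.
  - exact: size_Poly.
by move=> /(congr1 (fun p : {poly k} => p`_0)); rewrite coef_Poly coef0.
Qed.

Lemma poly_zero_everywhere (p : {poly k}) : (forall x, p.[x] = 0) -> p = 0.
Proof.
move=> H; apply/eqP; apply: contraT => /closed_nonrootP[x].
by rewrite /root H eqxx.
Qed.

Lemma horner_Poly4 (a b c d t : k) :
  (Poly [:: a; b; c; d]).[t] = a + t * b + t ^+ 2 * c + t ^+ 3 * d.
Proof. by rewrite horner_Poly /=; ring. Qed.

Section Vanishing.
Variables (V : lmodType k) (C C' : V -> V -> V -> k).
Hypotheses (triC : trilinear C) (triC' : trilinear C').
Hypothesis CC' : forall x, cubic C x = 0 -> cubic C' x = 0.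

(* A line through o meeting the surface of C in three points carries at most a
   quadratic polynomial C' with three zeros; such lines are dense. *)
Lemma cubic_vanish o u : cubic C o != 0 -> cubic C' o = 0 ->
    cubic_disc (cubic C o) (polar1 C o u) (polar1 C u o) (cubic C u) != 0 ->
  forall x, cubic C' x = 0.
Proof.
move=> o0 o'0 du x; pose d := x - u.
pose pb := Poly [:: polar1 C o u; polar1 C o d; 0; 0].
pose pc := Poly [:: polar1 C u o; polar2 C u d o; polar1 C d o; 0].
pose pd := Poly [:: cubic C u; polar1 C u d; polar1 C d u; cubic C d].
pose pg := Poly [:: cubic C' u; polar1 C' u d; polar1 C' d u; cubic C' d].
pose pD := cubic_disc (cubic C o)%:P pb pc pd.
have hb s : pb.[s] = polar1 C o (u + s *: d).
  by rewrite horner_Poly4 !(polarE triC); ring.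
have hc s : pc.[s] = polar1 C (u + s *: d) o.
  by rewrite horner_Poly4 !(polarE triC); ring.
have hd s : pd.[s] = cubic C (u + s *: d).
  by rewrite horner_Poly4 !(polarE triC); ring.
have hg s : pg.[s] = cubic C' (u + s *: d).
  by rewrite horner_Poly4 !(polarE triC'); ring.
have hD s : pD.[s] = cubic_disc (cubic C o) (polar1 C o (u + s *: d))
    (polar1 C (u + s *: d) o) (cubic C (u + s *: d)).
  by rewrite -hb -hc -hd /pD /cubic_disc !(hornerD, hornerN, hornerM, horner_exp, hornerMn, hornerC); ring.
have vanish s : pD.[s] != 0 -> pg.[s] = 0.
  rewrite hD hg => /(cubic_three_roots o0)[r1 [r2 [r3 [r12 r13 r23 H]]]].
  apply: (quadratic_three_roots (a := polar1 C' o (u + s *: d))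
    (b := polar1 C' (u + s *: d) o) r12 r13 r23) => r /H Hr.
  have : cubic C' ((u + s *: d) + r *: o) = 0.
    apply: CC'; rewrite (cubicD triC) !(cubicZ triC, polar1Zl triC, polar1Zr triC).
    by rewrite -[RHS]Hr; ring.
  rewrite (cubicD triC') !(cubicZ triC', polar1Zl triC', polar1Zr triC') o'0 => h.
  by rewrite -[RHS]h; ring.
(* For each s one factor vanishes; pD is nonzero at s = 0, so pg is the zero polynomial, and s = 1
   is the point x. *)
have /eqP : pD * pg = 0.
  apply: poly_zero_everywhere => s; rewrite hornerM.
  by have [->|/vanish ->] := eqVneq pD.[s] 0; rewrite ?mul0r ?mulr0.
rewrite mulf_eq0 => /orP[] /eqP p0.
  by move: (hD 0) du; rewrite p0 horner0 scale0r addr0 => <-; rewrite eqxx.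
by have := hg 1; rewrite p0 horner0 scale1r /d addrC subrK.
Qed.

End Vanishing.

(** On the line through u and v the form is x y (x D(u, v) + y D(v, u)), with three distinct zeros.
    From a point o of this line off the surface, the direction u satisfies the hypothesis of
    [cubic_vanish], applied to C' - c C with c chosen to vanish at o. *)
Lemma cubic_determined (V : lmodType k) (C C' : V -> V -> V -> k) u v :
    trilinear C -> trilinear C' -> cubic C u = 0 -> cubic C v = 0 ->
    polar1 C u v != 0 -> polar1 C v u != 0 ->
    (forall x, cubic C x = 0 -> cubic C' x = 0) ->
  exists c, forall x, cubic C' x = c * cubic C x.
Proof.
move=> triC triC' fu fv uv vu H.
(* The excluded values are those for which u + al v falls on the surface. *)
have [al] := exists_notin_seq [:: 0; - (polar1 C u v / polar1 C v u)].
rewrite !inE negb_or => /andP[al0 al1].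
pose o := u + al *: v.
have oE : cubic C o = al * (polar1 C u v + al * polar1 C v u).
  by rewrite /o !(polarE triC) fu fv; ring.
have o0 : cubic C o != 0.
  rewrite oE mulf_neq0 //; apply: contra al1; rewrite addr_eq0 => /eqP ->.
  by rewrite mulNr opprK mulfK.
pose c := cubic C' o / cubic C o; exists c.
pose C2 x y z := C' x y z - c * C x y z.
have tri2 : trilinear C2.
  split=> a x x' y z; rewrite /C2.
  - by rewrite (trilinear1 triC) (trilinear1 triC'); ring.
  - by rewrite (trilinear2 triC) (trilinear2 triC'); ring.
  - by rewrite (trilinear3 triC) (trilinear3 triC'); ring.
have C2E x : cubic C2 x = cubic C' x - c * cubic C x by [].
suff C20 : forall x, cubic C2 x = 0 by move=> x; apply/eqP; rewrite -subr_eq0 -C2E C20.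
apply: (@cubic_vanish _ C C2 triC tri2 _ o u o0).
- by move=> x fx; rewrite C2E fx (H _ fx); ring.
- by rewrite C2E /c divfK // subrr.
have -> : polar1 C o u = al * (2%:R * polar1 C u v + al * polar1 C v u).
  by rewrite /o !(polarE triC) fu; ring.
have -> : polar1 C u o = al * polar1 C u v.
  by rewrite /o !(polarE triC) fu; ring.
rewrite oE fu /cubic_disc.
rewrite (_ : _ + _ = al ^+ 6 * polar1 C u v ^+ 2 * polar1 C v u ^+ 2); last by ring.
by rewrite !mulf_neq0 // expf_neq0.
Qed.

(** The difference vanishes on the whole space, so [polar1_on_cubic] applies to it. *)
Lemma eq_cubic_polar1 (V : vectType k) (C C' : V -> V -> V -> k) :
    trilinear C -> trilinear C' -> (forall x, cubic C x = cubic C' x) ->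
  forall u v, polar1 C u v = polar1 C' u v.
Proof.
move=> triC triC' H u v; pose C2 x y z := C x y z - C' x y z.
have tri2 : trilinear C2.
  split=> a x x' y z; rewrite /C2.
  - by rewrite (trilinear1 triC) (trilinear1 triC'); ring.
  - by rewrite (trilinear2 triC) (trilinear2 triC'); ring.
  - by rewrite (trilinear3 triC) (trilinear3 triC'); ring.
have on2 : on_cubic C2 fullv by move=> x _; apply/eqP; rewrite subr_eq0; apply/eqP/H.
have := polar1_on_cubic tri2 on2 (memvf u) (memvf v).
by rewrite /polar1 /C2 => h; apply/eqP; rewrite -subr_eq0 -[X in _ == X]h; apply/eqP; ring.
Qed.

Lemma eq_cubic_polar2 (V : vectType k) (C C' : V -> V -> V -> k) :
    trilinear C -> trilinear C' -> (forall x, cubic C x = cubic C' x) ->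
  forall u v w, polar2 C u v w = polar2 C' u v w.
Proof.
move=> triC triC' H u v w; have E := eq_cubic_polar1 triC triC' H.
have := E (u + v) w; rewrite (polar1Dl triC) (polar1Dl triC') !E => h.
by move: h => /addIr /addrI.
Qed.

End CubicZeros.

(** * From polynomials to trilinear forms *)

Section Polynomials.
Variable k : closedFieldType.
Implicit Types (F : {mpoly k[4]}) (v w : 'cV[k]_4).

Local Notation ev F v := (F.@[fun i => v i ord0]).

Lemma mnm_pred n (m : 'X_{1..4}) : mdeg m = n.+1 ->
  exists i m', m = (U_(i) + m')%MM /\ mdeg m' = n.
Proof.
move=> dm; have [i mi] : exists i, m i != 0%N.
  apply: contrapT => m0; move: dm; rewrite (_ : m = 0%MM) ?mdeg0 //.
  by apply/mnmP => i; rewrite mnm0E; apply/eqP; apply: contrapT => /negP mi; apply: m0; exists i.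
have mE : m = (U_(i) + (m - U_(i)))%MM by rewrite addmC submK // lep1mP.
exists i, (m - U_(i))%MM; split=> //.
by move: dm; rewrite {1}mE mdegD mdeg1 => -[].
Qed.

Lemma mnm_deg3 (m : 'X_{1..4}) : mdeg m = 3%N ->
  exists i j l, 'X_[m] = 'X_i * 'X_j * 'X_l :> {mpoly k[4]}.
Proof.
move=> /mnm_pred[i [m1 [-> /mnm_pred[j [m2 [-> /mnm_pred[l [m3 [-> d3]]]]]]]]].
exists i, j, l; have -> : m3 = 0%MM by apply/eqP; rewrite -mdeg_eq0 d3.
by rewrite addm0 !mpolyXD mulrA.
Qed.

Lemma mderiv_monomial (i j l a : 'I_4) v :
  ev (('X_i * 'X_j * 'X_l : {mpoly k[4]})^`M(a)) v =
  (i == a)%:R * v j 0 * v l 0 + v i 0 * (j == a)%:R * v l 0 + v i 0 * v j 0 * (l == a)%:R.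
Proof.
have dX (b : 'I_4) : ('X_b : {mpoly k[4]})^`M(a) = (b == a)%:R%:MP.
  rewrite mderivX mnm1E; have [->|] := eqVneq b a; last by rewrite scale0r mpolyC0.
  by rewrite (_ : (U_(a) - U_(a))%MM = 0%MM) ?mpolyX0 ?scale1r ?mpolyC1 //; apply/mnmP => c; rewrite mnmBE subnn mnm0E.
by rewrite !mderivM !dX !(mevalD, mevalM, mevalXU, mevalC); ring.
Qed.

(** Each monomial is written as an ordered product x_i x_j x_l and gives one trilinear term; nothing
    is divided by 6. *)
Lemma homog3_trilinear F : F \is 3.-homog -> exists C : 'cV[k]_4 -> 'cV[k]_4 -> 'cV[k]_4 -> k, [/\ trilinear C,
  forall v, cubic C v = ev F v &
  forall v w, polar1 C v w = \sum_i w i 0 * ev (F^`M(i)) v].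
Proof.
move=> /dhomogP hF; rewrite [F]mpolyE.
have : {in msupp F, forall m, mdeg m = 3%N} by [].
elim: (msupp F) => [_|m s IH hs].
  exists (fun _ _ _ : 'cV[k]_4 => 0); rewrite big_nil; split=> [|v|v w].
  - by split=> *; rewrite mulr0 addr0.
  - by rewrite meval0.
  - by rewrite /polar1 !addr0 big1 // => i _; rewrite mderiv0 meval0 mulr0.
have [|C1 [tri1 c1 p1]] := IH; first by move=> m' m's; apply: hs; rewrite inE m's orbT.
have [i [j [l mE]]] := mnm_deg3 (hs m (mem_head _ _)).
pose a := F@_m.
exists (fun x y z : 'cV[k]_4 => a * (x i 0 * y j 0 * z l 0) + C1 x y z); split.
- split=> b x x' y z; rewrite !mxE.
  + by rewrite (trilinear1 tri1); ring.
  + by rewrite (trilinear2 tri1); ring.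
  + by rewrite (trilinear3 tri1); ring.
- move=> v; rewrite big_cons mE mevalD mevalZ !mevalM !mevalXU -c1.
  by [].
move=> v w; rewrite big_cons mE.
rewrite (eq_bigr (fun d => w d 0 * (a * ((i == d)%:R * v j 0 * v l 0
     + v i 0 * (j == d)%:R * v l 0 + v i 0 * v j 0 * (l == d)%:R))
     + w d 0 * ev (\sum_(m <- s) F@_m *: 'X_[m])^`M(d) v)); last first.
  by move=> d _; rewrite mderivD mderivZ mevalD mevalZ mderiv_monomial mulrDr.
rewrite big_split -p1 /=.
have sE (b : 'I_4) (c : 'I_4 -> k) : \sum_d w d 0 * (c d * (b == d)%:R) = w b 0 * c b.
  rewrite (bigD1 b) //= eqxx mulr1 big1 ?addr0 // => d /negPf db.
  by rewrite eq_sym db !mulr0.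
have -> : \sum_(d < 4) w d 0 * (a * ((i == d)%:R * v j 0 * v l 0
     + v i 0 * (j == d)%:R * v l 0 + v i 0 * v j 0 * (l == d)%:R)) =
  w i 0 * (a * v j 0 * v l 0) + w j 0 * (a * v i 0 * v l 0) + w l 0 * (a * v i 0 * v j 0).
  rewrite -(sE i (fun=> a * v j 0 * v l 0)) -(sE j (fun=> a * v i 0 * v l 0)).
  rewrite -(sE l (fun=> a * v i 0 * v j 0)) -!big_split; apply: eq_bigr => d _ /=; ring.
by rewrite /polar1; ring.
Qed.

Lemma nonsingular_trilinear F C : nonsingular F ->
    (forall v, cubic C v = ev F v) ->
    (forall v w, polar1 C v w = \sum_i w i 0 * ev (F^`M(i)) v) ->
  nonsingular_form C.
Proof.
move=> nsF cC pC v v0; rewrite cC => /(nsF v v0)[i di].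
exists (delta_mx i 0); rewrite pC (bigD1 i) //= mxE !eqxx mul1r big1 ?addr0 // => j ji.
by rewrite mxE (negPf ji) mul0r.
Qed.

Definition octa_form (a : k * k * k * k) (x y z : 'cV[k]_4) : k :=
  let: (a0, a1, a2, a3) := a in
  x (inord 0) 0 * y (inord 1) 0 *
    (z (inord 0) 0 + z (inord 1) 0 + a3 * z (inord 2) 0 + a2 * z (inord 3) 0)
  + x (inord 2) 0 * y (inord 3) 0 *
    (a1 * z (inord 0) 0 + a0 * z (inord 1) 0 + z (inord 2) 0 + z (inord 3) 0).

Lemma octa_form_trilinear a : trilinear (octa_form a).
Proof.
by case: a => [[[a0 a1] a2] a3]; split=> b x x' y z; rewrite /octa_form !mxE; ring.
Qed.

Lemma cubic_octa_form a v : cubic (octa_form a) v = ev (octanomial a) v.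
Proof.
case: a => [[[a0 a1] a2] a3]; rewrite /cubic /octa_form /octanomial.
by rewrite !(mevalD, mevalM, mevalZ, mevalXU).
Qed.

End Polynomials.

(** * Projective transformations *)

Section ScalarClass.
Variables (k : fieldType) (V : lmodType k).
Implicit Types u v : V.

Lemma scalar_classP u v : scalar_class u v <-> exists2 c, c != 0 & v = c *: u.
Proof. by split=> [[c c0 <-]|[c c0 ->]]; exists c. Qed.

Lemma scalar_class_eqP u v :
  scalar_class u = scalar_class v <-> exists2 c, c != 0 & v = c *: u.
Proof.
rewrite -scalar_classP; split=> [->|/scalar_classP[c c0 ->]].
  by apply/scalar_classP; exists 1; rewrite ?oner_neq0 ?scale1r.
apply/seteqP; split=> w /scalar_classP[d d0 ->]; apply/scalar_classP.
  by exists (d / c); rewrite ?mulf_neq0 ?invr_neq0 // scalerA divfK.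
by exists (d * c); rewrite ?mulf_neq0 // scalerA.
Qed.

End ScalarClass.

Section Action.
Variable k : fieldType.
Implicit Types (A B : 'M[k]_4) (v w : 'cV[k]_4).

Lemma pgl_act_class A v :
  pgl_act (scalar_class A) (scalar_class v) = scalar_class (A *m v).
Proof.
apply/seteqP; split=> w.
  move=> [_ [c c0 <-] [_ [d d0 <-] <-]]; apply/scalar_classP; exists (c * d).
    by rewrite mulf_neq0.
  by rewrite -scalemxAl -scalemxAr scalerA.
move=> /scalar_classP[c c0 ->]; exists (c *: A); first by exists c.
by exists v; rewrite -?scalemxAl //; exists 1; rewrite ?scale1r //= oner_neq0.
Qed.

Lemma unitmx_inj A v w : A \in unitmx -> A *m v = A *m w -> v = w.
Proof. by move=> uA /(congr1 (mulmx (invmx A))); rewrite !mulKmx. Qed.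

Lemma unitmx_neq0 A v : A \in unitmx -> v != 0 -> A *m v != 0.
Proof.
by move=> uA; apply: contraNneq => e; apply/eqP/(unitmx_inj uA); rewrite e mulmx0.
Qed.

Definition cubic_surface (C : 'cV[k]_4 -> 'cV[k]_4 -> 'cV[k]_4 -> k) :
    set (set 'cV[k]_4) :=
  [set scalar_class v | v in [set v | v != 0 /\ cubic C v = 0]].

Lemma surface_cubic (F : {mpoly k[4]}) C :
  (forall v, cubic C v = F.@[fun i => v i ord0]) -> surface F = cubic_surface C.
Proof.
move=> cC; rewrite /surface /cubic_surface; congr (_ @` _).
by apply/seteqP; split=> v /=; rewrite cC.
Qed.

Lemma act_cubic_surfaceP A C C' : trilinear C -> trilinear C' -> A \in unitmx ->
  pgl_act (scalar_class A) @` cubic_surface C = cubic_surface C' <->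
  forall v, v != 0 -> (cubic C v = 0 <-> cubic C' (A *m v) = 0).
Proof.
move=> triC triC' uA; split=> [e v v0|H].
  split=> [fv|fAv].
    have : cubic_surface C' (scalar_class (A *m v)).
      by rewrite -e; exists (scalar_class v); [exists v | rewrite pgl_act_class].
    by move=> [w [w0 fw] /scalar_class_eqP[c c0 ->]]; rewrite (cubicZ triC') fw mulr0.
  have : cubic_surface C' (scalar_class (A *m v)).
    by exists (A *m v) => //; split=> //; apply: unitmx_neq0.
  rewrite -e => -[_ [w [w0 fw] <-]]; rewrite pgl_act_class => /scalar_class_eqP[c c0].
  by rewrite scalemxAr => /(unitmx_inj uA) ->; rewrite (cubicZ triC) fw mulr0.
apply/seteqP; split=> x.
  move=> [_ [v [v0 fv] <-] <-]; rewrite pgl_act_class; exists (A *m v) => //.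
  by split; [apply: unitmx_neq0 | apply/(H v v0)].
move=> [w [w0 fw] <-]; have Aw : A *m (invmx A *m w) = w by rewrite mulKVmx.
have v0 : invmx A *m w != 0 by apply: unitmx_neq0; rewrite ?unitmx_inv.
exists (scalar_class (invmx A *m w)); last by rewrite pgl_act_class Aw.
by exists (invmx A *m w) => //; split=> //; apply/(H _ v0); rewrite Aw.
Qed.

End Action.

Lemma has_card_cancel (T U : choiceType) (f : T -> U) (g : U -> T) (A : set T) n :
  cancel f g -> has_card (f @` A) n -> has_card A n.
Proof.
move=> fK c; have inj : {in f @` A &, injective g}.
  move=> _ _ /set_mem[x _ <-] /set_mem[y _ <-]; rewrite !fK => -> //.
apply: has_card_ext (has_card_image inj c) => x; split=> [[_ [y Ay <-] <-]|Ax].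
  by rewrite fK.
by exists (f x); rewrite ?fK //; exists x.
Qed.

(** * Counting parameters against automorphisms *)

Section Torsor.
Variables (k : fieldType) (P : choiceType) (X : set (set 'cV[k]_4)).
Variables (C : 'cV[k]_4 -> 'cV[k]_4 -> 'cV[k]_4 -> k).
Variable (C' : P -> 'cV[k]_4 -> 'cV[k]_4 -> 'cV[k]_4 -> k).
Hypotheses (triC : trilinear C) (triC' : forall a, trilinear (C' a)).
Hypothesis XC : X = cubic_surface C.
Hypothesis C'_inj : forall a b, cubic_surface (C' a) = cubic_surface (C' b) -> a = b.

(** The set that is counted in two ways, by parameters here and by quadrilaterals later. *)
Definition transporter : set (set 'M[k]_4) :=
  [set g | PGL4 g /\ exists a, pgl_act g @` X = cubic_surface (C' a)].

Definition targets : set P :=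
  [set a | projectively_isomorphic X (cubic_surface (C' a))].

(** If A0 carries X onto the surface of a, the other such classes form the coset A0 Aut(X); [f] is
    left multiplication by A0. *)
Lemma transporter_fibre a : targets a -> exists f f' : set 'M[k]_4 -> set 'M[k]_4,
  [/\ cancel f f', injective f & forall g, (f @` surface_Aut X) g <->
     transporter g /\ pgl_act g @` X = cubic_surface (C' a)].
Proof.
move=> [_ [A0 uA0 <-] eA0].
have mK : cancel (fun h : set 'M[k]_4 => mulmx A0 @` h) (fun h => mulmx (invmx A0) @` h).
  move=> h; apply/seteqP; split=> M; first by move=> [_ [N hN <-] <-]; rewrite mulKmx.
  by move=> hM; exists (A0 *m M); rewrite ?mulKmx //; exists M.
exists (fun h => mulmx A0 @` h), (fun h => mulmx (invmx A0) @` h).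
split=> [//||g]; first exact: can_inj mK.
have mulcl H : mulmx A0 @` scalar_class H = scalar_class (A0 *m H).
  apply/seteqP; split=> M.
    by move=> [_ [c c0 <-] <-]; exists c => //; rewrite scalemxAr.
  by move=> [c c0 <-]; exists (c *: H); [exists c|rewrite scalemxAr].
move: eA0; rewrite XC => /(act_cubic_surfaceP triC (triC' a) uA0) H0; split.
  move=> [_ [[H uH <-] eH] <-]; rewrite mulcl.
  have uAH : A0 *m H \in unitmx by rewrite unitmx_mul uA0.
  have e : pgl_act (scalar_class (A0 *m H)) @` cubic_surface C = cubic_surface (C' a).
    apply/(act_cubic_surfaceP triC (triC' a) uAH) => v v0; rewrite -mulmxA.
    rewrite -(H0 _ (unitmx_neq0 uH v0)).
    by move: v v0; apply/(act_cubic_surfaceP triC triC uH).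
  by split=> //; split; [exists (A0 *m H)|exists a; rewrite XC].
move=> [[[A uA <-] _]] /(act_cubic_surfaceP triC (triC' a) uA) HA.
have uH : invmx A0 *m A \in unitmx by rewrite unitmx_mul unitmx_inv uA0.
exists (scalar_class (invmx A0 *m A)); last by rewrite mulcl mulKVmx.
split; first by exists (invmx A0 *m A).
apply/(act_cubic_surfaceP triC triC uH) => v v0.
by rewrite (HA v v0) (H0 _ (unitmx_neq0 uH v0)) mulmxA mulKVmx.
Qed.

(** The hypothesis N > 0 gives a nonempty fibre, a finite set in bijection with Aut(X); finiteness
    of Aut(X) follows from that of the transporter. *)
Lemma has_card_torsor N : has_card transporter N -> (0 < N)%N ->
  exists n m, [/\ has_card targets n, has_card (surface_Aut X) m & N = (n * m)%N].
Proof.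
move=> cS N0.
have [[|g0 s] [_ sN sP]] := cS; first by rewrite -sN in N0.
have [g0P [a0 e0]] : transporter g0 by apply/sP; rewrite inE eqxx.
have ta0 : targets a0 by exists g0.
have [m cm] : exists m, has_card (surface_Aut X) m.
  have [f [f' [fK _ fE]]] := transporter_fibre ta0.
  have [m cm] := has_card_sub (B := f @` surface_Aut X) (fun g h => ((fE g).1 h).1) cS.
  by exists m; apply: has_card_cancel fK cm.
have /choice[F FP] : forall g, exists a, transporter g -> pgl_act g @` X = cubic_surface (C' a).
  move=> g; have [[_ [a ea]]|ng] := pselect (transporter g); first by exists a.
  by exists a0.
have FE : forall a, targets a <-> (F @` transporter) a.
  move=> a; split=> [[g Pg eg]|[g Sg <-]].
    have Sg : transporter g by split=> //; exists a.
    by exists g => //; apply: C'_inj; rewrite -FP.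
  by have [Pg _] := Sg; exists g => //; apply: FP.
have [n cn] := has_card_onto F cS.
have cn' : has_card targets n by apply: has_card_ext cn => a; rewrite FE.
exists n, m; split=> //; apply: has_card_unique cS _.
apply: (has_card_fib (f := F) _ cn') => [g Sg|a ta]; first by apply/FE; exists g.
have [f [f' [_ fI fE]]] := transporter_fibre ta.
apply: has_card_ext (has_card_image (f := f) (in2W fI) cm) => g.
rewrite fE; split=> -[Sg]; last by move=> <-; split=> //; apply: FP.
by move=> e; split=> //; apply: C'_inj; rewrite -FP.
Qed.

End Torsor.

(** * Octanomial frames *)

Section Frames.
Variable k : closedFieldType.
Local Notation i0 := (inord 0 : 'I_4).
Local Notation i1 := (inord 1 : 'I_4).
Local Notation i2 := (inord 2 : 'I_4).
Local Notation i3 := (inord 3 : 'I_4).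
Local Notation e i := (delta_mx i 0 : 'cV[k]_4).
Implicit Types (A B : 'M[k]_4).

Lemma inord4_eq (i j : nat) : (i < 4)%N -> (j < 4)%N ->
  ((inord i : 'I_4) == inord j) = (i == j).
Proof. by move=> hi hj; rewrite -val_eqE /= !inordK. Qed.

Lemma sum4 (M : nmodType) (F : 'I_4 -> M) :
  \sum_i F i = F i0 + F i1 + F i2 + F i3.
Proof.
rewrite !big_ord_recl big_ord0 addr0 !addrA.
congr (F _ + F _ + F _ + F _); apply: val_inj; rewrite /= inordK //.
Qed.

Lemma mulmx_cols B (x : 'cV[k]_4) : B *m x =
  x i0 0 *: col i0 B + x i1 0 *: col i1 B + x i2 0 *: col i2 B + x i3 0 *: col i3 B.
Proof.
apply/matrixP => i j; rewrite (ord1 j) mxE sum4 !mxE.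
by rewrite !(mulrC (B i _)).
Qed.

Lemma octa_polar1 (a : k * k * k * k) :
  [/\ polar1 (octa_form a) (e i0) (e i1) = 1, polar1 (octa_form a) (e i1) (e i0) = 1,
      polar1 (octa_form a) (e i2) (e i3) = 1 & polar1 (octa_form a) (e i3) (e i2) = 1].
Proof.
case: a => [[[a0 a1] a2] a3]; rewrite /polar1 /octa_form.
by split; rewrite !mxE !inord4_eq //=; ring.
Qed.

Lemma octa_polar1_0 (a : k * k * k * k) i j : (i < 4)%N -> (j < 4)%N -> (i < 2)%N != (j < 2)%N ->
  polar1 (octa_form a) (e (inord i)) (e (inord j)) = 0.
Proof.
case: a => [[[a0 a1] a2] a3] hi hj; rewrite /polar1 /octa_form !mxE !inord4_eq //.
by move: i j hi hj => [|[|[|[|i]]]] // [|[|[|[|j]]]] //= _ _ _; ring.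
Qed.

Lemma octa_cubic_0 (a : k * k * k * k) i : (i < 4)%N -> cubic (octa_form a) (e (inord i)) = 0.
Proof.
case: a => [[[a0 a1] a2] a3] hi; rewrite /cubic /octa_form !mxE !inord4_eq //.
by move: i hi => [|[|[|[|i]]]] //= _; ring.
Qed.

Lemma octa_polar2 (a0 a1 a2 a3 : k) (a := (a0, a1, a2, a3)) :
  [/\ polar2 (octa_form a) (e i0) (e i1) (e i2) = a3,
      polar2 (octa_form a) (e i0) (e i1) (e i3) = a2,
      polar2 (octa_form a) (e i0) (e i2) (e i3) = a1 &
      polar2 (octa_form a) (e i1) (e i2) (e i3) = a0].
Proof.
by rewrite /polar2 /octa_form; split; rewrite !mxE !inord4_eq //=; ring.
Qed.

Lemma octa_determined a (C : 'cV[k]_4 -> 'cV[k]_4 -> 'cV[k]_4 -> k) : trilinear C ->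
    (forall x, cubic (octa_form a) x = 0 -> cubic C x = 0) ->
  exists c, forall x, cubic C x = c * cubic (octa_form a) x.
Proof.
move=> triC; have [D01 D10 _ _] := octa_polar1 a.
apply: (cubic_determined (u := e i0) (v := e i1)) => //.
- exact: octa_form_trilinear.
- exact: octa_cubic_0.
- exact: octa_cubic_0.
- by rewrite D01 oner_neq0.
- by rewrite D10 oner_neq0.
Qed.

Lemma trilinear_scale (V : lmodType k) c (C : V -> V -> V -> k) :
  trilinear C -> trilinear (fun x y z => c * C x y z).
Proof.
move=> triC; split=> a u u' v w.
- by rewrite (trilinear1 triC); ring.
- by rewrite (trilinear2 triC); ring.
- by rewrite (trilinear3 triC); ring.
Qed.

Lemma polar1_scale (V : lmodType k) c (C : V -> V -> V -> k) u v :
  polar1 (fun x y z => c * C x y z) u v = c * polar1 C u v.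
Proof. by rewrite /polar1; ring. Qed.

Lemma polar2_scale (V : lmodType k) c (C : V -> V -> V -> k) u v w :
  polar2 (fun x y z => c * C x y z) u v w = c * polar2 C u v w.
Proof. by rewrite /polar2; ring. Qed.

(** The two forms are proportional, the common value D(e0, e1) = 1 makes the factor 1, and the
    parameters are then read off as values of [polar2]. *)
Lemma octa_surface_inj (a b : k * k * k * k) :
  cubic_surface (octa_form a) = cubic_surface (octa_form b) -> a = b.
Proof.
move=> eab; have [ta tb] := (octa_form_trilinear a, octa_form_trilinear b).
have id1 : pgl_act (scalar_class 1%:M) @` cubic_surface (octa_form a) = cubic_surface (octa_form b).
  rewrite -eab; apply/seteqP; split=> x.
    by move=> [_ [v hv <-] <-]; rewrite pgl_act_class mul1mx; exists v.
  by move=> [v hv <-]; exists (scalar_class v); [exists v|rewrite pgl_act_class mul1mx].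
move/(act_cubic_surfaceP ta tb (unitmx1 _ _)): id1 => H.
have [|c cE] := @octa_determined b (octa_form a) ta.
  move=> x; have [->|x0] := eqVneq x 0; first by rewrite (cubic0 ta).
  by move=> fx; apply/(H x x0); rewrite mul1mx.
have tc := trilinear_scale c tb.
have c1 : c = 1.
  have := eq_cubic_polar1 ta tc cE (e i0) (e i1).
  by rewrite polar1_scale; have [-> _ _ _] := octa_polar1 a;
    have [-> _ _ _] := octa_polar1 b; rewrite mulr1.
have P2 := eq_cubic_polar2 ta tc cE.
case: a b P2 {ta tb eab H cE tc} => [[[a0 a1] a2] a3] [[[b0 b1] b2] b3] P2.
have [A3 A2 A1 A0] := octa_polar2 a0 a1 a2 a3.
have [B3 B2 B1 B0] := octa_polar2 b0 b1 b2 b3.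
have := P2 (e i0) (e i1) (e i2); rewrite polar2_scale A3 B3 c1 mul1r => ->.
have := P2 (e i0) (e i1) (e i3); rewrite polar2_scale A2 B2 c1 mul1r => ->.
have := P2 (e i0) (e i2) (e i3); rewrite polar2_scale A1 B1 c1 mul1r => ->.
by have := P2 (e i1) (e i2) (e i3); rewrite polar2_scale A0 B0 c1 mul1r => ->.
Qed.

Section Frame.
Variable C : 'cV[k]_4 -> 'cV[k]_4 -> 'cV[k]_4 -> k.
Hypothesis triC : trilinear C.
Hypothesis nsC : nonsingular_form C.
Local Notation D := (polar1 C).
Local Notation T := (polar2 C).
Local Notation f := (cubic C).

Definition octa_frame (b0 b1 b2 b3 : 'cV[k]_4) :=
  [/\ [/\ f b0 = 0, f b1 = 0, f b2 = 0 & f b3 = 0],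
      [/\ D b0 b2 = 0, D b2 b0 = 0, D b1 b3 = 0 & D b3 b1 = 0],
      [/\ D b1 b2 = 0, D b2 b1 = 0, D b0 b3 = 0 & D b3 b0 = 0] &
      [/\ D b0 b1 != 0, D b1 b0 = D b0 b1, D b2 b3 = D b0 b1 & D b3 b2 = D b0 b1]].

Definition pullback B (x y z : 'cV[k]_4) := C (B *m x) (B *m y) (B *m z).

Lemma pullback_trilinear B : trilinear (pullback B).
Proof.
split=> a u u' v w; rewrite /pullback mulmxDr -scalemxAr.
- exact: (trilinear1 triC).
- exact: (trilinear2 triC).
- exact: (trilinear3 triC).
Qed.

(** The columns of B are the points that invmx B sends to the coordinate points, so the conditions
    on a frame are the missing or equal coefficients of an octanomial, up to a common factor. *)
Lemma octa_frameP B : B \in unitmx ->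
  (exists a, pgl_act (scalar_class (invmx B)) @` cubic_surface C = cubic_surface (octa_form a))
  <-> octa_frame (col i0 B) (col i1 B) (col i2 B) (col i3 B).
Proof.
move=> uB; have uA : invmx B \in unitmx by rewrite unitmx_inv.
have tB := pullback_trilinear B; split.
  move=> [a /(act_cubic_surfaceP triC (octa_form_trilinear a) uA) H].
  have [|c cE] := @octa_determined a _ tB.
    move=> x; have [->|x0] := eqVneq x 0; first by rewrite (cubic0 tB).
    by move=> ox; apply/(H _ (unitmx_neq0 uB x0)); rewrite mulKmx.
  have tc := trilinear_scale c (octa_form_trilinear a).
  have DE i j : D (col i B) (col j B) = c * polar1 (octa_form a) (e i) (e j).
    have := eq_cubic_polar1 tB tc cE (e i) (e j).
    by rewrite polar1_scale /polar1 /pullback -!colE.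
  have fE i : (i < 4)%N -> f (col (inord i) B) = 0.
    by move=> i4; rewrite colE; have := cE (e (inord i)); rewrite octa_cubic_0 // mulr0.
  (* Otherwise the form would vanish identically and every point would be singular. *)
  have c0 : c != 0.
    apply/eqP => c0; have f0 : on_cubic C fullv.
      move=> x _; have := cE (invmx B *m x).
      by rewrite /cubic /pullback mulKVmx // c0 mul0r.
    have e0 : e i0 != 0.
      by apply/eqP => /matrixP/(_ i0 0)/eqP; rewrite !mxE !eqxx oner_eq0.
    have [w /eqP[]] := nsC e0 (f0 _ (memvf _)).
    exact: (polar1_on_cubic triC f0 (memvf _) (memvf _)).
  have [D01 D10 D23 D32] := octa_polar1 a.
  split; split; rewrite ?fE ?DE ?D01 ?D10 ?D23 ?D32 ?mulr1 //;
    by rewrite octa_polar1_0 // mulr0.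
set b0 := col i0 B; set b1 := col i1 B; set b2 := col i2 B; set b3 := col i3 B.
move=> [[f0 f1 f2 f3] [D02 D20 D13 D31] [D12 D21 D03 D30] [l0 D10 D23 D32]].
pose l := D b0 b1.
(* The four mixed coefficients, normalized by the common value l, in the order given by
   [octa_polar2]. *)
pose a := (T b1 b2 b3 / l, T b0 b2 b3 / l, T b0 b1 b3 / l, T b0 b1 b2 / l).
have fE x : f (B *m x) = l * cubic (octa_form a) x.
  rewrite mulmx_cols -/b0 -/b1 -/b2 -/b3 !(cubicD triC, cubicZ triC).
  rewrite !(polar1Dl triC, polar1Zl triC, polar1Dr triC, polar1Zr triC).
  rewrite !(polar2Dl triC, polar2Zl triC, polar2Dm triC, polar2Zm triC, polar2Zr triC).
  rewrite f0 f1 f2 f3 D02 D20 D13 D31 D12 D21 D03 D30 D10 D23 D32 -/l.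
  by rewrite /cubic /octa_form /a; field.
exists a; apply/(act_cubic_surfaceP triC (octa_form_trilinear a) uA) => v v0.
rewrite -{1}[v](mulKVmx uB) fE; split=> [/eqP|->]; last by rewrite mulr0.
by rewrite mulf_eq0 (negPf l0) => /eqP.
Qed.

End Frame.
End Frames.

Lemma line_scale (k : fieldType) (V : vectType k) (c : k) (v : V) :
  c != 0 -> (<[c *: v]> = <[v]>)%VS.
Proof.
move=> c0; apply/eqP; rewrite eqEsubv -!memvE memvZ ?memv_line //=.
by rewrite -{1}[v]scale1r -(mulVf c0) -scalerA memvZ ?memv_line.
Qed.

Section CubeRoots.
Variable k : closedFieldType.

Lemma has_card_cube_roots (kap : k) : kap != 0 ->
  has_card (fun t : k => t ^+ 3 = kap) (if 3%N \in [pchar k] then 1 else 3).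
Proof.
move=> kap0; have hX (t : k) : ('X^3 - kap%:P).[t] = t ^+ 3 - kap by rewrite !hornerE.
have sX : size ('X^3 - kap%:P : {poly k}) = 4%N by rewrite size_XnsubC.
case: ifPn => [|c3].
  rewrite inE => /andP[_ /eqP c3].
  have [|r] := @root_of_size _ ('X^3 - kap%:P); first by rewrite sX.
  rewrite hX => /subr0_eq rE; apply: has_card_ext (has_card1 r) => t.
  split=> [->//|tE]; have : (t - r) ^+ 3 == 0.
    have -> : (t - r) ^+ 3 = t ^+ 3 - r ^+ 3 - 3%:R * (t ^+ 2 * r - t * r ^+ 2) by ring.
    by rewrite tE rE c3 subrr mul0r subr0.
  by rewrite expf_eq0 /= subr_eq0 => /eqP.
have c30 : (3%:R : k) != 0 by apply: contra c3 => h; rewrite inE h.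
apply: has_card_ext (has_card_simple_roots sX _) => t.
  by rewrite hX; split=> [/subr0_eq|->]; rewrite ?subrr.
rewrite hX => /subr0_eq tE; rewrite derivB derivC subr0 derivXn hornerMn hornerXn.
rewrite -mulr_natl mulf_neq0 // expf_neq0 //.
by apply: contraNneq kap0 => t0; rewrite -tE t0 expr0n.
Qed.

End CubeRoots.

(** * Quadrilaterals of lines and their vertices *)

Section Quadrilateral.
Variables (k : closedFieldType) (V : vectType k) (C : V -> V -> V -> k).
Hypothesis triC : trilinear C.
Hypothesis dimV : \dim {:V} = 4%N.
Hypothesis nsC : nonsingular_form C.
Local Notation f := (cubic C).
Local Notation D := (polar1 C).
Local Notation line := (is_line C).
Implicit Types (a b t n : {vspace V}) (p x y : V).

Definition free4 p0 p1 p2 p3 := forall x0 x1 x2 x3 : k,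
  x0 *: p0 + x1 *: p1 + x2 *: p2 + x3 *: p3 = 0 -> [/\ x0 = 0, x1 = 0, x2 = 0 & x3 = 0].

Lemma free4_swap p0 p1 p2 p3 : free4 p0 p1 p2 p3 -> free4 p1 p0 p3 p2.
Proof.
move=> F x1 x0 x3 x2; rewrite (addrC (x1 *: _)) -addrA (addrC (x3 *: _)) addrA.
by case/F.
Qed.

Lemma free4_rev p0 p1 p2 p3 : free4 p0 p1 p2 p3 -> free4 p2 p3 p0 p1.
Proof.
move=> F x2 x3 x0 x1; rewrite -addrA addrC addrA.
by case/F.
Qed.

Lemma free4_pair02 p0 p1 p2 p3 : free4 p0 p1 p2 p3 -> \dim (<[p0]> + <[p2]>) = 2%N.
Proof.
move=> F; rewrite dim_pair; have -> : p0 != 0.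
  apply/eqP => z; have [|/eqP] := F 1 0 0 0; last by rewrite oner_eq0.
  by rewrite z scaler0 !scale0r !addr0.
suff -> : p2 \notin <[p0]>%VS by [].
apply/negP => /vlineP[c z]; have [|_ _ /eqP] := F (- c) 0 1 0; last by rewrite oner_eq0.
by rewrite z scale1r !scale0r !addr0 scaleNr addNr.
Qed.

Lemma free4_pair03 p0 p1 p2 p3 : free4 p0 p1 p2 p3 -> \dim (<[p0]> + <[p3]>) = 2%N.
Proof.
move=> F; apply: (free4_pair02 (p1 := p1) (p3 := p2)) => x0 x1 x2 x3.
by rewrite -addrA (addrC (x2 *: _)) addrA => /F[].
Qed.

Lemma free4_cap p0 p1 p2 p3 : free4 p0 p1 p2 p3 ->
  ((<[p0]> + <[p2]>) :&: (<[p1]> + <[p3]>) == 0)%VS.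
Proof.
move=> F; apply/eqP/vspaceP => x; rewrite memv0; apply/idP/eqP => [|->]; last exact: mem0v.
rewrite memv_cap => /andP[/mem_pairP[a [b xE]] /mem_pairP[c [d xE']]].
have [|a0 _ b0 _] := F a (- c) b (- d); last by rewrite xE a0 b0 !scale0r addr0.
by rewrite !scaleNr (addrAC (a *: p0)) -xE -addrA -opprD -xE' subrr.
Qed.

Lemma free4_not_in p0 p1 p2 p3 : free4 p0 p1 p2 p3 -> p0 \notin (<[p1]> + <[p2]>)%VS.
Proof.
move=> F; apply/negP => /mem_pairP[c [d z]].
have [|/eqP] := F 1 (- c) (- d) 0; last by rewrite oner_eq0.
by rewrite scale1r !scaleNr scale0r addr0 -addrA -opprD -z subrr.
Qed.

Definition frame_lines p0 p1 p2 p3 : ({vspace V} * {vspace V}) * ({vspace V} * {vspace V}) :=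
  ((<[p0]> + <[p2]>, <[p1]> + <[p3]>), (<[p1]> + <[p2]>, <[p0]> + <[p3]>))%VS.

Lemma free4_neq0 p0 p1 p2 p3 : free4 p0 p1 p2 p3 -> p0 != 0.
Proof.
move=> F; apply/eqP => z; have [|/eqP] := F 1 0 0 0; last by rewrite oner_eq0.
by rewrite z scaler0 !scale0r !addr0.
Qed.

Lemma frame_quadrilateral p0 p1 p2 p3 : free4 p0 p1 p2 p3 ->
    f p0 = 0 -> f p1 = 0 -> f p2 = 0 -> f p3 = 0 ->
    D p0 p2 = 0 -> D p2 p0 = 0 -> D p1 p3 = 0 -> D p3 p1 = 0 ->
    D p1 p2 = 0 -> D p2 p1 = 0 -> D p0 p3 = 0 -> D p3 p0 = 0 ->
  quadrilateral C (frame_lines p0 p1 p2 p3).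
Proof.
move=> F f0 f1 f2 f3 D02 D20 D13 D31 D12 D21 D03 D30.
have F' := free4_swap F; have F'' := free4_rev F; have F''' := free4_rev F'.
have [q0 q1 q2 q3] := And4 (free4_neq0 F) (free4_neq0 F') (free4_neq0 F'') (free4_neq0 F''').
have l02 : line (<[p0]> + <[p2]>)%VS by split; [exact: free4_pair02 F|exact: on_cubic_pair].
have l13 : line (<[p1]> + <[p3]>)%VS by split; [exact: free4_pair02 F'|exact: on_cubic_pair].
have l12 : line (<[p1]> + <[p2]>)%VS by split; [exact: free4_pair03 F'|exact: on_cubic_pair].
have l03 : line (<[p0]> + <[p3]>)%VS by split; [exact: free4_pair03 F|exact: on_cubic_pair].
split=> //; first exact: free4_cap F.
split.
- split=> //; apply/cap_neq0P; first by exists p2; rewrite // !in_pair_r.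
  by exists p1; rewrite // !in_pair_l.
- split=> //; apply/cap_neq0P; first by exists p0; rewrite // !in_pair_l.
  by exists p3; rewrite // !in_pair_r.
by move=> e; have := free4_not_in F; rewrite -e in_pair_l.
Qed.

Lemma transversal_neq a b t : transversal C a b t -> (a :&: b == 0)%VS -> t <> a.
Proof. by move=> [_ _ bt] ab e; rewrite e capvC ab in bt. Qed.

(* If the transversals t and t' met on a, then a, t, t' would span a plane, which
   b meets in a single point. *)
Lemma quadrilateral_vertices a b t t' p0 p1 p2 p3 :
    line a -> line b -> (a :&: b == 0)%VS -> transversal C a b t -> transversal C a b t' ->
    t' <> t -> p0 != 0 -> p1 != 0 -> p2 != 0 -> p3 != 0 ->
    p0 \in a -> p0 \in t' -> p2 \in a -> p2 \in t -> p1 \in b -> p1 \in t ->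
    p3 \in b -> p3 \in t' -> p2 \notin <[p0]>%VS.
Proof.
move=> la lb ab tt tt' tn q0 q1 q2 q3 p0a p0t' p2a p2t p1b p1t p3b p3t'.
have ta := transversal_neq tt ab; have [lt _ _] := tt; have [lt' _ _] := tt'.
apply/negP => /vlineP[c p2E]; have c0 : c != 0.
  by apply: contraNneq q2 => c0; rewrite p2E c0 scale0r.
have p0t : p0 \in t by rewrite -[p0]scale1r -(mulVf c0) -scalerA -p2E memvZ.
have at_ : a <> t by move=> e; apply: ta.
have t'W := concurrent_sub triC dimV nsC la lt lt' at_ q0 p0a p0t p0t'.
have dW : \dim (a + t) = 3%N.
  by apply: (line_dim3 triC dimV nsC) => //; apply/cap_neq0P; exists p0; rewrite ?p0a.
have bW : ~~ (b <= a + t)%VS.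
  apply: contraL ab => bW; apply: (cap_neq0_dim (addvSl a t) bW).
  by rewrite dW; have [-> _] := la; have [-> _] := lb.
have [x x0 [xb xW xP]] := line_plane_cap dimV lb dW bW.
have /vlineP[d1 d1E] := xP _ p1b (subvP (addvSr a t) _ p1t).
have /vlineP[d3 d3E] := xP _ p3b (subvP t'W _ p3t').
have d10 : d1 != 0 by apply: contraNneq q1 => z; rewrite d1E z scale0r.
have p3t : p3 \in t by rewrite d3E -[d3](mulfVK d10) -scalerA -d1E memvZ.
apply: tn; have [dt' _] := lt'; have [dt _] := lt.
have dpp : \dim (<[p0]> + <[p3]>) = 2%N.
  rewrite dim_pair q0 (_ : p3 \notin _) //; apply/negP => /vlineP[g gE].
  by move/eqP/vspaceP/(_ p3): ab; rewrite memv_cap memv0 (negPf q3) p3b andbT gE memvZ.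
have et : (<[p0]> + <[p3]>)%VS = t by apply: eq_dim_subv; rewrite ?dpp ?dt // subv_add -!memvE p0t.
by rewrite -et; apply/esym/eq_dim_subv; rewrite ?dpp ?dt' // subv_add -!memvE p0t'.
Qed.

(** The vertices are p0 on a and t', p2 on a and t, p1 on b and t, p3 on b and t'. Since a and b are
    skew, independence reduces to that of the two vertices on each of them. *)
Lemma quadrilateral_frame q : quadrilateral C q -> exists p0 p1 p2 p3,
  free4 p0 p1 p2 p3 /\ q = frame_lines p0 p1 p2 p3.
Proof.
case: q => [[a b] [t t']] [la lb ab [tt tt' tn]].
have [[lt at0 bt0] [lt' at'0 bt'0]] := (tt, tt').
have /cap_neq0P[p0 q0 /andP[p0a p0t']] := at'0.
have /cap_neq0P[p2 q2 /andP[p2a p2t]] := at0.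
have /cap_neq0P[p1 q1 /andP[p1b p1t]] := bt0.
have /cap_neq0P[p3 q3 /andP[p3b p3t']] := bt'0.
have p20 := quadrilateral_vertices la lb ab tt tt' tn q0 q1 q2 q3 p0a p0t' p2a p2t p1b p1t p3b p3t'.
have sw s : transversal C a b s -> transversal C b a s by case.
have ba : (b :&: a == 0)%VS by rewrite capvC.
have p31 : p3 \notin <[p1]>%VS.
  by apply: (quadrilateral_vertices lb la ba (sw _ tt') (sw _ tt) _ q1 q0 q3 q2) => // /esym.
have pair n x y : \dim n = 2%N -> x != 0 -> y \notin <[x]>%VS -> x \in n -> y \in n ->
    n = (<[x]> + <[y]>)%VS.
  move=> dn x0 yx xn yn; apply/esym/eq_dim_subv; first by rewrite dim_pair x0 yx dn.
  by rewrite subv_add -!memvE xn.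
have [[[da _] [db _]] [[dt _] [dt' _]]] := (la, lb, (lt, lt')).
have nin x y : x \in a -> y \in b -> y != 0 -> y \notin <[x]>%VS.
  move=> xa yb y0; apply/negP => /vlineP[c yE].
  by move/eqP/vspaceP/(_ y): ab; rewrite memv_cap memv0 (negPf y0) yb andbT yE memvZ.
have nin' x y : x \in b -> y \in a -> y != 0 -> y \notin <[x]>%VS.
  move=> xa yb y0; apply/negP => /vlineP[c yE].
  by move/eqP/vspaceP/(_ y): ba; rewrite memv_cap memv0 (negPf y0) yb andbT yE memvZ.
exists p0, p1, p2, p3; split; last first.
  by rewrite /frame_lines; congr ((_, _), (_, _)); apply: pair => //; [exact: nin'|exact: nin].
move=> x0 x1 x2 x3 e.
have aE : x0 *: p0 + x2 *: p2 = - (x1 *: p1 + x3 *: p3).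
  by apply/eqP; rewrite -addr_eq0 addrACA addrA e.
have a0 : x0 *: p0 + x2 *: p2 = 0.
  apply/eqP; rewrite -memv0 -(eqP ab) memv_cap memvD ?memvZ //= aE memvN.
  by rewrite memvD ?memvZ.
have b0 : x1 *: p1 + x3 *: p3 = 0 by apply: oppr_inj; rewrite -aE a0 oppr0.
have d02 : \dim (<[p0]> + <[p2]>) = 2%N by rewrite dim_pair q0 p20.
have d13 : \dim (<[p1]> + <[p3]>) = 2%N by rewrite dim_pair q1 p31.
have [h|] := boolP ((x0 != 0) || (x2 != 0)).
  by have := pair_neq0 d02 h; rewrite a0 eqxx.
rewrite negb_or !negbK => /andP[/eqP -> /eqP ->].
have [h|] := boolP ((x1 != 0) || (x3 != 0)).
  by have := pair_neq0 d13 h; rewrite b0 eqxx.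
by rewrite negb_or !negbK => /andP[/eqP -> /eqP ->].
Qed.

(** Each vertex is the intersection of two sides, so the sides determine it up to a scalar. *)
Lemma frame_lines_unique p0 p1 p2 p3 c0 c1 c2 c3 : free4 p0 p1 p2 p3 ->
    frame_lines c0 c1 c2 c3 = frame_lines p0 p1 p2 p3 ->
  exists s0 s1 s2 s3 : k,
    [/\ c0 = s0 *: p0, c1 = s1 *: p1, c2 = s2 *: p2 & c3 = s3 *: p3].
Proof.
have key q0 q1 q2 q3 x : free4 q0 q1 q2 q3 -> x \in (<[q0]> + <[q2]>)%VS ->
    x \in (<[q0]> + <[q3]>)%VS -> exists s : k, x = s *: q0.
  move=> F /mem_pairP[a [b xE]] /mem_pairP[c [d xE']]; exists a.
  have [|_ _ b0 _] := F (a - c) 0 b (- d); last by rewrite xE b0 scale0r addr0.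
  rewrite scale0r addr0 scalerBl scaleNr.
  by rewrite (addrAC (a *: q0)) -xE -addrA -opprD -xE' subrr.
move=> F E.
have E02 : (<[c0]> + <[c2]> = <[p0]> + <[p2]>)%VS by have := congr1 (fun q => q.1.1) E.
have E13 : (<[c1]> + <[c3]> = <[p1]> + <[p3]>)%VS by have := congr1 (fun q => q.1.2) E.
have E12 : (<[c1]> + <[c2]> = <[p1]> + <[p2]>)%VS by have := congr1 (fun q => q.2.1) E.
have E03 : (<[c0]> + <[c3]> = <[p0]> + <[p3]>)%VS by have := congr1 (fun q => q.2.2) E.
have F' := free4_swap F.
have F'' := free4_rev F; have F''' := free4_rev F'.
have [s0 S0] : exists s : k, c0 = s *: p0.
  by apply: (key _ _ _ _ _ F); rewrite -?E02 -?E03 in_pair_l.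
have [s1 S1] : exists s : k, c1 = s *: p1.
  by apply: (key _ _ _ _ _ F'); rewrite -?E13 -?E12 in_pair_l.
have [s2 S2] : exists s : k, c2 = s *: p2.
  by apply: (key _ _ _ _ _ F''); rewrite addvC -?E02 -?E12 in_pair_r.
have [s3 S3] : exists s : k, c3 = s *: p3.
  by apply: (key _ _ _ _ _ F'''); rewrite addvC -?E13 -?E03 in_pair_r.
by exists s0, s1, s2, s3.
Qed.

Lemma frame_span p0 p1 p2 p3 x : free4 p0 p1 p2 p3 -> exists x0 x1 x2 x3 : k,
  x = x0 *: p0 + x1 *: p1 + x2 *: p2 + x3 *: p3.
Proof.
move=> F; have [d02 d13] := (free4_pair02 F, free4_pair02 (free4_swap F)).
have : x \in ((<[p0]> + <[p2]>) + (<[p1]> + <[p3]>))%VS.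
  suff -> : ((<[p0]> + <[p2]>) + (<[p1]> + <[p3]>))%VS = fullv by rewrite memvf.
  by apply: eq_dim_subv (subvf _); rewrite dimv_disjoint_sum ?d02 ?d13 ?dimV //; apply/eqP/free4_cap.
case/memv_addP => _ /mem_pairP[a [b ->]] [_ /mem_pairP[c [d ->]] ->].
by exists a, c, b, d; rewrite addrACA addrA.
Qed.

(** D(p0, -) vanishes at p2, at p3, and at p0, where it is 3 f(p0); nonsingularity leaves only
    p1. *)
Lemma frame_polar_neq0 p0 p1 p2 p3 : free4 p0 p1 p2 p3 ->
  f p0 = 0 -> D p0 p2 = 0 -> D p0 p3 = 0 -> D p0 p1 != 0.
Proof.
move=> F f0 D02 D03; have [x] := nsC (free4_neq0 F) f0; apply: contra => /eqP D01.
have [x0 [x1 [x2 [x3 ->]]]] := frame_span x F.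
by rewrite !(polarE triC) f0 D02 D03 D01 !mulr0 !addr0.
Qed.

End Quadrilateral.

(** * Frames on a given quadrilateral *)

Section Count.
Variables (k : closedFieldType) (C : 'cV[k]_4 -> 'cV[k]_4 -> 'cV[k]_4 -> k).
Hypothesis triC : trilinear C.
Hypothesis nsC : nonsingular_form C.
Local Notation f := (cubic C).
Local Notation D := (polar1 C).
Local Notation i0 := (inord 0 : 'I_4).
Local Notation i1 := (inord 1 : 'I_4).
Local Notation i2 := (inord 2 : 'I_4).
Local Notation i3 := (inord 3 : 'I_4).
Implicit Types (A B : 'M[k]_4) (p : 'cV[k]_4).

Let dimV : \dim {:'cV[k]_4} = 4%N.
Proof. by rewrite dimvf /dim /= muln1. Qed.

Lemma free4_cols B :
  B \in unitmx <-> free4 (col i0 B) (col i1 B) (col i2 B) (col i3 B).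
Proof.
split=> [uB x0 x1 x2 x3 e|F].
  pose x : 'cV[k]_4 := \col_i [:: x0; x1; x2; x3]`_i.
  have xE n : (n < 4)%N -> x (inord n) 0 = [:: x0; x1; x2; x3]`_n.
    by move=> n4; rewrite mxE inordK.
  have x_0 : x = 0.
    by apply: (unitmx_inj uB); rewrite mulmx0 mulmx_cols !xE.
  by split; [have := xE 0%N isT|have := xE 1%N isT|have := xE 2%N isT|have := xE 3%N isT];
    rewrite x_0 mxE /= => <-.
rewrite -unitmx_tr -row_free_unit; apply: inj_row_free => v vB.
have : B *m v^T = 0 by rewrite -[B]trmxK -trmx_mul vB trmx0.
rewrite mulmx_cols => /F[v0 v1 v2 v3]; apply/matrixP => i j; rewrite (ord1 i) mxE.
have -> : v 0 j = v^T j 0 by rewrite mxE.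
by rewrite -[j]inord_val; case: j => -[|[|[|[|j]]]] //= _.
Qed.

Definition colmx (p0 p1 p2 p3 : 'cV[k]_4) : 'M[k]_4 :=
  \matrix_(i, j) ([:: p0; p1; p2; p3]`_j) i 0.

Lemma col_colmx p0 p1 p2 p3 n : (n < 4)%N ->
  col (inord n) (colmx p0 p1 p2 p3) = [:: p0; p1; p2; p3]`_n.
Proof. by move=> n4; apply/matrixP => i j; rewrite !mxE inordK // (ord1 j). Qed.

Definition cols_lines B := frame_lines (col i0 B) (col i1 B) (col i2 B) (col i3 B).

Lemma scalar_class_invmx B B' : B \in unitmx -> B' \in unitmx ->
  scalar_class (invmx B) = scalar_class (invmx B') ->
  exists2 c, c != 0 & B = c *: B'.
Proof.
move=> uB uB' /scalar_class_eqP[c c0 e]; exists c => //.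
have := congr1 (fun M => B *m M *m B') e.
by rewrite mulmxKV // -scalemxAr mulmxV // -scalemxAl mul1mx.
Qed.

Lemma scalar_class_invmxZ B c : B \in unitmx -> c != 0 ->
  scalar_class (invmx (c *: B)) = scalar_class (invmx B).
Proof.
move=> uB c0; apply/scalar_class_eqP; exists c => //.
by rewrite invmxZ ?unitmxZ ?unitfE // scalerA divff ?scale1r.
Qed.

Lemma cols_linesZ B c : c != 0 -> cols_lines (c *: B) = cols_lines B.
Proof.
move=> c0; have cZ i : col i (c *: B) = c *: col i B.
  by apply/matrixP => a b; rewrite !mxE.
by rewrite /cols_lines /frame_lines !cZ !line_scale.
Qed.

Local Notation S := (transporter (cubic_surface C) (@octa_form k)).
Local Notation Rel g q := (exists B, [/\ B \in unitmx, g = scalar_class (invmx B) & q = cols_lines B]).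

Lemma transporter_frame B : B \in unitmx ->
  S (scalar_class (invmx B)) <-> octa_frame C (col i0 B) (col i1 B) (col i2 B) (col i3 B).
Proof.
move=> uB; rewrite -(octa_frameP triC nsC uB); split=> [[]//|h]; split=> //.
by exists (invmx B) => //=; rewrite unitmx_inv.
Qed.

Lemma octa_frameZ p0 p1 p2 p3 (s0 s1 s2 s3 : k) :
    f p0 = 0 -> f p1 = 0 -> f p2 = 0 -> f p3 = 0 ->
    D p0 p2 = 0 -> D p2 p0 = 0 -> D p1 p3 = 0 -> D p3 p1 = 0 ->
    D p1 p2 = 0 -> D p2 p1 = 0 -> D p0 p3 = 0 -> D p3 p0 = 0 ->
  octa_frame C (s0 *: p0) (s1 *: p1) (s2 *: p2) (s3 *: p3) <->
  [/\ s0 ^+ 2 * s1 * D p0 p1 != 0, s1 ^+ 2 * s0 * D p1 p0 = s0 ^+ 2 * s1 * D p0 p1,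
      s2 ^+ 2 * s3 * D p2 p3 = s0 ^+ 2 * s1 * D p0 p1 &
      s3 ^+ 2 * s2 * D p3 p2 = s0 ^+ 2 * s1 * D p0 p1].
Proof.
move=> f0 f1 f2 f3 D02 D20 D13 D31 D12 D21 D03 D30.
have DZ (s t : k) (p q : 'cV[k]_4) : D (s *: p) (t *: q) = s ^+ 2 * t * D p q.
  by rewrite (polar1Zl triC) (polar1Zr triC) mulrCA mulrA (mulrC t) .
rewrite /octa_frame !DZ !(cubicZ triC) f0 f1 f2 f3 D02 D20 D13 D31 D12 D21 D03 D30 !mulr0.
by split=> [[_ _ _ []]|[]].
Qed.

(** A frame on q has the form s0 p0, ..., s3 p3, and the projective class allows s0 = 1. The
    equalities give s1 = D(p0, p1) / D(p1, p0) and s3 = s2 D(p2, p3) / D(p3, p2), and the last one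
    prescribes the cube of s2. *)
Lemma has_card_transporter_fibre q : quadrilateral C q ->
  has_card (fun g => S g /\ Rel g q) (if 3%N \in [pchar k] then 1 else 3).
Proof.
move=> qq; have [p0 [p1 [p2 [p3 [F qE]]]]] := quadrilateral_frame triC dimV nsC qq.
have F' := free4_swap F; have F'' := free4_rev F; have F''' := free4_rev F'.
move: qq; rewrite qE => -[[_ l02] [_ l13] _ [[[_ l12] _ _] [[_ l03] _ _] _]].
have [a0 a2] := (@in_pair_l _ _ p0 p2, @in_pair_r _ _ p0 p2).
have [b1 b3] := (@in_pair_l _ _ p1 p3, @in_pair_r _ _ p1 p3).
have [t1 t2] := (@in_pair_l _ _ p1 p2, @in_pair_r _ _ p1 p2).
have [s0 s3] := (@in_pair_l _ _ p0 p3, @in_pair_r _ _ p0 p3).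
have pl := polar1_on_cubic triC.
have [f0 f1 f2 f3] := And4 (l02 _ a0) (l13 _ b1) (l02 _ a2) (l13 _ b3).
have [D02 D20 D13 D31] := And4 (pl _ _ _ l02 a0 a2) (pl _ _ _ l02 a2 a0)
  (pl _ _ _ l13 b1 b3) (pl _ _ _ l13 b3 b1).
have [D12 D21 D03 D30] := And4 (pl _ _ _ l12 t1 t2) (pl _ _ _ l12 t2 t1)
  (pl _ _ _ l03 s0 s3) (pl _ _ _ l03 s3 s0).
have D01 := frame_polar_neq0 triC dimV nsC F f0 D02 D03.
have D10 := frame_polar_neq0 triC dimV nsC F' f1 D13 D12.
have D23 := frame_polar_neq0 triC dimV nsC F'' f2 D20 D21.
have D32 := frame_polar_neq0 triC dimV nsC F''' f3 D31 D30.
have frameE r0 r1 r2 r3 := octa_frameZ r0 r1 r2 r3 f0 f1 f2 f3 D02 D20 D13 D31 D12 D21 D03 D30.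
(* The value of (s2 / s0)^3 obtained by eliminating s1 and s3 from the frame equations. *)
pose kap := D p0 p1 ^+ 2 / D p1 p0 * (D p3 p2 / D p2 p3 ^+ 2).
have kap0 : kap != 0 by rewrite !mulf_neq0 ?invr_neq0 ?expf_neq0.
pose N t := colmx p0 ((D p0 p1 / D p1 p0) *: p1) (t *: p2) ((t * (D p2 p3 / D p3 p2)) *: p3).
have N0 t : col i0 (N t) = 1 *: p0 by rewrite col_colmx // scale1r.
have N1 t : col i1 (N t) = (D p0 p1 / D p1 p0) *: p1 by rewrite col_colmx.
have N2 t : col i2 (N t) = t *: p2 by rewrite col_colmx.
have N3 t : col i3 (N t) = (t * (D p2 p3 / D p3 p2)) *: p3 by rewrite col_colmx.
have m0 : D p0 p1 / D p1 p0 != 0 by rewrite mulf_neq0 ?invr_neq0.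
have n0 : D p2 p3 / D p3 p2 != 0 by rewrite mulf_neq0 ?invr_neq0.
have unz t : t ^+ 3 = kap -> t != 0.
  by move=> e; apply: contraNneq kap0 => z; rewrite -e z expr0n.
have uN t : t ^+ 3 = kap -> N t \in unitmx.
  move=> /unz tn0; apply/free4_cols; rewrite N0 N1 N2 N3 => x0 x1 x2 x3.
  rewrite !scalerA mulr1 => /F[-> /eqP + /eqP + /eqP].
  rewrite !mulf_eq0 (negPf D01) invr_eq0 (negPf D10) (negPf tn0) invr_eq0 (negPf D23) (negPf D32).
  by rewrite !orbF => /eqP -> /eqP -> /eqP ->.
have inj : {in [set t : k | t ^+ 3 = kap] &, injective (fun t => scalar_class (invmx (N t)))}.
  move=> t t' /set_mem/= ht /set_mem/= ht' /(scalar_class_invmx (uN _ ht) (uN _ ht'))[c c0 e].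
  have cE i : col i (N t) = c *: col i (N t').
    by rewrite e; apply/matrixP => a b; rewrite !mxE.
  have := cE i0; rewrite !N0 !scale1r => h.
  have c1 : c = 1.
    apply/eqP; rewrite -subr_eq0; have [|/eqP -> //] := F (c - 1) 0 0 0.
    by rewrite scalerBl scale1r -h subrr !scale0r !addr0.
  have := cE i2; rewrite !N2 c1 scale1r => h2.
  apply/eqP; rewrite -subr_eq0; have [|_ _ /eqP -> //] := F 0 0 (t - t') 0.
  by rewrite scalerBl h2 subrr !scale0r !addr0.
apply: has_card_ext (has_card_image inj (has_card_cube_roots kap0)) => g; split.
  move=> [t tE <-]; have tn0 := unz _ tE; split.
    apply/(transporter_frame (uN _ tE)); rewrite N0 N1 N2 N3; apply/frameE; split.
    - by rewrite !mulf_neq0 // ?expf_neq0 ?oner_neq0 // ?invr_neq0.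
    - by field; rewrite D10.
    - rewrite (_ : _ * D p2 p3 = t ^+ 3 * (D p2 p3 ^+ 2 / D p3 p2)); last by ring.
      by rewrite tE /kap; field; rewrite D10 D23 D32.
    - rewrite (_ : _ * D p3 p2 = t ^+ 3 * (D p2 p3 ^+ 2 / D p3 p2)); last by field.
      by rewrite tE /kap; field; rewrite D10 D23 D32.
  exists (N t); split=> //; first exact: uN.
  rewrite /cols_lines N0 N1 N2 N3 /frame_lines !line_scale // ?oner_neq0 //.
  by rewrite mulf_neq0.
move=> [Sg [B [uB gE lE]]]; move: Sg; rewrite gE => /(transporter_frame uB).
have [r0 [r1 [r2 [r3 [c0 c1 c2 c3]]]]] := frame_lines_unique F (esym lE).
rewrite c0 c1 c2 c3 => /frameE[r01 e10 e23 e32].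
have r0n : r0 != 0 by apply: contraNneq r01 => ->; rewrite expr0n !mul0r.
have r1n : r1 != 0 by apply: contraNneq r01 => ->; rewrite mulr0 mul0r.
have r2n : r2 != 0 by apply: contraNneq r01 => z; rewrite -e23 z expr0n !mul0r.
have r3n : r3 != 0 by apply: contraNneq r01 => z; rewrite -e23 z mulr0 mul0r.
have r1E : r1 = r0 * (D p0 p1 / D p1 p0).
  apply: (mulIf D10); rewrite mulrA mulfVK //; apply: (mulfI r0n); apply: (mulfI r1n).
  by apply: etrans (etrans _ e10) (etrans _ _) => //; ring.
have r3E : r3 = r2 * (D p2 p3 / D p3 p2).
  apply: (mulIf D32); rewrite mulrA mulfVK //; apply: (mulfI r2n); apply: (mulfI r3n).
  by apply: etrans (etrans _ (etrans e32 (esym e23))) (etrans _ _) => //; ring.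
have BE : B = r0 *: N (r2 / r0).
  apply/matrixP => i j; suff : col j B = col j (r0 *: N (r2 / r0)).
    by move/matrixP/(_ i 0); rewrite !mxE.
  have cZ l M : col l (r0 *: M) = r0 *: col l M :> 'cV[k]_4.
    by apply/matrixP => a b; rewrite !mxE.
  have -> : j = inord j by rewrite inord_val.
  case: j => -[|[|[|[|j]]]] //= _; rewrite cZ ?N0 ?N1 ?N2 ?N3 ?c0 ?c1 ?c2 ?c3 scalerA.
  - by rewrite mulr1.
  - by rewrite -r1E.
  - by rewrite mulrC divfK.
  - by congr (_ *: _); rewrite r3E; field; rewrite ?r0n ?D32.
have tE : (r2 / r0) ^+ 3 = kap.
  rewrite expr_div_n; apply: (canLR (mulfK _)); first by rewrite expf_neq0.
  rewrite /kap; move: e23; rewrite r3E r1E => e.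
  apply: (mulIf (mulf_neq0 (mulf_neq0 D23 D23) (invr_neq0 D32))).
  apply: etrans (etrans _ e) (etrans _ _); first by ring.
    by reflexivity.
  by field; rewrite D10 D23 D32.
exists (r2 / r0) => //; rewrite BE scalar_class_invmxZ //.
exact: uN.
Qed.

Lemma has_card_transporter : has_card S (8640 * (if 3%N \in [pchar k] then 1 else 3)).
Proof.
have [U lU] := exists_line triC.
apply: (has_card_rel (R := fun g q => Rel g q) _ _ (has_card_quadrilateral triC dimV nsC lU)
  has_card_transporter_fibre).
  move=> g [[A uA <-] [a ea]].
  have uB : invmx A \in unitmx by rewrite unitmx_inv.
  have : S (scalar_class (invmx (invmx A))).
    by rewrite invmxK; split; [exists A|exists a].
  move=> /(transporter_frame uB)[[f0 f1 f2 f3] [D02 D20 D13 D31] [D12 D21 D03 D30] _].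
  exists (cols_lines (invmx A)); last by exists (invmx A); rewrite invmxK.
  by apply: (frame_quadrilateral triC) => //; apply/free4_cols.
move=> g q q' _ _ _ [B [uB -> ->]] [B' [uB' e ->]].
have [c c0 ->] := scalar_class_invmx uB uB' e.
exact: cols_linesZ.
Qed.

End Count.

(** * The number of octanomial parameters *)

Local Open Scope classical_set_scope.
Local Open Scope fset_scope.
Local Open Scope ring_scope.

Theorem mainTheorem3 (k : closedFieldType) (F : {mpoly k[4]})
    (F_cubic : F \is 3.-homog) (F_nonsingular : nonsingular F) :
  let X := surface F in
  [/\ finite_set (octanomial_parameters X),
      finite_set (surface_Aut X) &
      (#|` fset_set (octanomial_parameters X)|)%:R =
        (if 3%N \in [pchar k] then 8640%:R else 25920%:R)
        / (#|` fset_set (surface_Aut X)|)%:R :> rat].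
Proof.
have [C [triC cC pC]] := homog3_trilinear F_cubic.
have nsC := nonsingular_trilinear F_nonsingular cC pC.
move=> X; have XE : X = cubic_surface C by apply: surface_cubic.
set c := (if 3%N \in [pchar k] then 1 else 3)%N.
have cS : has_card (transporter X (@octa_form k)) (8640 * c).
  by rewrite XE; apply: has_card_transporter.
have N0 : (0 < 8640 * c)%N by rewrite muln_gt0 /c; case: ifP.
have [n [m [cP cA NE]]] := has_card_torsor triC (@octa_form_trilinear k) XE
  (@octa_surface_inj k) cS N0.
have {}cP : has_card (octanomial_parameters X) n.
  apply: has_card_ext cP => a; rewrite /targets /octanomial_parameters /=.
  by rewrite (surface_cubic (C := octa_form a)) // => v; apply: cubic_octa_form.
have [finP ->] := has_card_finite cP; have [finA ->] := has_card_finite cA.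
split=> //; have m0 : (m%:R : rat) != 0.
  by rewrite Num.Theory.pnatr_eq0; apply: contraTneq N0 => m0; rewrite NE m0 muln0.
apply: (canRL (mulfK m0)); rewrite -natrM -NE /c.
have e25920 : (8640 * 3)%N = 25920%N by vm_compute.
case: ifP => _; first (rewrite [X in X%:R = _]muln1; reflexivity).
rewrite [X in X%:R = _]e25920; reflexivity.
Qed.
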